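(* Let $F$ be a $C_1$-field, let $A$ be a finite-dimensional associative $F$-algebra of finite representation type, let $K/F$ be a field extension (not necessarily algebraic), and let $M$ be a finitely generated $A_K$-module. Assume further that $F$ is perfectly closed in $K$. Then $M$ has a minimal field of definition $F \subset K_0 \subset K$, and this $K_0$ satisfies $[K_0:F] < \infty$.
   Context: For a field extension $K/F$, $A_K := K \otimes_F A$. An intermediate field $F \subset K_0 \subset K$ is a field of definition for an $A_K$-module $M$ (equivalently, $M$ descends to $K_0$) if there exists a finitely generated $A_{K_0}$-module $M_0$ with $M \cong K \otimes_{K_0} M_0$ as $A_K$-modules. A field of definition $K_0$ of $M$ is minimal if whenever $M$ descends to an intermediate field $F \subset L \subset K$, we have $K_0 \subset L$. A field $F$ is a $C_1$-field if every homogeneous polynomial $f(x_1,\dots,x_n)$ with coefficients in $F$ of degree $d$ with $0<d<n$ has a non-trivial zero in $F^n$. $A$ is of finite representation type if there are only finitely many indecomposable finitely generated $A$-modules up to isomorphism. $F$ is perfectly closed in $K$ if for every subextension $F \subset E \subset K$ with $[E:F]<\infty$, $E$ is separable over $F$. *)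

(* Defs.v *)
From HB Require Import structures.
From mathcomp Require Import all_boot all_order all_algebra all_field.
From mathcomp Require Import boolp mpoly.

Set Implicit Arguments.
Unset Strict Implicit.
Unset Printing Implicit Defensive.

Import GRing.Theory.
Local Open Scope ring_scope.
Local Open Scope quotient_scope.

Definition fin_gen (R : pzRingType) (M : lmodType R) : Prop :=
  exists (n : nat) (e : 'I_n -> M),
    forall x : M, exists c : 'I_n -> R, x = \sum_i c i *: e i.

Definition iso_mod (R : pzRingType) (M N : lmodType R) : Prop :=
  exists f : {linear M -> N}, bijective f.

Definition zero_mod (R : pzRingType) (M : lmodType R) : Prop :=
  forall x : M, x = 0.

Definition indecomposable (R : pzRingType) (M : lmodType R) : Prop :=
  ~ zero_mod M /\
  forall N P : lmodType R, iso_mod M (N * P)%type -> zero_mod N \/ zero_mod P.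

Definition finite_rep_type (R : pzRingType) : Prop :=
  exists (n : nat) (S : 'I_n -> lmodType R),
    forall M : lmodType R, fin_gen M -> indecomposable M ->
      exists i, iso_mod M (S i).

(** Restriction of scalars of an [S]-module along [f : R -> S]. *)
Definition restr (R S : pzRingType) (f : {rmorphism R -> S}) (M : lmodType S)
  : Type := M.

Section Restr.
Variables (R S : pzRingType) (f : {rmorphism R -> S}) (M : lmodType S).

HB.instance Definition _ := GRing.Zmodule.on (restr f M).

Definition restr_scale (c : R) (x : restr f M) : restr f M :=
  (f c *: (x : M) : M).

Fact restr_scaleA a b x : restr_scale a (restr_scale b x) = restr_scale (a * b) x.
Proof. by rewrite /restr_scale scalerA rmorphM. Qed.
Fact restr_scale1 : left_id 1 restr_scale.
Proof. by move=> x; rewrite /restr_scale rmorph1 scale1r. Qed.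
Fact restr_scaleDr : right_distributive restr_scale +%R.
Proof. by move=> a x y; rewrite /restr_scale scalerDr. Qed.
Fact restr_scaleDl x : {morph restr_scale^~ x : a b / a + b}.
Proof. by move=> a b; rewrite /restr_scale rmorphD scalerDl. Qed.

HB.instance Definition _ := GRing.Zmodule_isLmodule.Build R (restr f M)
  restr_scaleA restr_scale1 restr_scaleDr restr_scaleDl.

Lemma restr_scaleE (c : R) (x : restr f M) : c *: x = (f c *: (x : M) : M).
Proof. by []. Qed.

End Restr.

(** Tensor product [K (x)_k V] along a field morphism [j : k -> K]

    Formal sums of pairs [(a, v)], represented by sequences, modulo the
    congruence generated by the tensor relations.  No separate rule for
    opposites is needed: [(a, v)] and [(- a, v)] add up to [(0, v)]. *)

Section Tensor.
Variables (k K : fieldType) (j : {rmorphism k -> K}) (V : lmodType k).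

Inductive tens_rel : seq (K * V) -> seq (K * V) -> Prop :=
| TensRefl s : tens_rel s s
| TensSym s t : tens_rel s t -> tens_rel t s
| TensTrans t s u : tens_rel s t -> tens_rel t u -> tens_rel s u
| TensCat s s' t t' :
    tens_rel s s' -> tens_rel t t' -> tens_rel (s ++ t) (s' ++ t')
| TensComm s t : tens_rel (s ++ t) (t ++ s)
| TensZero v : tens_rel [:: (0, v)] [::]
| TensAddl a b v : tens_rel [:: (a + b, v)] [:: (a, v); (b, v)]
| TensAddr a v w : tens_rel [:: (a, v + w)] [:: (a, v); (a, w)]
| TensBal a c v : tens_rel [:: (a * j c, v)] [:: (a, c *: v)].

Definition tens_eqb (s t : seq (K * V)) : bool := `[< tens_rel s t >].

Fact tens_eqb_refl : reflexive tens_eqb.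
Proof. by move=> s; apply/asboolP/TensRefl. Qed.
Fact tens_eqb_sym : ssrbool.symmetric tens_eqb.
Proof.
by move=> s t; apply/asboolP/asboolP => h; apply: TensSym.
Qed.
Fact tens_eqb_trans : transitive tens_eqb.
Proof.
by move=> t s u /asboolP h1 /asboolP h2; apply/asboolP; apply: TensTrans h1 h2.
Qed.

Canonical tens_equiv :=
  EquivRel tens_eqb tens_eqb_refl tens_eqb_sym tens_eqb_trans.

Definition tens : Type := {eq_quot tens_equiv}.
HB.instance Definition _ := Choice.on tens.
HB.instance Definition _ := EqQuotient.on tens.

Definition tpi (s : seq (K * V)) : tens := \pi_tens s.

(** The elementary tensor [a (x) v]. *)
Definition pure (a : K) (v : V) : tens := tpi [:: (a, v)].

Lemma tpi_eqP s t : tpi s = tpi t <-> tens_rel s t.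
Proof.
split; first by move/eqmodP/asboolP.
by move=> h; apply/eqmodP/asboolP.
Qed.

Lemma tpiK x : tpi (repr x) = x.
Proof. exact: reprK. Qed.

Definition tens_zero : tens := tpi [::].
Definition tens_add (x y : tens) : tens := tpi (repr x ++ repr y).
Definition tens_opp (x : tens) : tens :=
  tpi [seq (- p.1, p.2) | p <- repr x].

Lemma tens_addE s t : tens_add (tpi s) (tpi t) = tpi (s ++ t).
Proof. by apply/tpi_eqP/TensCat; apply/tpi_eqP; rewrite tpiK. Qed.

Fact tens_addA : associative tens_add.
Proof.
by move=> x y z; rewrite -(tpiK x) -(tpiK y) -(tpiK z) !tens_addE catA.
Qed.

Fact tens_addC : commutative tens_add.
Proof. by move=> x y; apply/tpi_eqP/TensComm. Qed.

Fact tens_add0 : left_id tens_zero tens_add.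
Proof. by move=> x; rewrite -(tpiK x) tens_addE. Qed.

Fact tens_addN : left_inverse tens_zero tens_opp tens_add.
Proof.
move=> x; rewrite -{2}(tpiK x) tens_addE; elim: (repr x) => //= -[a v] s IH /=.
have -> : (- a, v) :: [seq (- p.1, p.2) | p <- s] ++ (a, v) :: s =
  [:: (- a, v)] ++ ([seq (- p.1, p.2) | p <- s] ++ ([:: (a, v)] ++ s)) by [].
rewrite -!tens_addE [tens_add (tpi [seq _ | _ <- _]) _]tens_addA.
rewrite [tens_add (tpi [seq _ | _ <- _]) (tpi _)]tens_addC.
rewrite -[tens_add (tens_add _ _) _]tens_addA tens_addE IH.
rewrite tens_addA tens_addE /= [tens_add _ (tpi [::])]tens_addC tens_add0.
apply/tpi_eqP; apply: TensTrans (TensZero v).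
by rewrite -[in X in tens_rel _ X](addNr a); apply/TensSym/TensAddl.
Qed.

HB.instance Definition _ := GRing.isZmodule.Build tens
  tens_addA tens_addC tens_add0 tens_addN.

Lemma tpi_cat s t : tpi (s ++ t) = tpi s + tpi t.
Proof. by rewrite -tens_addE. Qed.

Lemma tpi_sum s : tpi s = \sum_(p <- s) pure p.1 p.2.
Proof.
elim: s => [|[a v] s IH]; first by rewrite big_nil.
by rewrite big_cons -IH -tpi_cat.
Qed.

Lemma tens_ind (P : tens -> Prop) :
  P 0 -> (forall a v, P (pure a v)) -> (forall x y, P x -> P y -> P (x + y)) ->
  forall x, P x.
Proof.
move=> P0 P1 PD x; rewrite -(tpiK x) tpi_sum.
elim: (repr x) => [|p s IH]; first by rewrite big_nil.
by rewrite big_cons; apply: PD.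
Qed.

Lemma pureDl v : {morph pure^~ v : a b / a + b}.
Proof. by move=> a b; rewrite -tpi_cat; apply/tpi_eqP/TensAddl. Qed.
Lemma pureDr a : {morph pure a : v w / v + w}.
Proof. by move=> v w; rewrite -tpi_cat; apply/tpi_eqP/TensAddr. Qed.
Lemma pure_bal a c v : pure (a * j c) v = pure a (c *: v).
Proof. exact/tpi_eqP/TensBal. Qed.

Section Lift.
Variable W : zmodType.

Definition balanced (f : K -> V -> W) : Prop :=
  [/\ forall v, {morph f^~ v : a b / a + b},
      forall a, {morph f a : v w / v + w}
    & forall a c v, f (a * j c) v = f a (c *: v)].

Definition tlift (f : K -> V -> W) (x : tens) : W :=
  \sum_(p <- repr x) f p.1 p.2.

Variable f : K -> V -> W.
Hypothesis fB : balanced f.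

Lemma tlift_tpi s : tlift f (tpi s) = \sum_(p <- s) f p.1 p.2.
Proof.
have [fl fr fc] := fB; rewrite /tlift.
suff gen u t : tens_rel u t ->
    \sum_(p <- u) f p.1 p.2 = \sum_(p <- t) f p.1 p.2.
  by apply/gen/tpi_eqP; rewrite tpiK.
elim=> {u t} [//|s1 t _ -> //|t s1 u _ -> _ -> //|s1 s2 t1 t2 _ IH1 _ IH2
  |s1 t|v|a b v|a v w|a c v].
- by rewrite !big_cat /= IH1 IH2.
- by rewrite !big_cat /= addrC.
- rewrite big_cons !big_nil addr0 /=.
  by apply: (addrI (f 0 v)); rewrite -(fl v) !addr0.
- by rewrite !big_cons !big_nil !addr0 /= fl.
- by rewrite !big_cons !big_nil !addr0 /= fr.
- by rewrite !big_cons !big_nil !addr0 /= fc.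
Qed.

Lemma tlift_pure a v : tlift f (pure a v) = f a v.
Proof. by rewrite tlift_tpi big_cons big_nil addr0. Qed.

Lemma tliftD : {morph tlift f : x y / x + y}.
Proof.
move=> x y; rewrite -[x]tpiK -[y]tpiK -tpi_cat !tlift_tpi.
by rewrite big_cat.
Qed.

Lemma tlift0 : tlift f 0 = 0.
Proof. by rewrite -[0]/(tpi [::]) tlift_tpi big_nil. Qed.

End Lift.

Definition tens_scale (c : K) : tens -> tens := tlift (fun a v => pure (c * a) v).

Fact tens_scale_bal c : balanced (fun a v => pure (c * a) v).
Proof.
split=> [v a b|a v w|a d v]; first by rewrite mulrDr pureDl.
- by rewrite pureDr.
- by rewrite mulrA pure_bal.
Qed.

Lemma tens_scale_pure c a v : tens_scale c (pure a v) = pure (c * a) v.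
Proof. exact/tlift_pure/tens_scale_bal. Qed.

Fact tens_scaleDr : right_distributive tens_scale +%R.
Proof. by move=> c; apply/tliftD/tens_scale_bal. Qed.
Fact tens_scale0 c : tens_scale c 0 = 0.
Proof. exact/tlift0/tens_scale_bal. Qed.
Fact tens_scaleA a b x : tens_scale a (tens_scale b x) = tens_scale (a * b) x.
Proof.
elim/tens_ind: x => [|c v|x y IH1 IH2]; first by rewrite !tens_scale0.
- by rewrite !tens_scale_pure mulrA.
- by rewrite !tens_scaleDr IH1 IH2.
Qed.
Fact tens_scale1 : left_id 1 tens_scale.
Proof.
elim/tens_ind => [|c v|x y IH1 IH2]; first by rewrite tens_scale0.
- by rewrite tens_scale_pure mul1r.
- by rewrite tens_scaleDr IH1 IH2.
Qed.
Fact tens_scaleDl x : {morph tens_scale^~ x : a b / a + b}.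
Proof.
move=> a b; elim/tens_ind: x => [|c v|x y IH1 IH2].
- by rewrite !tens_scale0 addr0.
- by rewrite !tens_scale_pure mulrDl pureDl.
- by rewrite !tens_scaleDr IH1 IH2 addrACA.
Qed.

HB.instance Definition _ := GRing.Zmodule_isLmodule.Build K tens
  tens_scaleA tens_scale1 tens_scaleDr tens_scaleDl.

Lemma scale_pure (c a : K) v : c *: pure a v = pure (c * a) v.
Proof. exact: tens_scale_pure. Qed.

End Tensor.

(** [A_K = K (x)_F A]. *)
Definition ext_alg (F K : fieldType) (iota : {rmorphism F -> K})
  (A : falgType F) : Type := tens iota A.

Section ExtAlg.
Variables (F K : fieldType) (iota : {rmorphism F -> K}) (A : falgType F).
Local Notation AK := (ext_alg iota A).

HB.instance Definition _ := GRing.Lmodule.on AK.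

Definition ext_pure (a : K) (x : A) : AK := pure iota a x.

Lemma ext_ind (P : AK -> Prop) :
  P 0 -> (forall a x, P (ext_pure a x)) ->
  (forall s t, P s -> P t -> P (s + t)) -> forall s, P s.
Proof. exact: tens_ind. Qed.

Lemma ext_scale_pure (c a : K) (x : A) :
  c *: ext_pure a x = ext_pure (c * a) x.
Proof. exact: scale_pure. Qed.

(** [(a (x) x) (b (x) y) = a b (x) x y]. *)
Definition ext_mul (s t : AK) : AK :=
  tlift (j := iota) (fun a x =>
    tlift (j := iota) (fun b y => ext_pure (a * b) (x * y)) t) s.

Fact ext_mul_bal1 a x : balanced iota (fun b y => ext_pure (a * b) (x * y)).
Proof.
split=> [y b c|b y z|b c y]; rewrite /ext_pure.
- by rewrite mulrDr pureDl.
- by rewrite mulrDr pureDr.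
- by rewrite mulrA pure_bal scalerAr.
Qed.

Fact ext_mul_bal2 t :
  balanced iota (fun a x =>
    tlift (j := iota) (fun b y => ext_pure (a * b) (x * y)) t).
Proof.
have B := ext_mul_bal1.
split=> [x a b|a x y|a c x]; elim/ext_ind: t => [|d z|u v IH1 IH2];
  rewrite ?(tlift0 (B _ _)) ?addr0 // ?(tlift_pure (B _ _)) ?(tliftD (B _ _));
  rewrite /ext_pure.
- by rewrite mulrDl pureDl.
- by rewrite IH1 IH2 addrACA.
- by rewrite mulrDl pureDr.
- by rewrite IH1 IH2 addrACA.
- by rewrite mulrAC pure_bal scalerAl.
- by rewrite IH1 IH2.
Qed.

Lemma ext_mul_pure a x b y :
  ext_mul (ext_pure a x) (ext_pure b y) = ext_pure (a * b) (x * y).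
Proof.
rewrite /ext_mul {1}/ext_pure (tlift_pure (ext_mul_bal2 _)).
exact: (tlift_pure (ext_mul_bal1 _ _)).
Qed.

Fact ext_mulDl : left_distributive ext_mul +%R.
Proof. by move=> s t u; apply: (tliftD (ext_mul_bal2 _)). Qed.
Fact ext_mul0l t : ext_mul 0 t = 0.
Proof. exact: (tlift0 (ext_mul_bal2 _)). Qed.
Fact ext_mul0r s : ext_mul s 0 = 0.
Proof.
elim/ext_ind: s => [|a x|s t IH1 IH2]; first exact: ext_mul0l.
- rewrite /ext_mul (tlift_pure (ext_mul_bal2 _)).
  exact: (tlift0 (ext_mul_bal1 _ _)).
- by rewrite ext_mulDl IH1 IH2 addr0.
Qed.
Fact ext_mulDr : right_distributive ext_mul +%R.
Proof.
move=> s t u; elim/ext_ind: s => [|a x|s1 s2 IH1 IH2].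
- by rewrite !ext_mul0l addr0.
- rewrite /ext_mul !(tlift_pure (ext_mul_bal2 _)).
  exact: (tliftD (ext_mul_bal1 _ _)).
- by rewrite !ext_mulDl IH1 IH2 addrACA.
Qed.

Fact ext_mulA : associative ext_mul.
Proof.
move=> s t u; elim/ext_ind: s => [|a x|s1 s2 IH1 IH2].
- by rewrite !ext_mul0l.
- elim/ext_ind: t => [|b y|t1 t2 IH1 IH2].
  + by rewrite !(ext_mul0l, ext_mul0r).
  + elim/ext_ind: u => [|c z|u1 u2 IH1 IH2].
    * by rewrite !ext_mul0r.
    * by rewrite !ext_mul_pure !mulrA.
    * by rewrite !ext_mulDr IH1 IH2.
  + by rewrite !(ext_mulDl, ext_mulDr) IH1 IH2.
- by rewrite !ext_mulDl IH1 IH2.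
Qed.

Definition ext_one : AK := ext_pure 1 1.

Fact ext_mul1 : left_id ext_one ext_mul.
Proof.
elim/ext_ind => [|a x|s t IH1 IH2]; first exact: ext_mul0r.
- by rewrite ext_mul_pure !mul1r.
- by rewrite ext_mulDr IH1 IH2.
Qed.
Fact ext_mulr1 : right_id ext_one ext_mul.
Proof.
elim/ext_ind => [|a x|s t IH1 IH2]; first exact: ext_mul0l.
- by rewrite ext_mul_pure !mulr1.
- by rewrite ext_mulDl IH1 IH2.
Qed.

Fact ext_one_neq0 : ext_one != 0.
Proof.
apply/eqP => e.
have [i i0] : exists i, coord (vbasis {:A}) i 1 != 0.
  apply/existsP; apply: contra_neqT (oner_neq0 A) => /existsPn h.
  rewrite (coord_vbasis (memvf 1)) big1 // => i _.
  by move/negbNE/eqP: (h i) => ->; rewrite scale0r.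
pose f a (x : A) := a * iota (coord (vbasis {:A}) i x).
have fB : balanced iota f.
  split=> [v a b|a v w|a c v]; rewrite /f.
  - by rewrite mulrDl.
  - by rewrite linearD rmorphD mulrDr.
  - by rewrite linearZ rmorphM mulrA.
have := tlift_pure fB 1 1; rewrite -/(ext_pure 1 1) -/ext_one e (tlift0 fB).
by move/esym/eqP; rewrite /f mul1r fmorph_eq0 (negPf i0).
Qed.

HB.instance Definition _ := GRing.Zmodule_isNzRing.Build AK
  ext_mulA ext_mul1 ext_mulr1 ext_mulDl ext_mulDr ext_one_neq0.

Lemma ext_pureM a x b y :
  ext_pure a x * ext_pure b y = ext_pure (a * b) (x * y).
Proof. exact: ext_mul_pure. Qed.

Fact ext_scaleAl (c : K) (s t : AK) : c *: (s * t) = (c *: s) * t.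
Proof.
elim/ext_ind: s => [|a x|s1 s2 IH1 IH2].
- by rewrite mul0r scaler0 mul0r.
- elim/ext_ind: t => [|b y|t1 t2 IH1 IH2].
  + by rewrite !mulr0 scaler0.
  + by rewrite !(ext_scale_pure, ext_pureM) mulrA.
  + by rewrite !mulrDr scalerDr IH1 IH2.
- by rewrite mulrDl !scalerDr mulrDl IH1 IH2.
Qed.

HB.instance Definition _ := GRing.Lmodule_isLalgebra.Build K AK ext_scaleAl.

Fact ext_scaleAr (c : K) (s t : AK) : c *: (s * t) = s * (c *: t).
Proof.
elim/ext_ind: s => [|a x|s1 s2 IH1 IH2].
- by rewrite !mul0r scaler0.
- elim/ext_ind: t => [|b y|t1 t2 IH1 IH2].
  + by rewrite scaler0 !mulr0 scaler0.
  + by rewrite !(ext_scale_pure, ext_pureM) mulrCA.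
  + by rewrite mulrDr !scalerDr mulrDr IH1 IH2.
- by rewrite !mulrDl scalerDr IH1 IH2.
Qed.

HB.instance Definition _ := GRing.Lalgebra_isAlgebra.Build K AK ext_scaleAr.

End ExtAlg.

(** The [A_K]-module [K (x)_L M0], for [F -> L -> K] and an [A_L]-module [M0]

    [M0] is an [L]-vector space through [in_alg : L -> A_L], and the action is
    [(a (x) x) (b (x) m) = a b (x) (1 (x) x) m]. *)

Definition ext_mod (F L K : fieldType) (i : {rmorphism F -> L})
  (j : {rmorphism L -> K}) (iota : {rmorphism F -> K})
  (ji : forall c, j (i c) = iota c)
  (A : falgType F) (M0 : lmodType (ext_alg i A)) : Type :=
  tens j (restr (in_alg (ext_alg i A)) M0).

Section ExtMod.
Variables (F L K : fieldType) (i : {rmorphism F -> L}).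
Variables (j : {rmorphism L -> K}) (iota : {rmorphism F -> K}).
Hypothesis ji : forall c, j (i c) = iota c.
Variables (A : falgType F) (M0 : lmodType (ext_alg i A)).
Local Notation AK := (ext_alg iota A).
Local Notation AL := (ext_alg i A).
Local Notation M0L := (restr (in_alg AL) M0).
Local Notation MK := (ext_mod ji M0).

HB.instance Definition _ := GRing.Zmodule.on MK.

Definition mod_pure (b : K) (m : M0) : MK := pure j b (m : M0L).

Lemma mod_ind (P : MK -> Prop) :
  P 0 -> (forall b m, P (mod_pure b m)) ->
  (forall s t, P s -> P t -> P (s + t)) -> forall s, P s.
Proof. exact: (@tens_ind _ _ j M0L P). Qed.

Definition ext_act (s : AK) (t : MK) : MK :=
  tlift (j := iota) (fun a x =>
    tlift (j := j) (fun b (m : M0L) => mod_pure (a * b) (ext_pure i 1 x *: (m : M0))) t) s.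

Fact ext_act_bal1 a x :
  balanced j (fun b (m : M0L) => mod_pure (a * b) (ext_pure i 1 x *: (m : M0))).
Proof.
split=> [m b c|b m n|b c m]; rewrite /mod_pure.
- by rewrite mulrDr pureDl.
- by rewrite scalerDr -pureDr.
- rewrite mulrA pure_bal !restr_scaleE; congr (pure _ _ _).
  by rewrite !scalerA /= -scalerAl -scalerAr mul1r mulr1.
Qed.

Fact ext_act_bal2 t : balanced iota (fun a x =>
  tlift (j := j) (fun b (m : M0L) => mod_pure (a * b) (ext_pure i 1 x *: (m : M0))) t).
Proof.
have B := ext_act_bal1.
split=> [x a b|a x y|a c x]; elim/mod_ind: t => [|d m|u v IH1 IH2];
  rewrite ?(tlift0 (B _ _)) ?addr0 // ?(tlift_pure (B _ _)) ?(tliftD (B _ _)).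
- by rewrite mulrDl /mod_pure pureDl.
- by rewrite IH1 IH2 addrACA.
- by rewrite /ext_pure pureDr scalerDl /mod_pure -pureDr.
- by rewrite IH1 IH2 addrACA.
- have e : (i c)%:A * ext_pure i 1 x = ext_pure i 1 (c *: x).
    by rewrite -scalerAl mul1r ext_scale_pure mulr1 -[i c]mul1r /ext_pure pure_bal.
  by rewrite -ji mulrAC /mod_pure pure_bal restr_scaleE scalerA /= e.
- by rewrite IH1 IH2.
Qed.

Lemma ext_act_pure a x b m :
  ext_act (ext_pure iota a x) (mod_pure b m) =
  mod_pure (a * b) (ext_pure i 1 x *: m).
Proof.
rewrite /ext_act (tlift_pure (ext_act_bal2 _)).
exact: (tlift_pure (ext_act_bal1 _ _)).
Qed.

Fact ext_actDl t : {morph ext_act^~ t : s u / s + u}.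
Proof. by move=> s u; apply: (tliftD (ext_act_bal2 _)). Qed.
Fact ext_act0l t : ext_act 0 t = 0.
Proof. exact: (tlift0 (ext_act_bal2 _)). Qed.
Fact ext_act0r s : ext_act s 0 = 0.
Proof.
elim/ext_ind: s => [|a x|s t IH1 IH2]; first exact: ext_act0l.
- rewrite /ext_act (tlift_pure (ext_act_bal2 _)).
  exact: (tlift0 (ext_act_bal1 _ _)).
- by rewrite ext_actDl IH1 IH2 addr0.
Qed.
Fact ext_actDr : right_distributive ext_act +%R.
Proof.
move=> s t u; elim/ext_ind: s => [|a x|s1 s2 IH1 IH2].
- by rewrite !ext_act0l addr0.
- rewrite /ext_act !(tlift_pure (ext_act_bal2 _)).
  exact: (tliftD (ext_act_bal1 _ _)).
- by rewrite !ext_actDl IH1 IH2 addrACA.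
Qed.
Fact ext_actA s t u : ext_act s (ext_act t u) = ext_act (s * t) u.
Proof.
elim/ext_ind: s => [|a x|s1 s2 IH1 IH2].
- by rewrite mul0r !ext_act0l.
- elim/ext_ind: t => [|b y|t1 t2 IH1 IH2].
  + by rewrite mulr0 ext_act0l ext_act0r.
  + elim/mod_ind: u => [|c m|u1 u2 IH1 IH2].
    * by rewrite !ext_act0r.
    * rewrite ext_pureM !ext_act_pure.
      by rewrite scalerA ext_pureM mulr1 mulrA.
    * by rewrite !ext_actDr IH1 IH2.
  + by rewrite mulrDr !ext_actDl ext_actDr IH1 IH2.
- by rewrite mulrDl !ext_actDl IH1 IH2.
Qed.
Fact ext_act1 : left_id 1 ext_act.
Proof.
elim/mod_ind => [|b m|s t IH1 IH2]; first exact: ext_act0r.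
- by rewrite ext_act_pure mul1r scale1r.
- by rewrite ext_actDr IH1 IH2.
Qed.

HB.instance Definition _ := GRing.Zmodule_isLmodule.Build AK MK
  ext_actA ext_act1 ext_actDr ext_actDl.

Lemma scale_mod_pure a x b m :
  ext_pure iota a x *: mod_pure b m = mod_pure (a * b) (ext_pure i 1 x *: m).
Proof. exact: ext_act_pure. Qed.

End ExtMod.

(** The intermediate fields of [iota : F -> K].  Boolean predicates lose no
    generality, the ambient logic being classical. *)
Record interfield (F K : fieldType) (iota : {rmorphism F -> K}) := Interfield {
  if_pred :> divringClosed K;
  if_base : forall c : F, iota c \in if_pred
}.

Definition if_sort (F K : fieldType) (iota : {rmorphism F -> K})
  (E : interfield iota) : Type := {x : K | x \in if_pred E}.

Section Interfield.
Variables (F K : fieldType) (iota : {rmorphism F -> K}) (E : interfield iota).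

HB.instance Definition _ := SubChoice.on (if_sort E).
HB.instance Definition _ :=
  [SubChoice_isSubIntegralDomain of if_sort E by <:].
HB.instance Definition _ :=
  [SubIntegralDomain_isSubField of if_sort E by <:].

Definition if_val : {rmorphism if_sort E -> K} := val.
Definition if_inj_fun (c : F) : if_sort E := Sub (iota c) (if_base E c).

Fact if_inj_zmod : zmod_morphism if_inj_fun.
Proof. by move=> a b; apply: val_inj; rewrite /= rmorphB. Qed.
Fact if_inj_monoid : monoid_morphism if_inj_fun.
Proof.
by split=> [|a b]; apply: val_inj; rewrite /= ?rmorph1 ?rmorphM.
Qed.
HB.instance Definition _ :=
  GRing.isZmodMorphism.Build F (if_sort E) if_inj_fun if_inj_zmod.
HB.instance Definition _ :=
  GRing.isMonoidMorphism.Build F (if_sort E) if_inj_fun if_inj_monoid.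

Definition if_inj : {rmorphism F -> if_sort E} := if_inj_fun.

Lemma if_injK c : if_val (if_inj c) = iota c.
Proof. by []. Qed.

End Interfield.

Definition finite_degree (F K : fieldType) (iota : {rmorphism F -> K})
  (E : interfield iota) : Prop :=
  fin_gen (restr (if_inj E) (if_sort E)^o).

(** Such a [p] is necessarily the minimal polynomial of [x] over [F]. *)
Definition separable_elt (F K : fieldType) (iota : {rmorphism F -> K}) (x : K)
  : Prop :=
  exists p : {poly F}, [/\ p \is monic, irreducible_poly p,
    root (map_poly iota p) x & separable_poly p].

Definition perfectly_closed (F K : fieldType) (iota : {rmorphism F -> K})
  : Prop :=
  forall E : interfield iota, finite_degree E ->
    forall x : K, x \in if_pred E -> separable_elt iota x.

Definition C1_field (F : fieldType) : Prop :=
  forall (n d : nat) (f : {mpoly F[n]}), (0 < d < n)%N -> f \is d.-homog ->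
    exists v : 'I_n -> F, (exists i, v i != 0) /\ f.@[v] = 0.

Section FieldOfDefinition.
Variables (F K : fieldType) (iota : {rmorphism F -> K}) (A : falgType F).
Variable M : lmodType (ext_alg iota A).

Definition field_of_definition (E : interfield iota) : Prop :=
  exists M0 : lmodType (ext_alg (if_inj E) A),
    fin_gen M0 /\ iso_mod M (ext_mod (if_injK E) M0).

Definition minimal_field_of_definition (E : interfield iota) : Prop :=
  field_of_definition E /\
  forall L : interfield iota, field_of_definition L ->
    {subset if_pred E <= if_pred L}.

End FieldOfDefinition.

(* Main.v *)
Require Import Defs.
From HB Require Import structures.
From mathcomp Require Import all_boot all_order all_algebra all_field perm.
From mathcomp Require Import boolp mpoly ring zify.

(* Modules over [A] and its scalar extensions are matrix representations on row vectors. Let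
   [N] be a representation of minimal dimension over [F] of which every other one is a
   summand of a power, [G = End N] and [J] its radical. Minimality of [N] and the C1 property
   (no division algebras: the characteristic form of a generic element of [G / J] factors
   into forms with too few zeros) make [G / J] a commutative reduced algebra; perfect
   closedness, with the fact that a C1 field has p-degree at most 1, keeps it reduced over
   every intermediate field [L]. There each module [M] is a direct sum of images
   [N_L h_0 + N_L h_1 + ...] of idempotents, [h_c] decreasing modulo [J_L]: [Hom (N_L, M)] is
   projective over [G_L] because every [A]-module is a union of summands of powers of [N].
   A rank count shows that the classes of the [h_c] modulo [J] depend on [M] only. So [M]
   descends to [L] if and only if these idempotents have coordinates in [L], and the
   coordinates of an idempotent of [K (x) G / J] are algebraic over [F]. *)

Set Implicit Arguments.
Unset Strict Implicit.
Unset Printing Implicit Defensive.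

Import GRing.Theory.
Local Open Scope ring_scope.

(** * The radical of a matrix algebra *)

(** Commutativity of [G / J] is what makes descent rigid. In general a summand of a power of [N_L]
    is a conjugacy class of idempotent matrices, and such a class may be defined over a field
    without containing an idempotent over it; division algebras are the obstruction. Once [G / J] is
    commutative, the class of [h_c] modulo [J] is a single point, whose coordinates can be compared
    over different fields. The nesting singles out one decomposition among many: without it, images
    of orthogonal idempotents could be regrouped. Minimality of [N] removes repeated summands from
    [N], hence matrix blocks from [G / J], which leaves only division algebras for C1 to exclude.
    Perfect closedness yields directly only that an element of [F] that is not a p-th power does not
    become one in [K], while reducedness over [K] needs p-independent elements of [F] to stay
    independent over [K^p]. For p-degree at most 1 the former implies the latter; that bound comes
    from the zeros of forms of degree [p] in [p + 1] variables. *)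

Section NonUnital.
Variables (k : fieldType) (n : nat).
Implicit Types (x y e w : 'M[k]_n) (S : 'M[k]_n -> Prop).

(** No unit is required, so that radicals, ideals and corners [e S e] qualify. *)
Definition nualg S := [/\ S 0, forall x y, S x -> S y -> S (x + y),
  forall c x, S x -> S (c *: x) & forall x y, S x -> S y -> S (x *m y)].

Definition nilmx x := exists s, x ^+ s = 0.

Lemma nualg_sum S (I : Type) (r : seq I) (P : pred I) (f : I -> 'M[k]_n) :
  nualg S -> (forall i, P i -> S (f i)) -> S (\sum_(i <- r | P i) f i).
Proof. by move=> [S0 SD _ _] Sf; apply: (big_ind S S0 SD). Qed.

Lemma nualgN S x : nualg S -> S x -> S (- x).
Proof. by case=> _ _ SZ _ Sx; rewrite -scaleN1r; apply: SZ. Qed.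

Lemma nualgB S x y : nualg S -> S x -> S y -> S (x - y).
Proof. by move=> nS Sx Sy; have [_ SD _ _] := nS; apply: SD => //; apply: nualgN. Qed.

Lemma nualgX S x i : nualg S -> S x -> S (x ^+ i.+1).
Proof.
move=> [_ _ _ SM] Sx; elim: i => [|i IH]; first by rewrite expr1.
by rewrite exprS; apply: SM.
Qed.

End NonUnital.

(* Bezout for the factorisation ['X^a * q], [q(0) != 0], of the characteristic
   polynomial gives [w]; taking the exponent of ['X] at least 2 keeps [w] in the
   non-unital algebra generated by [x]. *)
Lemma fitting (k : fieldType) n (S : 'M[k]_n -> Prop) (x : 'M[k]_n) :
  nualg S -> S x ->
  exists w, [/\ S w, x *m w = w *m x, x *m w *m (x *m w) = x *m w
    & exists s, x ^+ s *m (1%:M - x *m w) = 0].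
Proof.
case: n S x => [|n] S x nS Sx.
  have [S0 _ _ _] := nS.
  by exists 0; split => //; [rewrite [LHS]flatmx0 [RHS]flatmx0|
    rewrite [LHS]flatmx0 [RHS]flatmx0|exists 0%N; rewrite [LHS]flatmx0].
have [m [q q0 ep]] := multiplicity_XsubC (char_poly x) 0.
rewrite (monic_neq0 (char_poly_monic x)) /= in q0.
rewrite polyC0 subr0 in ep.
have cop : coprimep ('X^(m.+2)) q.
  by rewrite coprimep_sym; apply: coprimep_expr; rewrite -(subr0 'X) -polyC0 coprimep_XsubC.
have [[u v] /= uv1] := Bezout_eq1_coprimepP _ _ cop.
have hXq : horner_mx x ('X^(m.+2) * q) = 0.
  have -> : 'X^(m.+2) * q = char_poly x * 'X^2 by rewrite ep -[RHS]mulrA -(exprD 'X m 2) addn2 mulrC.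
  by rewrite rmorphM /= Cayley_Hamilton mul0r.
exists (horner_mx x (u * 'X^(m.+1))).
have xw : x *m horner_mx x (u * 'X^(m.+1)) = horner_mx x (u * 'X^(m.+2)).
  by rewrite -{1}[x]horner_mx_X -[_ *m _]rmorphM /= mulrCA -exprS.
have wx : horner_mx x (u * 'X^(m.+1)) *m x = horner_mx x (u * 'X^(m.+2)).
  by rewrite -[X in _ *m X = _]horner_mx_X -[_ *m _]rmorphM /= -mulrA -exprSr.
have e1 : 1%:M - horner_mx x (u * 'X^(m.+2)) = horner_mx x (v * q).
  by rewrite -[1%:M](rmorph1 (horner_mx x)) -uv1 rmorphD /= addrC addKr.
split.
- rewrite -[u]coefK poly_def mulr_suml rmorph_sum /=.
  apply: nualg_sum => // i _; rewrite -scalerAl -exprD addnS.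
  rewrite horner_mxZ rmorphXn /= horner_mx_X.
  by have [_ _ SZ _] := nS; apply: SZ; apply: nualgX.
- by rewrite xw wx.
- rewrite xw; apply/eqP; rewrite -subr_eq0 -opprB oppr_eq0.
  rewrite -{1}[horner_mx x _]mulmx1 -mulmxBr e1 -[_ *m _]rmorphM /=.
  have -> : u * 'X^(m.+2) * (v * q) = (u * v) * ('X^(m.+2) * q).
    by rewrite mulrACA.
  by rewrite rmorphM /= hXq mulr0.
- exists m.+2; rewrite xw e1 -{1}[x]horner_mx_X -rmorphXn -[_ *m _]rmorphM /=.
  by rewrite mulrCA rmorphM /= hXq mulr0.
Qed.

(** Take [U] of maximal rank with row space inside [Q]: a vector of [Q] outside it could be
    appended. This gives a rank and a basis to subspaces described by a predicate, such as
    homomorphisms or a radical. *)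
Lemma subspace_mx (k : fieldType) N (Q : 'rV[k]_N -> Prop) :
  Q 0 -> (forall u v, Q u -> Q v -> Q (u + v)) ->
  (forall c u, Q u -> Q (c *: u)) ->
  exists U : 'M[k]_N, forall u : 'rV_N, (u <= U)%MS <-> Q u.
Proof.
move=> Q0 QD QZ.
pose P r := `[< exists U : 'M[k]_N, (forall u : 'rV_N, (u <= U)%MS -> Q u) /\ \rank U = r >].
have exP : exists r, P r.
  exists 0%N; apply/asboolP; exists 0; split=> [u|]; last exact: mxrank0.
  by rewrite submx0 => /eqP ->.
have ubP r : P r -> (r <= N)%N by case/asboolP=> U [_ <-]; exact: rank_leq_row.
case: (ex_maxnP exP ubP) => r /asboolP[U [QU rU]] max.
exists U => u; split=> [|Qu]; first exact: QU.
apply/negP => /negP nuU.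
have : P (\rank (U + u)%MS).
  apply/asboolP; exists (U + u)%MS; split=> // w.
  case/sub_addsmxP=> [[a b]] /= ->; apply: QD; first by apply: QU; exact: submxMl.
  by rewrite [b]mx11_scalar mul_scalar_mx; exact: QZ.
move/max; rewrite -rU leqNgt ltn_neqAle mxrankS ?addsmxSl // andbT negbK.
rewrite (mxrank_leqif_eq (addsmxSl U u)) => /eqmxP/eqmx_sym e.
by move: nuU; rewrite -e addsmxSr.
Qed.

Lemma exprMM (k : fieldType) m n (x : 'M[k]_(m, n)) (y : 'M[k]_(n, m)) s :
  (x *m y) ^+ s.+1 = x *m (y *m x) ^+ s *m y.
Proof.
elim: s => [|s IH]; first by rewrite expr1 expr0 mulmx1.
by rewrite exprS IH (exprS (y *m x)) -![_ * _]/(_ *m _) !mulmxA.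
Qed.

Lemma nilM (k : fieldType) m n (x : 'M[k]_(m, n)) (y : 'M[k]_(n, m)) : nilmx (x *m y) -> nilmx (y *m x).
Proof.
by case=> s xy0; exists s.+1; rewrite exprMM xy0 mulmx0 mul0mx.
Qed.

Definition lie (R : pzRingType) n (x y : 'M[R]_n) := x *m y - y *m x.

Lemma lieN (R : pzRingType) n (x y : 'M[R]_n) : lie x y = - lie y x.
Proof. by rewrite /lie opprB. Qed.

Lemma lieDl (R : pzRingType) n (x x' y : 'M[R]_n) : lie (x + x') y = lie x y + lie x' y.
Proof. by rewrite /lie mulmxDl mulmxDr opprD addrACA. Qed.

Lemma lieDr (R : pzRingType) n (x y y' : 'M[R]_n) : lie x (y + y') = lie x y + lie x y'.
Proof. by rewrite lieN lieDl opprD -!lieN. Qed.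

Lemma lieZl (R : comPzRingType) n c (x y : 'M[R]_n) : lie (c *: x) y = c *: lie x y.
Proof. by rewrite /lie -scalemxAl -scalemxAr scalerBr. Qed.

Lemma lieZr (R : comPzRingType) n c (x y : 'M[R]_n) : lie x (c *: y) = c *: lie x y.
Proof. by rewrite lieN lieZl -scalerN -lieN. Qed.

Lemma lie_scalar (R : comPzRingType) n c (x : 'M[R]_n) : lie c%:M x = 0.
Proof. by rewrite /lie scalar_mxC subrr. Qed.

Section Radical.
Variables (k : fieldType) (n : nat) (S : 'M[k]_n -> Prop).
Hypotheses (nS : nualg S) (S1 : S 1%:M).

Let S0 : S 0. Proof. by case: nS. Qed.
Let SD x y : S x -> S y -> S (x + y). Proof. by case: nS => _ + _ _; apply. Qed.
Let SZ c x : S x -> S (c *: x). Proof. by case: nS => _ _ + _; apply. Qed.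
Let SM x y : S x -> S y -> S (x *m y). Proof. by case: nS => _ _ _ +; apply. Qed.

(** The Jacobson radical: in a finite-dimensional algebra, [x] belongs to it exactly when the right
    ideal [x S] is nil. *)
Definition rad x := S x /\ forall y, S y -> nilmx (x *m y).

Lemma radS x : rad x -> S x. Proof. by case. Qed.

Lemma rad_nil x : rad x -> nilmx x.
Proof. by case=> _ /(_ _ S1); rewrite mulmx1. Qed.

Lemma radMr x y : rad x -> S y -> rad (x *m y).
Proof.
move=> [Sx Nx] Sy; split=> [|z Sz]; first exact: SM.
by rewrite -mulmxA; apply/Nx/SM.
Qed.

Lemma radMl x y : rad x -> S y -> rad (y *m x).
Proof.
move=> [Sx Nx] Sy; split=> [|z Sz]; first exact: SM.
by apply: nilM; rewrite mulmxA; apply: nilM; rewrite mulmxA -mulmxA; apply/Nx/SM.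
Qed.

Lemma rad0 : rad 0.
Proof. by split=> // y _; exists 1%N; rewrite mul0mx expr1. Qed.

Lemma radZ c x : rad x -> rad (c *: x).
Proof.
move=> [Sx Nx]; split=> [|y Sy]; first exact: SZ.
by rewrite -scalemxAl scalemxAr; apply/Nx/SZ.
Qed.

(** In the algebra with unit [e], [e - a] is invertible because [a] is nilpotent; being nilpotent as
    well, it forces [e = 0]. *)
Lemma nil_idem_sub (e a : 'M[k]_n) : e *m e = e -> e *m a = a -> a *m e = a ->
  nilmx a -> nilmx (e - a) -> e = 0.
Proof.
move=> ee ea ae [s as0] [t bt0].
have e1 : e *m (1%:M - a) = e - a by rewrite mulmxBr mulmx1 ea.
have c1 : GRing.comm e (1%:M - a).
  by rewrite /GRing.comm -![_ * _]/(_ *m _) mulmxBr mulmxBl mul1mx mulmx1 ea ae.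
have eX u : e ^+ u.+1 = e.
  by elim: u => [|u IH]; rewrite ?expr1 // exprS IH.
have h := subrX1 a s; rewrite as0 sub0r in h.
set b := \sum_(i < s) _ in h.
have h1 : (1 - a) * b = 1 by rewrite -opprB mulNr -h opprK.
have hb u : (1 - a) ^+ u * b ^+ u = 1.
  elim: u => [|u IH]; first by rewrite !expr0 mulr1.
  by rewrite exprSr exprS mulrA -[_ * _ * b]mulrA h1 mulr1.
case: t bt0 => [|t] bt0.
  by move/(congr1 (mulmx e)): bt0; rewrite expr0 mulmx1 mulmx0.
move: bt0; rewrite -e1 -[e *m _]/(e * _) exprMn_comm // eX => bt0.
by rewrite -[e]mulr1 -(hb t.+1) mulrA bt0 mul0r.
Qed.

Lemma idem_notnil (x : 'M[k]_n) : S x -> ~ nilmx x ->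
  exists w, [/\ S w, x *m w = w *m x, x *m w *m (x *m w) = x *m w & x *m w <> 0].
Proof.
move=> Sx nx; have [w [Sw c i [s h]]] := fitting nS Sx.
exists w; split=> // e0; apply: nx; exists s.
by move: h; rewrite e0 subr0 mulmx1.
Qed.

(** If [(x + y) z] were not nilpotent, Fitting would give a nonzero idempotent [e] in the right
    ideal it generates. Cut down by [e], the parts coming from [x] and from [y] are two nilpotents
    with sum [e], against [nil_idem_sub]. *)
Lemma radD x y : rad x -> rad y -> rad (x + y).
Proof.
move=> [Sx Nx] [Sy Ny]; split=> [|z Sz]; first exact: SD.
apply: contrapT => /(idem_notnil (SM (SD Sx Sy) Sz)) [w [Sw _ ee]]; apply.
have [e Ee] : {e | e = (x + y) *m z *m w} by exists ((x + y) *m z *m w).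
rewrite -Ee in ee *.
have Se : S e by rewrite Ee; apply: SM => //; apply: SM => //; apply: SD.
have [a Ea] : {a | a = e *m x *m z *m w *m e} by exists (e *m x *m z *m w *m e).
have aE : e - a = e *m y *m z *m w *m e.
  have {1}-> : e = e *m e *m e by rewrite !ee.
  rewrite {2}Ee Ea !(mulmxDl, mulmxDr) !mulmxA.
  by rewrite addrAC subrr add0r.
apply: (@nil_idem_sub e a) => //.
- by rewrite Ea !mulmxA ee.
- by rewrite Ea -!mulmxA ee.
- rewrite Ea -!mulmxA; apply: nilM; rewrite -!mulmxA; apply: Nx.
  by do !apply: SM.
- rewrite aE -!mulmxA; apply: nilM; rewrite -!mulmxA; apply: Ny.
  by do !apply: SM.
Qed.

Lemma nualg_rad : nualg rad.
Proof.
split; [exact: rad0|exact: radD|exact: radZ|].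
by move=> x y rx /radS; apply: radMr.
Qed.

Lemma rad_lie x y : rad x -> S y -> rad (lie x y).
Proof.
move=> rx Sy; have [_ JD _ _] := nualg_rad.
by apply: JD; [exact: radMr|apply: (nualgN nualg_rad); exact: radMl].
Qed.

Lemma nil_unit (a : 'M[k]_n) : nilmx a -> (1%:M - a) \in unitmx.
Proof.
case=> s as0.
have h := subrX1 a s; rewrite as0 sub0r in h.
have h1 : (1 - a) * (\sum_(i < s) a ^+ i) = 1 by rewrite -opprB mulNr -h opprK.
by have [] := mulmx1_unit h1.
Qed.

Definition stable (V : 'M[k]_n) := forall x, S x -> (V *m x <= V)%MS.

Lemma stable_sub V (v : 'rV_n) x : stable V -> S x -> (v <= V)%MS -> (v *m x <= V)%MS.
Proof. by move=> sV Sx vV; apply: submx_trans (submxMr _ vV) (sV _ Sx). Qed.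

(** Nakayama: for [V'] a proper stable subspace of maximal rank, [V / V'] is simple. If [v x] were
    outside [V'], some [y] would give [v x y = v] modulo [V'], and inverting [1 - x y] would put [v]
    in [V']. *)
Lemma rad_step (V : 'M[k]_n) : stable V -> V != 0 ->
  exists V' : 'M[k]_n, [/\ stable V', (V' < V)%MS & forall x, rad x -> (V *m x <= V')%MS].
Proof.
move=> sV V0.
pose P r := `[< exists V' : 'M[k]_n, [/\ stable V', (V' < V)%MS & \rank V' = r] >].
have exP : exists r, P r.
  exists 0%N; apply/asboolP; exists 0; split; rewrite ?mxrank0 // ?lt0mx //.
  by move=> x _; rewrite mul0mx.
have ubP r : P r -> (r <= n)%N by case/asboolP=> U [_ _ <-]; exact: rank_leq_row.
case: (ex_maxnP exP ubP) => r /asboolP[V' [sV' ltV rV']] max.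
have leV : (V' <= V)%MS by case/andP: ltV.
exists V'; split=> // x rx; apply/rV_subP => u uVx.
have [v vV ->] : exists2 v, (v <= V)%MS & u = v *m x.
  by case/submxP: uVx => D ->; exists (D *m V); rewrite ?submxMl // mulmxA.
(* By maximality of the rank, every [w] of [V] outside [V'] generates [V] modulo [V']. *)
have gen (w : 'rV_n) : (w <= V)%MS -> ~~ (w <= V')%MS ->
    forall z : 'rV_n, (z <= V)%MS -> exists2 y, S y & (z - w *m y <= V')%MS.
  move=> wV wV'.
  have [|||U HU] := @subspace_mx k n (fun z => exists2 y, S y & (z - w *m y <= V')%MS).
  - by exists 0; rewrite // mulmx0 subr0 sub0mx.
  - move=> z1 z2 [y1 S1' h1] [y2 S2' h2]; exists (y1 + y2); first exact: SD.
    by rewrite mulmxDr opprD addrACA; apply: addmx_sub.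
  - move=> c z [y Sy h]; exists (c *: y); first exact: SZ.
    by rewrite -scalemxAr -scalerBr; apply: scalemx_sub.
  move=> z zV; apply/HU; apply: submx_trans zV _.
  have UV : (U <= V)%MS.
    apply/rV_subP => z' /HU[y Sy h]; rewrite -(subrK (w *m y) z').
    by apply: addmx_sub; [exact: submx_trans leV|exact: stable_sub].
  have V'U : (V' <= U)%MS.
    by apply/rV_subP => z' h; apply/HU; exists 0; rewrite // mulmx0 subr0.
  have wU : (w <= U)%MS by apply/HU; exists 1%:M; rewrite // mulmx1 subrr sub0mx.
  have sU : stable U.
    move=> y Sy; apply/rV_subP => z' /submxP[D ->]; apply/HU.
    have /HU[y' Sy' h] : (D *m U <= U)%MS by exact: submxMl.
    exists (y' *m y); first exact: SM.
    by rewrite !mulmxA -mulmxBl; apply: stable_sub.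
  apply: contraT => nVU.
  have : P (\rank U) by apply/asboolP; exists U; split=> //; rewrite /ltmx UV.
  move/max; rewrite -rV' leqNgt => /negP; case.
  rewrite ltn_neqAle mxrankS // andbT (mxrank_leqif_eq V'U).
  by apply: contra wV' => /eqmxP ->.
apply: contraT => nux.
have vV' : ~~ (v <= V')%MS by apply: contra nux => h; apply: stable_sub => //; exact: radS.
have [y Sy] := gen _ (stable_sub sV (radS rx) vV) nux _ vV.
rewrite -mulmxA -{1}[v]mulmx1 -mulmxBr.
have rxy := radMr rx Sy; have U1 := nil_unit (rad_nil rxy).
move=> h; have : (v *m (1%:M - x *m y) *m invmx (1%:M - x *m y) <= V')%MS.
  apply: stable_sub => //.
  have [s xys] := rad_nil rxy.
  (* The inverse is a geometric series in [x y], hence lies in [S] and preserves [V']. *)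
  have -> : invmx (1%:M - x *m y) = \sum_(i < s) (x *m y) ^+ i.
    have h' := subrX1 (x *m y) s; rewrite xys sub0r in h'.
    have h1 : (1 - x *m y) *m (\sum_(i < s) (x *m y) ^+ i) = 1.
      by rewrite -[_ *m (\sum_ _ _)]/(_ * _) -opprB mulNr -h' opprK.
    by apply: (can_inj (mulKmx U1)); rewrite h1 mulmxV.
  apply: nualg_sum => // i _; case: (val i) => [|j]; first by rewrite expr0.
  by apply: nualgX => //; apply: radS.
by rewrite mulmxK // (negPf vV').
Qed.

(** Nilpotency of the radical as an ideal, in a form that survives extension of scalars: each
    inclusion in the flag is a matrix identity over [k]. *)
Lemma rad_flag : exists s (W : nat -> 'M[k]_n), [/\ W 0%N = 1%:M, W s = 0 &
  forall i x, rad x -> (W i *m x <= W i.+1)%MS].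
Proof.
suff gen r (V : 'M[k]_n) : stable V -> (\rank V <= r)%N ->
    exists s (W : nat -> 'M[k]_n), [/\ W 0%N = V, W s = 0 &
      forall i x, rad x -> (W i *m x <= W i.+1)%MS].
  by apply: (gen n); [move=> x _; rewrite submx1|exact: rank_leq_row].
elim: r V => [|r IH] V sV rV; have [V0|V0] := eqVneq V 0.
- by exists 0%N, (fun=> 0); split=> // i x _; rewrite mul0mx.
- by move: V0; rewrite -mxrank_eq0 -leqn0 rV.
- by exists 0%N, (fun=> 0); split=> // i x _; rewrite mul0mx.
have [V' [sV' ltV h]] := rad_step sV V0.
have [|s [W [W0 Ws hW]]] := IH V' sV'.
  by move: ltV; rewrite ltmxErank => /andP[_ lt]; rewrite -ltnS (leq_trans lt).
by exists s.+1, (fun i => if i is i'.+1 then W i' else V); split=> // -[|i] x rx;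
  rewrite ?W0; [exact: h|exact: hW].
Qed.

End Radical.

(** * Gauss's lemma and forms *)

Section Divides.
Variable R : idomainType.
Implicit Types a b c d p x : R.

Definition divides d a := exists q, a = d * q.

Definition prime_elt p :=
  [/\ p != 0, p \isn't a GRing.unit
    & forall a b, divides p (a * b) -> divides p a \/ divides p b].

(** The factors are prime, not merely irreducible, so that the existence of such factorisations
    already expresses unique factorisation. *)
Definition factored x := exists u s, [/\ u \is a GRing.unit,
  forall p, p \in s -> prime_elt p & x = u * \prod_(p <- s) p].

Lemma factoredM x y : factored x -> factored y -> factored (x * y).
Proof.
move=> [u [s [Uu Ps ->]]] [v [t [Uv Pt ->]]]; exists (u * v), (s ++ t); split.
- by rewrite unitrM Uu.
- by move=> p; rewrite mem_cat => /orP[]; [exact: Ps|exact: Pt].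
- by rewrite big_cat /= mulrACA.
Qed.

Lemma prime_factored p : prime_elt p -> factored p.
Proof.
move=> Pp; exists 1, [:: p]; split; first exact: unitr1.
  by move=> q; rewrite inE => /eqP ->.
by rewrite big_seq1 mul1r.
Qed.

Lemma unit_factored u : u \is a GRing.unit -> factored u.
Proof. by move=> Uu; exists u, [::]; rewrite big_nil mulr1. Qed.

Lemma divides_trans a b c : divides a b -> divides b c -> divides a c.
Proof. by move=> [q ->] [r ->]; exists (q * r); rewrite mulrA. Qed.

Lemma divides_mulr a b c : divides a b -> divides a (b * c).
Proof. by move=> [q ->]; exists (q * c); rewrite mulrA. Qed.

Lemma divides_mull a b c : divides a b -> divides a (c * b).
Proof. by rewrite mulrC; apply: divides_mulr. Qed.

Lemma divides_add a b c : divides a b -> divides a c -> divides a (b + c).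
Proof. by move=> [q ->] [r ->]; exists (q + r); rewrite mulrDr. Qed.

Lemma divides_opp a b : divides a b -> divides a (- b).
Proof. by move=> [q ->]; exists (- q); rewrite mulrN. Qed.

Lemma divides0 a : divides a 0.
Proof. by exists 0; rewrite mulr0. Qed.

Lemma prime_prod p u s : prime_elt p -> u \is a GRing.unit ->
  divides p (u * \prod_(q <- s) q) -> exists2 q, q \in s & divides p q.
Proof.
move=> [p0 pU pP] Uu; elim: s => [|q s IH].
  rewrite big_nil mulr1 => -[v uE]; move: Uu.
  by rewrite uE unitrM (negPf pU).
rewrite big_cons mulrCA => /pP[h|/IH [r rs h]].
  by exists q; rewrite ?mem_head.
by exists r; rewrite // in_cons rs orbT.
Qed.

Lemma prime_assoc p q : prime_elt p -> prime_elt q -> divides p q -> divides q p.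
Proof.
move=> [p0 pU _] [q0 qU qP] [r e].
have /qP[//|[t rE]] : divides q (p * r) by exists 1; rewrite mulr1.
have : q * (1 - p * t) = 0 by rewrite mulrBr mulr1 {1}e rE mulrCA mulrA subrr.
move/eqP; rewrite mulf_eq0 (negPf q0) /= subr_eq0 => /eqP h.
by case/negP: pU; apply/unitrP; exists t; rewrite mulrC -h.
Qed.

End Divides.

Definition factorial (R : idomainType) := forall x : R, x != 0 -> factored x.

Lemma factorial_field (F : fieldType) : factorial F.
Proof. by move=> x x0; apply: unit_factored; rewrite unitfE. Qed.

Section PolyFactorial.
Variable R : idomainType.
Implicit Types f g h a b : {poly R}.

Lemma divides_lead (c : R) f : divides c%:P f -> divides c (lead_coef f).
Proof. by move=> [q ->]; exists (lead_coef q); rewrite lead_coefM lead_coefC. Qed.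

Lemma unit_polyC (u : R) : u \is a GRing.unit -> u%:P \is a @GRing.unit {poly R}.
Proof.
move=> Uu; have u0 : u != 0 by apply: contraTneq Uu => ->; rewrite unitr0.
by rewrite poly_unitE coefC /= Uu size_polyC u0.
Qed.

(* Gauss: strip the leading terms. *)
Lemma prime_polyC (p : R) : prime_elt p -> prime_elt p%:P.
Proof.
move=> [p0 pU pP]; split; first by rewrite polyC_eq0.
  by apply: contra pU; rewrite poly_unitE coefC => /andP[].
move=> f g; move en: (size f + size g)%N => n.
elim/ltn_ind: n f g en => n IH f g en dfg.
have [->|f0] := eqVneq f 0; first by left; exact: divides0.
have [->|g0] := eqVneq g 0; first by right; exact: divides0.
have lt_tail h : h != 0 -> (size (h - lead_coef h *: 'X^((size h).-1))%R < size h)%N.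
  move=> h0; have hs : (0 < size h)%N by rewrite size_poly_gt0.
  rewrite -{2}(prednK hs) ltnS; apply/leq_sizeP => i le.
  rewrite coefB coefZ coefXn; case: eqP => [->|/eqP ne].
    by rewrite mulr1 lead_coefE subrr.
  rewrite mulr0 subr0 nth_default // -(prednK hs) ltn_neqAle le andbT.
  by rewrite eq_sym.
have dlead h : divides p (lead_coef h) -> divides p%:P (lead_coef h *: 'X^((size h).-1)).
  by move=> [q ->]; rewrite -mul_polyC polyCM -mulrA; eexists.
have dtail h : divides p (lead_coef h) ->
      divides p%:P (h - lead_coef h *: 'X^((size h).-1)) -> divides p%:P h.
  move=> h1 h2; rewrite -(subrK (lead_coef h *: 'X^((size h).-1)) h).
  by apply: divides_add => //; exact: dlead.
have /pP[df|dg] : divides p (lead_coef f * lead_coef g).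
  by rewrite -lead_coefM; apply: divides_lead.
- have d2 : divides p%:P ((f - lead_coef f *: 'X^((size f).-1)) * g).
    by rewrite mulrBl; apply: divides_add => //; apply/divides_opp/divides_mulr/dlead.
  have [|h|h] := IH _ _ _ _ erefl d2; last by right.
    by rewrite -en ltn_add2r lt_tail.
  by left; apply: dtail.
- have d2 : divides p%:P (f * (g - lead_coef g *: 'X^((size g).-1))).
    by rewrite mulrBr; apply: divides_add => //; apply/divides_opp/divides_mull/dlead.
  have [|h|h] := IH _ _ _ _ erefl d2; first by rewrite -en ltn_add2l lt_tail.
    by left.
  by right; apply: dtail.
Qed.

Hypothesis fR : factorial R.

Definition primitive f := forall p : R, prime_elt p -> ~ divides p%:P f.

(** The prime factors of [c] cancel one at a time: each stays prime in the polynomial ring and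
    divides [f * w] but not the primitive [f], hence divides [w]. *)
Lemma cancel_primitive (c : R) f b w : primitive f -> c != 0 ->
  c%:P * b = f * w -> divides f b.
Proof.
move=> pf c0; have [u [s [Uu Ps ->]]] := fR c0.
elim: s Ps w => [|p s IH] Ps w.
  rewrite big_nil mulr1 => e; exists (w * (u^-1)%:P).
  by rewrite mulrA -e mulrAC -polyCM mulrV // mul1r.
have Pp : prime_elt p by apply: Ps; rewrite mem_head.
rewrite big_cons mulrCA polyCM -mulrA => e.
have [_ _ /(_ f w) pP] := prime_polyC Pp.
have /pP[/(pf _ Pp) //|[w' wE]] : divides p%:P (f * w) by rewrite -e; eexists.
apply: (IH _ w') => [q qs|]; first by apply: Ps; rewrite in_cons qs orbT.
have p0 : p%:P != 0 by rewrite polyC_eq0; case: Pp.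
by apply: (mulfI p0); rewrite e wE mulrCA.
Qed.

(** Each prime factor of [c] divides [q] or [g]; those cancelled from [g] are collected in [d]. *)
Lemma cancel_const (c : R) y q g : c != 0 -> c%:P * y = q * g ->
  exists d q1 g1, y = q1 * g1 /\ g = d%:P * g1.
Proof.
move=> c0; have [u [s [Uu Ps ->]]] := fR c0.
elim: s Ps q g => [|p s IH] Ps q g.
  rewrite big_nil mulr1 => e; exists 1, ((u^-1)%:P * q), g.
  by rewrite mul1r -mulrA -e mulrA -polyCM mulVr // mul1r.
have Pp : prime_elt p by apply: Ps; rewrite mem_head.
have Ps' r : r \in s -> prime_elt r by move=> rs; apply: Ps; rewrite in_cons rs orbT.
rewrite big_cons mulrCA polyCM -mulrA => e.
have [_ _ /(_ q g) pP] := prime_polyC Pp.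
have p0 : p%:P != 0 by rewrite polyC_eq0; case: Pp.
have /pP[[q' qE]|[g' gE]] : divides p%:P (q * g) by rewrite -e; eexists.
  by apply: (IH Ps' q' g); apply: (mulfI p0); rewrite e qE mulrA.
have [|d [q1 [g1 [-> g'E]]]] := IH Ps' q g'.
  by apply: (mulfI p0); rewrite e gE mulrCA.
by exists (p * d), q1, g1; rewrite gE g'E polyCM mulrA.
Qed.

(** [g] is a nonzero combination of [f] and [a] of least degree, a gcd over the fraction field; by
    pseudo-division it divides all combinations up to constants. As [f] is irreducible, either [g]
    is constant, and [f] divides [b], or [g] is [f] up to constants, and [f] divides [a]. *)
Lemma primitive_irreducible_prime f : (1 < size f)%N -> primitive f ->
  (forall g h, f = g * h -> (size g <= 1)%N \/ (size h <= 1)%N) ->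
  prime_elt f.
Proof.
move=> sf pf irr.
have f0 : f != 0 by rewrite -size_poly_gt0 (leq_trans _ sf).
split=> //.
  by apply/negP; rewrite poly_unitE => /andP[/eqP e _]; rewrite e in sf.
move=> a b dab; have [da|nda] := pselect (divides f a); [by left|right].
pose I g := exists u v, g = u * f + v * a.
pose P n := `[< exists g, [/\ I g, g != 0 & size g = n] >].
have exP : exists n, P n.
  by exists (size f); apply/asboolP; exists f; split=> //; exists 1, 0; rewrite mul1r mul0r addr0.
case: (ex_minnP exP) => n /asboolP[g [[u [v gE]] g0 sg]] min.
have div y : I y -> exists2 c, c != 0 & exists q, c%:P * y = q * g.
  move=> [u' [v' yE]]; exists (lead_coef g ^+ Pdiv.Ring.rscalp y g).
    by rewrite expf_neq0 // lead_coef_eq0.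
  exists (Pdiv.Ring.rdivp y g).
  have e := Pdiv.ComRing.rdivp_eq g y; rewrite -mul_polyC in e.
  rewrite e; suff -> : Pdiv.Ring.rmodp y g = 0 by rewrite addr0.
  apply: contrapT => /eqP r0.
  have : P (size (Pdiv.Ring.rmodp y g)).
    apply/asboolP; exists (Pdiv.Ring.rmodp y g); split=> //.
    set c := _%:P in e; set q := Pdiv.Ring.rdivp y g in e.
    exists (c * u' - q * u), (c * v' - q * v).
    apply: (addrI (q * g)); rewrite -e yE gE; ring.
  by move/min; rewrite -sg leqNgt Pdiv.Ring.ltn_rmodp g0.
have [c c0 [q cfE]] : exists2 c, c != 0 & exists q, c%:P * f = q * g.
  by apply: div; exists 1, 0; rewrite mul1r mul0r addr0.
have [d [q1 [g1 [fE g1E]]]] := cancel_const c0 cfE.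
have d0 : d != 0 by apply: contraNneq g0 => d0; rewrite g1E d0 mul0r.
have [q1s|g1s] := irr _ _ fE; last first.
  have : (size g <= 1)%N by rewrite g1E mul_polyC size_scale.
  move/size1_polyC => gC; have g00 : g`_0 != 0 by rewrite -polyC_eq0 -gC.
  have [w wE] := dab.
  apply: (@cancel_primitive (g`_0) f b (u * b + v * w)) => //.
  by rewrite -gC gE mulrDr !mulrDl -[v * a * b]mulrA wE; ring.
have q1C := size1_polyC q1s.
have q10 : q1`_0 != 0.
  by rewrite -polyC_eq0 -q1C; apply: contraNneq f0 => e; rewrite fE e mul0r.
have Uq : q1`_0 \is a GRing.unit.
  have [w [s [Uw Ps e]]] := fR q10.
  case: s Ps e => [|p s] Ps e; first by rewrite e big_nil mulr1.
  case: (pf p); first by apply: Ps; rewrite mem_head.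
  rewrite fE q1C e big_cons mulrCA polyCM -mulrA; eexists; reflexivity.
have [c' c'0 [q' caE]] : exists2 c, c != 0 & exists q, c%:P * a = q * g.
  by apply: div; exists 0, 1; rewrite mul1r mul0r add0r.
case: nda; apply: (@cancel_primitive c' f a (q' * (d * (q1`_0)^-1)%:P)) => //.
have fE' : f = (q1`_0)%:P * g1 by rewrite -q1C.
rewrite caE g1E fE' polyCM.
have e : (q1`_0)%:P * ((q1`_0)^-1)%:P = 1 :> {poly R} by rewrite -polyCM mulrV.
rewrite -[LHS]mulr1 -e; ring.
Qed.

(** Induction on the degree, then on the number of prime factors of the leading coefficient. A
    constant prime that divides [f] divides its leading coefficient, so splitting these off ends
    with a primitive polynomial, which is prime or a product of factors of smaller degree. *)
Theorem factorial_poly : factorial {poly R}.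
Proof.
move=> f; move en: (size f) => n; elim/ltn_ind: n f en => n IH f en f0.
have [s1|s1] := leqP n 1.
  have fC : f = (f`_0)%:P by apply: size1_polyC; rewrite en.
  have : f`_0 != 0 by rewrite -polyC_eq0 -fC.
  case/fR => u [s [Uu Ps e]]; exists u%:P, [seq p%:P | p <- s]; split.
  - exact: unit_polyC.
  - by move=> _ /mapP[p ps ->]; apply/prime_polyC/Ps.
  - by rewrite big_map fC e polyCM rmorph_prod.
have prim h : size h = n -> primitive h -> factored h.
  move=> sh ph.
  have [[g1 [g2 [hE [s1g s2g]]]]|irr] := pselect (exists g1 g2,
    h = g1 * g2 /\ (1 < size g1)%N /\ (1 < size g2)%N).
    have g10 : g1 != 0 by rewrite -size_poly_gt0 ltnW.
    have g20 : g2 != 0 by rewrite -size_poly_gt0 ltnW.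
    have sgh : n = (size g1 + size g2).-1 by rewrite -sh hE size_mul.
    by rewrite hE; apply: factoredM; [apply: (IH (size g1))|apply: (IH (size g2))];
      rewrite // sgh; lia.
  apply/prime_factored/primitive_irreducible_prime => //; first by rewrite sh.
  move=> g1 g2 hE; have [|s1g] := leqP (size g1) 1; first by left.
  by right; rewrite leqNgt; apply/negP => s2g; apply: irr; exists g1, g2.
have lf0 : lead_coef f != 0 by rewrite lead_coef_eq0.
have [u [s [Uu Ps e]]] := fR lf0.
move es: (size s) => m; elim: m s es f f0 en lf0 Ps e => [|m IHm] s es f f0 en lf0 Ps e;
  have [[p [ps [g fE]]]|npf] := pselect (exists p, p \in s /\ divides p%:P f).
- by case: s es ps {Ps e}.
- apply: prim => // p Pp /divides_lead; rewrite e => /(prime_prod Pp Uu)[q].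
  by case: s es {Ps e npf}.
- have Pp := Ps _ ps; have p0 : p != 0 by case: Pp.
  have g0 : g != 0 by apply: contraNneq f0 => g0; rewrite fE g0 mulr0.
  rewrite fE; apply: factoredM; first exact/prime_factored/prime_polyC.
  apply: (IHm (rem p s)) => //.
  + by rewrite size_rem // es.
  + by rewrite -en fE mul_polyC size_scale.
  + by rewrite lead_coef_eq0.
  + by move=> q /mem_rem; exact: Ps.
  apply: (mulfI p0).
  have <- : lead_coef f = p * lead_coef g by rewrite fE lead_coefM lead_coefC.
  by rewrite e (big_rem p) //= mulrCA.
- apply: prim => // p Pp dpf; have := divides_lead dpf.
  rewrite e => /(prime_prod Pp Uu) [q qs dpq]; apply: npf; exists q; split=> //.
  apply: divides_trans dpf; have [r ->] := prime_assoc Pp (Ps _ qs) dpq.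
  by exists r%:P; rewrite polyCM.
Qed.

End PolyFactorial.

(** Split off the powers of ['X]: the cofactors have nonzero constant terms, so their product can
    only be the constant [c]. *)
Lemma monomial_factor (R : idomainType) (p q : {poly R}) c d :
  c != 0 -> p * q = c *: 'X^d -> exists e, forall i, i != e -> p`_i = 0.
Proof.
move=> c0 e.
have : p * q != 0 by rewrite e -mul_polyC mulf_neq0 ?polyC_eq0 // monic_neq0 // monicXn.
rewrite mulf_eq0 negb_or => /andP[p0 q0].
have [i [p1 p1r pE]] := multiplicity_XsubC p 0.
have [j [q1 q1r qE]] := multiplicity_XsubC q 0.
rewrite p0 /= polyC0 subr0 in p1r pE; rewrite q0 /= polyC0 subr0 in q1r qE.
rewrite pE qE mulrACA -exprD in e.
have r0 : (p1 * q1)`_0 != 0.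
  rewrite -horner_coef0 hornerM mulf_neq0 //.
have ed : (i + j)%N = d.
  apply/eqP; move/(congr1 (fun r : {poly R} => r`_(i + j))): e.
  rewrite coefMXn ltnn subnn coefZ coefXn; case: eqP => // _.
  by move/eqP; rewrite mulr0 (negPf r0).
have s1 : (size p1 <= 1)%N.
  have p10 : p1 != 0 by apply: contraNneq r0 => ->; rewrite mul0r coef0.
  have q10 : q1 != 0 by apply: contraNneq r0 => ->; rewrite mulr0 coef0.
  have : p1 * q1 = c%:P.
    apply: (@mulIf _ ('X^d)); first by rewrite monic_neq0 // monicXn.
    by rewrite -ed e ed mul_polyC.
  move/(congr1 (fun r : {poly R} => size r)); rewrite size_mul // size_polyC c0 /=.
  move: q10; rewrite -size_poly_gt0; case: (size q1) => // b _.
  by rewrite addnS /= => <-; exact: leq_addr.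
exists i => k ki; rewrite pE (size1_polyC s1) mul_polyC coefZ coefXn.
by rewrite (negPf ki) mulr0.
Qed.

Section HomogFactor.
Variables (F : fieldType) (n : nat).

(** The substitution of [X_i T] for [X_i] multiplies a form of degree [d] by [T^d]; homogeneity of a
    product becomes an equation with a monomial over a domain. *)
Let phi : {rmorphism {mpoly F[n]} -> {poly {mpoly F[n]}}} :=
  mmap (polyC \o @mpolyC n F) (fun i => ('X_i)%:P * 'X).

Let phiE p : phi p = \sum_(m <- msupp p) (p@_m *: 'X_[m])%:P * 'X^(mdeg m).
Proof.
apply: eq_bigr => m _; rewrite /mmap1 /=.
under eq_bigr => i _ do rewrite exprMn.
rewrite big_split /= -mul_mpolyC polyCM -mulrA; congr (_ * (_ * _)).
  by rewrite mpolyXE_id rmorph_prod; apply: eq_bigr => i _; rewrite rmorphXn.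
by rewrite prodrXr mdegE.
Qed.

Lemma homog_factor (p q : {mpoly F[n]}) d :
  p * q != 0 -> p * q \is d.-homog -> exists e, p \is e.-homog.
Proof.
move=> pq0 hom.
have e : phi p * phi q = (p * q) *: 'X^d.
  rewrite -rmorphM phiE /= -mul_polyC {3}[p * q]mpolyE rmorph_sum /= mulr_suml.
  by rewrite !big_seq; apply: eq_bigr => m mp; rewrite (dhomog_mf hom mp).
have [k pk] := monomial_factor pq0 e.
exists k; apply/dhomogP => m mp; apply/eqP; apply: contraT => ne.
have := congr1 (mcoeff m) (pk _ ne); rewrite phiE coef_sum raddf_sum mcoeff0 /=.
rewrite (bigD1_seq m) //= big1 ?addr0.
  by rewrite coefMXn ltnn subnn coefC mcoeffZ mcoeffX eqxx mulr1 => /eqP; rewrite mcoeff_eq0 mp.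
move=> m' /negPf nm; rewrite coefMXn; case: ifP => _; first by rewrite mcoeff0.
by rewrite coefC; case: ifP => _; rewrite ?mcoeff0 // mcoeffZ mcoeffX nm mulr0.
Qed.

End HomogFactor.

(** * Iterated polynomial rings *)

Section IteratedPoly.
Variable F : fieldType.

(* [itp n] is the ring of polynomials in [n] variables, with constants [itc] and variables [itv];
   [itev] evaluates the variables at [x]. *)
Fixpoint itp n : idomainType := if n is n'.+1 then {poly itp n'} else F.

Lemma factorial_itp n : factorial (itp n).
Proof.
elim: n => [|n IH]; first exact: factorial_field.
exact: factorial_poly.
Qed.

Fixpoint itc n : {rmorphism F -> itp n} :=
  if n is n'.+1 return {rmorphism F -> itp n} then polyC \o itc n' else idfun.

Fixpoint itv n (i : nat) : itp n :=
  if n is n'.+1 return itp n then if i == n' then 'X else (itv n' i)%:P else 0.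

Section Eval.
Variables (S : comNzRingType) (phi : {rmorphism F -> S}) (x : nat -> S).

Fixpoint itev n : {rmorphism itp n -> S} :=
  if n is n'.+1 return {rmorphism itp n -> S}
  then horner_eval (x n') \o map_poly (itev n') else phi.

Lemma itevC n c : itev n (itc n c) = phi c.
Proof.
elim: n => [|n IH] //=; by rewrite map_polyC /= /horner_eval hornerC IH.
Qed.

Lemma itevV n i : (i < n)%N -> itev n (itv n i) = x i.
Proof.
elim: n => [|n IH] //=; rewrite ltnS /horner_eval; case: eqP => [-> _|ne le].
  by rewrite map_polyX hornerX.
by rewrite map_polyC hornerC /= IH // ltn_neqAle le andbT; apply/eqP.
Qed.

End Eval.

Lemma itev_comp (S S' : comNzRingType) (g : {rmorphism S -> S'})
    (phi : {rmorphism F -> S}) (phi' : {rmorphism F -> S'}) x x' n :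
  (forall c, g (phi c) = phi' c) -> (forall i, (i < n)%N -> g (x i) = x' i) ->
  forall p, g (itev phi x n p) = itev phi' x' n p.
Proof.
move=> h; elim: n => [|n IH] hx p //=; rewrite /horner_eval.
rewrite -horner_map hx // -map_poly_comp; congr (_.[_]).
by apply: eq_map_poly => c /=; apply: IH => i ltin; apply/hx/ltnW.
Qed.

End IteratedPoly.

(* [P] gives the coordinates over the basis [B] of [U] modulo [V]. *)
Lemma compl_basis (k : fieldType) N (U V : 'M[k]_N) :
  exists n (B : 'M[k]_(n, N)) (P : 'M[k]_(N, n)),
    [/\ B *m P = 1%:M, V *m P = 0, (B <= U)%MS &
        forall u : 'rV_N, (u <= U)%MS -> (u - u *m P *m B <= V)%MS].
Proof.
pose B := row_base (U :\: V)%MS; pose W := row_base V.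
have free : row_free (col_mx B W).
  rewrite -row_leq_rank -addsmxE (adds_eqmx (eq_row_base _) (eq_row_base _)).
  by rewrite mxrank_disjoint_sum ?capmx_diff.
have eB : (B :=: U :\: V)%MS := eq_row_base _.
have eW : (W :=: V)%MS := eq_row_base _.
clearbody B W.
have [P [BP WP]] : exists P, B *m P = 1%:M /\ W *m P = 0.
  exists (pinvmx (col_mx B W) *m col_mx 1%:M 0).
  by apply: eq_col_mx; rewrite -mul_col_mx mulmxA mulmxVp // mul1mx.
exists _, B, P; split=> //.
- have /submxP[D VE] : (V <= W)%MS by rewrite eW.
  by rewrite [X in X *m _]VE -mulmxA WP mulmx0.
- by rewrite eB diffmxSl.
move=> u uU; have : (u <= B + W)%MS.
  rewrite (adds_eqmx eB eW); apply: submx_trans uU _.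
  by rewrite -{1}(addsmx_diff_cap_eq U V) addsmxS // capmxSr.
case/sub_addsmxP=> [[a b]] /= ->.
rewrite mulmxDl -!mulmxA BP WP mulmx1 mulmx0 addr0.
by rewrite addrAC subrr add0r mulmx_sub // eW.
Qed.

Section LocalAlgebra.
Variables (F : fieldType) (r : nat) (S : 'M[F]_r.+1 -> Prop).
Hypotheses (nS : nualg S) (S1 : S 1%:M).
Hypothesis lS : forall x, S x -> nilmx x \/ x \in unitmx.

Lemma local_rad x : S x -> nilmx x -> rad S x.
Proof.
move=> Sx [s xs0]; split=> // y Sy; have [_ _ _ SM] := nS.
have [//|uxy] := lS (SM _ _ Sx Sy).
have ux : x \is a GRing.unit.
  by move: uxy; rewrite -[_ \in unitmx]/(x *m y \in unitmx) unitmx_mul => /andP[].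
have : x ^+ s \is a GRing.unit by rewrite unitrX.
by rewrite xs0 unitr0.
Qed.

End LocalAlgebra.

Section FormFactor.
Variables (F : fieldType) (F_C1 : C1_field F) (n : nat).

(** Factoriality is known for iterated polynomials, homogeneity and the C1 property are stated for
    [mpoly]; evaluations relate the two. *)
Definition itmp : {rmorphism itp F n.+1 -> {mpoly F[n.+1]}} :=
  itev (@mpolyC n.+1 F) (fun i => 'X_(inord i)) n.+1.

Definition itval (v : 'I_n.+1 -> F) : {rmorphism itp F n.+1 -> F} :=
  itev (idfun : {rmorphism F -> F}) (fun i => v (inord i)) n.+1.

Lemma itmp_meval v p : (itmp p).@[v] = itval v p.
Proof.
apply: itev_comp => [c|i _]; first by rewrite /= mevalC.
by rewrite /= mevalXU.
Qed.

(* Setting every variable but the last one to 0 turns a form of degree [e] into a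
   multiple of ['X^e], so a form with unit leading coefficient in the last variable
   has the same degree in that variable. *)
Lemma homog_size (p : {poly itp F n}) e : lead_coef p \is a GRing.unit ->
  itmp p \is e.-homog -> size p = e.+1.
Proof.
move=> Ul hom.
pose ev0 := itev (idfun : {rmorphism F -> F}) (fun=> 0) n.
have sz : size (map_poly ev0 p) = size p.
  by apply: size_map_poly_id0; apply: contraTneq (rmorph_unit ev0 Ul) => ->; rewrite unitr0.
pose h (i : 'I_n.+1) : {poly F} := if i == n :> nat then 'X else 0.
have pE : mmap polyC h (itmp p) = map_poly ev0 p.
  rewrite (@itev_comp F _ _ (mmap polyC h : {rmorphism _ -> _}) _ (polyC : {rmorphism F -> {poly F}}) _
    (fun i => if i == n then 'X else 0)).
  - rewrite /= eqxx /horner_eval /=.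
    rewrite (_ : map_poly _ p = map_poly polyC (map_poly ev0 p)).
      by rewrite -[_.['X]]/(_ \Po 'X) comp_polyXr.
    rewrite -map_poly_comp; apply: eq_map_poly => c /=.
    apply/esym/itev_comp => // i ltin.
    by rewrite (ltn_eqF ltin) rmorph0.
  - by move=> c; rewrite /= mmapC.
  - by move=> i ltin; rewrite /= mmapX mmap1U /h inordK.
have hp m : mdeg m = e -> mmap1 h m = 'X^e \/ mmap1 h m = 0.
  move=> dm; have [z|nz] := boolP [forall i : 'I_n.+1, (i == n :> nat) || (m i == 0%N)].
    left; rewrite /mmap1 (bigD1 ord_max) //= /h eqxx big1 ?mulr1.
      rewrite -dm mdegE (bigD1 ord_max) //= big1 ?addn0 // => i ne.
      have := forallP z i; rewrite -val_eqE /= in ne; rewrite (negPf ne).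
      by move/eqP.
    move=> i ne; have := forallP z i; rewrite -val_eqE /= in ne; rewrite (negPf ne).
    by move/eqP->; rewrite expr0.
  right; case/forallPn: nz => i; rewrite negb_or => /andP[/negPf ne mi].
  by rewrite /mmap1 (bigD1 i) //= /h ne expr0n (negPf mi) mul0r.
have [c cE] : exists c : F, map_poly ev0 p = c *: 'X^e.
  rewrite -pE; rewrite /mmap big_seq; elim/big_ind: _ => [|_ _ [c ->] [d ->]|m mp].
  - by exists 0; rewrite scale0r.
  - by exists (c + d); rewrite scalerDl.
  - have [->|->] := hp _ (dhomog_mf hom mp); first by eexists; rewrite mul_polyC.
    by exists 0; rewrite mulr0 scale0r.
have p0 : map_poly ev0 p != 0.
  rewrite -size_poly_gt0 sz size_poly_gt0 -lead_coef_eq0.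
  by apply: contraTneq Ul => ->; rewrite unitr0.
have c0 : c != 0 by apply: contraNneq p0 => c0; rewrite cE c0 scale0r.
by rewrite -sz cE size_scale // size_polyXn.
Qed.

(** A factor that is not a unit is a form of positive degree. If this degree were at most [n], C1
    would give it a nontrivial zero in its [n + 1] variables, which is also a zero of the
    product. *)
Lemma form_factor_size (p q : {poly itp F n}) d :
  p * q \is monic -> itmp (p * q) \is d.-homog ->
  (forall v : 'I_n.+1 -> F, (exists i, v i != 0) -> itval v (p * q) != 0) ->
  p \isn't a GRing.unit -> (n.+1 < size p)%N.
Proof.
move=> mon hom nz Up.
have Ul : lead_coef p \is a GRing.unit.
  apply/unitrP; exists (lead_coef q).
  by rewrite mulrC -lead_coefM (monicP mon).
have pq0 : itmp (p * q) != 0.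
  have /nz : exists i : 'I_n.+1, (fun=> 1 : F) i != 0 by exists ord0; rewrite oner_neq0.
  by apply: contraNneq => e; rewrite -itmp_meval e meval0.
rewrite rmorphM in pq0 hom.
have [e pe] := homog_factor pq0 hom.
rewrite (homog_size Ul pe) ltnS leqNgt; apply/negP => lt.
have [e0|e0] := posnP e.
  have := homog_size Ul pe; rewrite e0 => s1; case/negP: Up.
  have pC := size1_polyC (eq_leq s1); rewrite pC; apply: unit_polyC.
  by rewrite -(lead_coefC p`_0) -pC.
have [|v [vn0 pv]] := F_C1 (n := n.+1) _ pe; first by rewrite e0.
by have := nz v vn0; rewrite (rmorphM (itval v)) -itmp_meval pv mul0r eqxx.
Qed.

End FormFactor.

(** * Extension of scalars *)

Section ExtSpan.
Variables (k : fieldType) (R : comNzRingType) (j : {rmorphism k -> R}).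

Section Def.
Variables (m n : nat) (Q : 'M[k]_(m, n) -> Prop).

Inductive ext_span : 'M[R]_(m, n) -> Prop :=
| ext_span0 : ext_span 0
| ext_spanS c x z : Q x -> ext_span z -> ext_span (c *: map_mx j x + z).

Lemma ext_spanZ c z : ext_span z -> ext_span (c *: z).
Proof.
elim=> [|d x y Qx _ IH]; first by rewrite scaler0; apply: ext_span0.
by rewrite scalerDr scalerA; apply: ext_spanS.
Qed.

Lemma ext_spanD y z : ext_span y -> ext_span z -> ext_span (y + z).
Proof.
move=> sy sz; elim: sy => [|d x t Qx _ IH]; first by rewrite add0r.
by rewrite -addrA; apply: ext_spanS.
Qed.

Lemma ext_spanN z : ext_span z -> ext_span (- z).
Proof. by rewrite -scaleN1r; apply: ext_spanZ. Qed.

Lemma ext_spanB y z : ext_span y -> ext_span z -> ext_span (y - z).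
Proof. by move=> sy /ext_spanN; apply: ext_spanD. Qed.

Lemma ext_span_map x : Q x -> ext_span (map_mx j x).
Proof.
by move=> Qx; rewrite -[map_mx j x]addr0 -[map_mx j x]scale1r; apply: ext_spanS => //; apply: ext_span0.
Qed.

Lemma ext_span_sum (I : Type) (r : seq I) (P : pred I) (f : I -> 'M[R]_(m, n)) :
  (forall i, P i -> ext_span (f i)) -> ext_span (\sum_(i <- r | P i) f i).
Proof.
move=> h; apply: (big_ind ext_span) => //; [exact: ext_span0|exact: ext_spanD].
Qed.

Lemma ext_span_ind' (T : 'M[R]_(m, n) -> Prop) :
  T 0 -> (forall c y, T y -> T (c *: y)) -> (forall y z, T y -> T z -> T (y + z)) ->
  (forall x, Q x -> T (map_mx j x)) -> forall z, ext_span z -> T z.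
Proof.
move=> T0 TZ TD TQ z; elim=> // c x y Qx _ Ty.
by apply: TD => //; apply: TZ; apply: TQ.
Qed.

End Def.

Lemma ext_span_mono m n (Q Q' : 'M[k]_(m, n) -> Prop) z :
  (forall x, Q x -> Q' x) -> ext_span Q z -> ext_span Q' z.
Proof.
move=> h; elim/ext_span_ind' => [|c y|y t|x Qx]; [exact: ext_span0|exact: ext_spanZ|exact: ext_spanD|].
by apply: ext_span_map; apply: h.
Qed.

Lemma ext_spanM m n p (Q1 : 'M[k]_(m, n) -> Prop) (Q2 : 'M[k]_(n, p) -> Prop)
    (Q3 : 'M[k]_(m, p) -> Prop) y z :
  (forall x x', Q1 x -> Q2 x' -> Q3 (x *m x')) ->
  ext_span Q1 y -> ext_span Q2 z -> ext_span Q3 (y *m z).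
Proof.
move=> h s1 s2; elim/ext_span_ind': s1 => [|c t|t t'|x Qx].
- by rewrite mul0mx; apply: ext_span0.
- by rewrite -scalemxAl; apply: ext_spanZ.
- by rewrite mulmxDl; apply: ext_spanD.
elim/ext_span_ind': s2 => [|c t|t t'|x' Qx'].
- by rewrite mulmx0; apply: ext_span0.
- by rewrite -scalemxAr; apply: ext_spanZ.
- by rewrite mulmxDr; apply: ext_spanD.
by rewrite -map_mxM; apply: ext_span_map; apply: h.
Qed.

Lemma ext_spanX n (S : 'M[k]_n -> Prop) z i :
  nualg S -> S 1%:M -> ext_span S z -> ext_span S (z ^+ i).
Proof.
move=> [_ _ _ SM] S1 sz; elim: i => [|i IH].
  by rewrite expr0 -[1](map_mx1 j); apply: ext_span_map.
by rewrite exprS; apply: (ext_spanM SM).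
Qed.

Lemma ext_span_flag n (Q : 'M[k]_n -> Prop) (W : nat -> 'M[k]_n) i z :
  (forall i x, Q x -> (W i *m x <= W i.+1)%MS) ->
  ext_span Q z -> exists D, map_mx j (W i) *m z = D *m map_mx j (W i.+1).
Proof.
move=> h; elim/ext_span_ind' => [|c y [D e]|y t [D e] [D' e']|x Qx].
- by exists 0; rewrite mulmx0 mul0mx.
- by exists (c *: D); rewrite -scalemxAr e scalemxAl.
- by exists (D + D'); rewrite mulmxDr e e' mulmxDl.
have /submxP[D e] := h i x Qx.
by exists (map_mx j D); rewrite -!map_mxM e.
Qed.

(** Every generator moves the flag of [rad_flag] down one step, hence so does every combination; the
    exponent is the length of the flag and is uniform in [z]. *)
Lemma ext_span_rad_nil n (S : 'M[k]_n -> Prop) :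
  nualg S -> S 1%:M -> exists s, forall z, ext_span (rad S) z -> z ^+ s = 0.
Proof.
move=> nS S1; have [s [W [W0 Ws h]]] := rad_flag nS S1.
exists s => z sz.
have [D e] : exists D, z ^+ s = D *m map_mx j (W s).
  elim: (s) => [|i [D e]]; first by exists 1; rewrite W0 map_mx1 mulmx1.
  have [D' e'] := ext_span_flag i h sz.
  by exists (D *m D'); rewrite exprSr e -[_ * _]/(_ *m _) -mulmxA e' mulmxA.
by rewrite e Ws map_mx0 mulmx0.
Qed.

(** Membership in [Q] is tested by a cokernel matrix over [k], which also annihilates the [R]-span
    of [Q]. *)
Lemma ext_span_descent m n (Q : 'M[k]_(m, n) -> Prop) c x :
  Q 0 -> (forall y z, Q y -> Q z -> Q (y + z)) -> (forall a y, Q y -> Q (a *: y)) ->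
  GRing.lreg c -> ext_span Q (c *: map_mx j x) -> Q x.
Proof.
move=> Q0 QD QZ rc sx.
have [|||U HU] := @subspace_mx k (m * n) (fun v => Q (vec_mx v)).
- by rewrite linear0.
- by move=> u v; rewrite linearD; apply: QD.
- by move=> a u; rewrite linearZ; apply: QZ.
have ker z : ext_span Q z -> mxvec z *m map_mx j (cokermx U) = 0.
  elim/ext_span_ind' => [|a y e|y t e e'|y Qy].
  - by rewrite linear0 mul0mx.
  - by rewrite linearZ /= -scalemxAl e scaler0.
  - by rewrite linearD /= mulmxDl e e' addr0.
  rewrite -map_mxvec -map_mxM (_ : mxvec y *m _ = 0) ?map_mx0 //.
  by apply/eqP; rewrite -submxE; apply/HU; rewrite mxvecK.
rewrite -[x]mxvecK; apply/HU; rewrite submxE; apply/eqP.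
have := ker _ sx; rewrite linearZ /= -scalemxAl -map_mxvec -map_mxM => e.
apply/rowP => i; rewrite mxE; apply: (fmorph_inj j).
have := congr1 (fun M : 'rV_ _ => M 0 i) e; rewrite !mxE => e'.
by apply: rc; rewrite e' rmorph0 mulr0.
Qed.

End ExtSpan.

(** * Local algebras over a C1 field *)

(** The remainder theorem for matrices: [B(X) - B(y)] is a multiple of [X - y]. When [B(y) = 0],
    determinants show that the characteristic polynomial of [y] divides a power of [B]. *)
Lemma char_poly_mx_factor (R : comNzRingType) r (y : 'M[R]_r.+1) (B : {poly R}) :
  exists W, B%:M - map_mx polyC (horner_mx y B) = char_poly_mx y *m W.
Proof.
elim/poly_ind: B => [|B c [W e]].
  by exists 0; rewrite (rmorph0 (horner_mx y)) map_mx0 mulmx0 subr0 raddf0.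
exists (W *m 'X%:M + map_mx polyC (horner_mx y B)).
have -> : horner_mx y (B * 'X + c%:P) = horner_mx y B *m y + c%:M.
  by rewrite rmorphD rmorphM /= horner_mx_X horner_mx_C.
rewrite map_mxD map_scalar_mx [(B * 'X + _)%:M]raddfD /= opprD addrACA subrr addr0 scalar_mxM.
rewrite mulmxDr mulmxA -e mulmxBl.
set H := map_mx polyC (horner_mx y B).
have -> : char_poly_mx y *m H = H *m 'X%:M - map_mx polyC (horner_mx y B *m y).
  rewrite /char_poly_mx mulmxBl scalar_mxC; congr (_ - _).
  by rewrite -map_mxM; congr map_mx; apply/esym/comm_horner_mx.
by rewrite addrA subrK.
Qed.

Lemma divides_exp (R : idomainType) (p a : R) s : prime_elt p -> divides p (a ^+ s) -> divides p a.
Proof.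
move=> [p0 Up pP]; elim: s => [|s IH]; last by rewrite exprS => /pP[].
rewrite expr0 => -[q e]; case/negP: Up; apply/unitrP; exists q.
by rewrite mulrC -e.
Qed.

Lemma det_homog (F : fieldType) n r (M : 'M[{mpoly F[n]}]_r) :
  (forall i j, M i j \is 1.-homog) -> \det M \is r.-homog.
Proof.
move=> h; apply: rpred_sum => s _; rewrite -signr_odd.
suff hp : \prod_i M i (s i) \is r.-homog.
  by case: odd; rewrite ?expr0 ?expr1 ?mul1r ?mulN1r ?rpredN.
suff : \prod_i M i (s i) \is (\sum_(i < r) 1)%N.-homog.
  by rewrite sum_nat_const card_ord muln1.
apply: (big_ind2 (fun (p : {mpoly F[n]}) d => p \is d.-homog)) => //.
  exact: dhomog1.
by move=> p d q e; apply: dhomogM.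
Qed.

(* The reduced characteristic form of the generic element: the last variable is the
   coefficient of 1. *)
Definition generic_elt (F : fieldType) r n (d : 'I_n -> 'M[F]_r) : 'M[itp F n]_r :=
  - \sum_(i < n) itv F n i *: map_mx (itc F n) (d i).

(** The sign in [generic_elt] is chosen for this: the characteristic polynomial becomes
    [det (x_n + sum x_i d_i)], a norm form on the span of 1 and the [d i]. *)
Lemma char_poly_generic (F : fieldType) (S : comNzRingType) (phi : {rmorphism F -> S})
    (x : nat -> S) r n (d : 'I_n -> 'M[F]_r) :
  map_mx (itev phi x n.+1) (char_poly_mx (generic_elt d)) =
  (x n)%:M + \sum_(i < n) x i *: map_mx phi (d i).
Proof.
apply/matrixP => k l; rewrite !mxE summxE rmorphB /= rmorphMn /= /horner_eval.
rewrite map_polyX map_polyC hornerMn hornerX hornerC /= rmorphN opprK summxE rmorph_sum /=.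
congr (_ + _); apply: eq_bigr => i _.
by rewrite !mxE rmorphM /= itevV // itevC.
Qed.

Section LocalAlgebra.
Variables (F : fieldType) (F_C1 : C1_field F).
Variables (r : nat) (S : 'M[F]_r.+1 -> Prop).
Hypotheses (nS : nualg S) (S1 : S 1%:M).
Hypothesis lS : forall x, S x -> nilmx x \/ x \in unitmx.

Let S0 : S 0. Proof. by case: nS. Qed.
Let SD x y : S x -> S y -> S (x + y). Proof. by case: nS => _ + _ _; apply. Qed.
Let SZ c x : S x -> S (c *: x). Proof. by case: nS => _ _ + _; apply. Qed.
Let SM x y : S x -> S y -> S (x *m y). Proof. by case: nS => _ _ _ +; apply. Qed.
Let nJ := nualg_rad nS.

(* 1 completes the family [d] to a basis of [S] modulo its radical. *)
Lemma basis_mod_rad : exists n (d : 'I_n -> 'M[F]_r.+1) (P : 'M[F]_(r.+1 * r.+1, n)),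
  [/\ forall i, S (d i),
      forall c c0, rad S (\sum_i c i *: d i + c0%:M) -> (forall i, c i = 0) /\ c0 = 0
    & forall x, S x -> exists c, rad S (x - \sum_i (mxvec x *m P) 0 i *: d i - c%:M)].
Proof.
have [_ JD JZ JM] := nJ.
have [|||US HS] := @subspace_mx F _ (fun v => S (vec_mx v)).
- by rewrite linear0.
- by move=> u v; rewrite linearD; apply: SD.
- by move=> a u; rewrite linearZ; apply: SZ.
have [|||UJ HJ] := @subspace_mx F _ (fun v => exists c, rad S (vec_mx v - c%:M)).
- by exists 0; rewrite linear0 raddf0 subr0; apply: rad0.
- move=> u v [c hc] [c' hc']; exists (c + c').
  by rewrite linearD raddfD opprD addrACA; apply: JD.
- move=> a u [c hc]; exists (a * c); rewrite linearZ /= -scale_scalar_mx -scalerBr.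
  exact: JZ.
have [n [B [P [BP VP BU UB]]]] := compl_basis US UJ.
exists n, (fun i => vec_mx (row i B)), P; split.
- by move=> i; apply/HS; apply: submx_trans BU; apply: row_sub.
- move=> c c0 rc.
  have e : mxvec (\sum_i c i *: vec_mx (row i B)) = (\row_i c i) *m B.
    rewrite linear_sum mulmx_sum_row /=; apply: eq_bigr => i _.
    by rewrite linearZ /= vec_mxK mxE.
  have cz : \row_i c i = 0 :> 'rV_n.
    rewrite -[LHS]mulmx1 -BP mulmxA -e.
    have /submxP[D ->] : (mxvec (\sum_i c i *: vec_mx (row i B)) <= UJ)%MS.
      by apply/HJ; exists (- c0); rewrite mxvecK raddfN opprK.
    by rewrite -mulmxA VP mulmx0.
  have ci i : c i = 0 by move/rowP/(_ i): cz; rewrite !mxE.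
  split=> //; move: rc; rewrite big1 ?add0r => [rc|i _]; last by rewrite ci scale0r.
  apply/eqP; apply: contraT => c00.
  have [s] := rad_nil S1 rc.
  move/eqP; rewrite -rmorphXn /= => /eqP/matrixP/(_ 0 0); rewrite !mxE eqxx mulr1n.
  by move/eqP; rewrite expf_eq0 (negPf c00) andbF.
- move=> x Sx; have /UB : (mxvec x <= US)%MS by apply/HS; rewrite mxvecK.
  move/HJ=> [c hc]; exists c; move: hc; rewrite linearB /= mxvecK.
  rewrite mulmx_sum_row linear_sum /=.
  by under eq_bigr => i _ do rewrite linearZ.
Qed.

(** Let [y] be the generic combination of the [d i]. If its powers span everything modulo the
    scalars and the radical, over the fraction field, the [d i] commute there like polynomials in
    [y]. Otherwise [y] satisfies modulo the radical an equation of degree at most [n]; a prime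
    factor of its characteristic polynomial divides this equation, although C1 forces the degree of
    such a factor above [n]. *)
Lemma local_commutator x y : S x -> S y -> rad S (lie x y).
Proof.
have [J0 JD JZ JM] := nJ.
have [n [d [P [Sd free gen]]]] := basis_mod_rad.
suff dd i l : rad S (lie (d i) (d l)).
  have step z w : S w -> (forall i, rad S (lie (d i) w)) -> S z -> rad S (lie z w).
    move=> Sw h Sz; have [c rc] := gen z Sz.
    set D := \sum_i _ in rc.
    have -> : z = (z - D - c%:M) + D + c%:M by rewrite addrAC subrK subrK.
    move: (z - D - c%:M) rc => t rt.
    rewrite !lieDl lie_scalar addr0; apply: (JD); first exact: (rad_lie nS).
    rewrite /D; apply: (big_ind (fun t => rad S (lie t w))) => [|u v hu hv|i _].
    - by rewrite /lie mul0mx mulmx0 subrr.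
    - by rewrite lieDl; apply: JD.
    - by rewrite lieZl; apply: JZ.
  move=> Sx Sy; apply: (step x y) => // i.
  rewrite lieN; apply: (nualgN nJ); apply: step => // i'; exact: dd.
move=> {x y}.
pose R := itp F n; pose ic := itc F n.
pose y : 'M[R]_r.+1 := generic_elt d.
have Sy : ext_span ic S y.
  by apply: ext_spanN; apply: ext_span_sum => k _; apply: ext_spanZ; apply: ext_span_map.
pose kap (z : 'M[R]_r.+1) := mxvec z *m map_mx ic P.
have coord z : ext_span ic S z -> exists c,
    ext_span ic (rad S) (z - \sum_k kap z 0 k *: map_mx ic (d k) - c%:M).
  elim/ext_span_ind' => [|a t [c hc]|t t' [c hc] [c' hc']|x Sx].
  - exists 0; rewrite /kap linear0 mul0mx raddf0 subr0 sub0r big1 ?oppr0 => [|k _].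
      exact: ext_span0.
    by rewrite mxE scale0r.
  - exists (a * c); rewrite -scale_scalar_mx.
    rewrite (_ : \sum_k _ = a *: \sum_k kap t 0 k *: map_mx ic (d k)).
      by rewrite -!scalerBr; apply: ext_spanZ.
    rewrite scaler_sumr; apply: eq_bigr => k _.
    by rewrite /kap linearZ /= -scalemxAl mxE scalerA.
  - exists (c + c'); rewrite raddfD /=.
    rewrite (_ : \sum_k _ = \sum_k kap t 0 k *: map_mx ic (d k) + \sum_k kap t' 0 k *: map_mx ic (d k)).
      by rewrite !opprD (addrACA t t') (addrACA (t - _)); apply: ext_spanD.
    rewrite -big_split; apply: eq_bigr => k _.
    by rewrite /kap linearD /= mulmxDl mxE scalerDl.
  - have [c hc] := gen x Sx; exists (ic c); have := ext_span_map ic hc.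
    rewrite !map_mxB map_scalar_mx map_mx_sum; congr (ext_span _ _ (_ - _ - _)).
    apply: eq_bigr => k _; by rewrite map_mxZ /kap -map_mxvec -map_mxM [in RHS]mxE.
(* Row [k] holds the coordinates of [y^(k+1)] on the [d l], modulo scalars and the radical. *)
pose C : 'M[R]_n := \matrix_(k, l) kap (y ^+ k.+1) 0 l.
have SX k : ext_span ic S (y ^+ k) by apply: ext_spanX.
have kap_sum (v : 'rV[R]_n) : kap (\sum_k v 0 k *: y ^+ k.+1) = v *m C.
  rewrite /kap linear_sum mulmx_suml mulmx_sum_row /=; apply: eq_bigr => k _.
  rewrite linearZ /= -scalemxAl; congr (_ *: _).
  by apply/rowP => l'; rewrite !mxE.
(* When [det C] is nonzero, the adjugate writes [det C] times each [d k], modulo scalars and the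
   radical, as a polynomial in [y]. These commute, and [ext_span_descent] removes the factor. *)
have [/eqP/det0P[v v0 vC]|dC] := eqVneq (\det C) 0; last first.
  set del := \det C in dC.
  pose u k := \sum_k' (row k (\adj C)) 0 k' *: y ^+ k'.+1.
  have uE k : exists c, ext_span ic (rad S) (u k - del *: map_mx ic (d k) - c%:M).
    have Su : ext_span ic S (u k) by apply: ext_span_sum => k' _; apply: ext_spanZ.
    have [c] := coord _ Su; rewrite kap_sum -row_mul mul_adj_mx -/del => h; exists c.
    rewrite (bigD1 k) //= big1 ?addr0 in h; first by rewrite !mxE eqxx mulr1n in h.
    by move=> k' ne; rewrite !mxE eq_sym (negPf ne) mulr0n scale0r.
  have [c hc] := uE i; have [c' hc'] := uE l.
  have uu : lie (u i) (u l) = 0.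
    apply/eqP; rewrite subr_eq0; apply/eqP.
    rewrite /u -[_ *m _]/(_ * _) -[X in _ = X]/(_ * _).
    apply: commr_sum => k _; apply/commr_sym/commr_sum => k' _.
    rewrite /GRing.comm -![_ * _]/(_ *m _) -!scalemxAl -!scalemxAr scalerA mulrC -scalerA.
    congr (_ *: (_ *: _)); rewrite -[LHS]/(_ * _) -[RHS]/(_ * _) -!exprD addnC //.
  move: hc hc'; set t := _ - c%:M; set t' := _ - c'%:M => ht ht'.
  have e : del *: map_mx ic (d i) = u i - t - c%:M.
    apply/esym/eqP; rewrite 2!subr_eq /t -[u i - _ - _]addrA -opprD.
    by rewrite [eqbRHS]addrC subrK.
  have e' : del *: map_mx ic (d l) = u l - t' - c'%:M.
    apply/esym/eqP; rewrite 2!subr_eq /t' -[u l - _ - _]addrA -opprD.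
    by rewrite [eqbRHS]addrC subrK.
  have lieJ z w : ext_span ic (rad S) z -> ext_span ic S w -> ext_span ic (rad S) (lie z w).
    move=> hz hw; apply: ext_spanB; first by apply: ext_spanM hz hw; exact: radMr.
    by apply: ext_spanM hw hz => w1 z1 h1 h2; exact: radMl.
  have Sd' k : ext_span ic S (del *: map_mx ic (d k)) by apply: ext_spanZ; apply: ext_span_map.
  have Su k : ext_span ic S (u k) by apply: ext_span_sum => k' _; apply: ext_spanZ.
  apply: (@ext_span_descent _ _ ic _ _ (rad S) (del * del)) => //.
    by apply/lregP; rewrite mulf_neq0.
  rewrite -scalerA /lie map_mxB !map_mxM -lieZr -lieZl e.
  rewrite !lieDl -scaleN1r lieZl -(scaleN1r c%:M) lieZl lie_scalar scaler0 addr0.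
  apply: ext_spanD; last by apply: ext_spanZ; apply: lieJ.
  rewrite lieN; apply: ext_spanN; rewrite e'.
  rewrite !lieDl -scaleN1r lieZl -(scaleN1r c'%:M) lieZl lie_scalar scaler0 addr0.
  rewrite lieN uu oppr0 add0r.
  by apply: ext_spanZ; apply: lieJ.
pose z0 := \sum_k v 0 k *: y ^+ k.+1.
have Sz0 : ext_span ic S z0 by apply: ext_span_sum => k _; apply: ext_spanZ.
have [c] := coord _ Sz0; rewrite kap_sum vC big1 ?subr0 => [hc|k _]; last by rewrite mxE scale0r.
(* The kernel vector [v] supplies the coefficients of exponents 1 to [n] and [c] the constant term,
   so [A] is nonzero of degree at most [n] and [A(y)] is nilpotent. *)
pose A : {poly R} := \sum_k v 0 k *: 'X^(k.+1) - c%:P.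
have hA : horner_mx y A = z0 - c%:M.
  rewrite rmorphB /= horner_mx_C rmorph_sum; congr (_ - _); apply: eq_bigr => k _.
  by rewrite /= horner_mxZ rmorphXn /= horner_mx_X.
have coefA i0 : A`_i0.+1 = \sum_k v 0 k * (i0 == k)%:R.
  rewrite coefB coefC subr0 coef_sum; apply: eq_bigr => k _.
  by rewrite coefZ coefXn eqSS.
have A0 : A != 0.
  have [k vk] := rV0Pn _ v0; apply: contraNneq vk => A0.
  have := coefA k; rewrite A0 coef0 (bigD1 k) //= eqxx mulr1 big1 ?addr0 => [->//|k' ne].
  by rewrite -val_eqE /= in ne; rewrite eq_sym (negPf ne) mulr0.
have sA : (size A <= n.+1)%N.
  apply/leq_sizeP => -[//|i0]; rewrite ltnS => le; rewrite coefA big1 // => k _.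
  by rewrite gtn_eqF ?mulr0 // (leq_trans _ le).
have [s snil] := ext_span_rad_nil ic nS S1.
have hAs : horner_mx y (A ^+ s) = 0 by rewrite rmorphXn /= hA snil.
have [W eW] := char_poly_mx_factor y (A ^+ s).
rewrite hAs map_mx0 subr0 in eW.
have eD : (A ^+ s) ^+ r.+1 = char_poly y * \det W by rewrite -det_scalar eW det_mulmx.
have cp0 : char_poly y != 0 by rewrite monic_neq0 // char_poly_monic.
have [u [ps [Uu Pps cpE]]] := factorial_poly (@factorial_itp F n) cp0.
case: ps => [|p ps] in Pps cpE.
  have := size_char_poly y; rewrite cpE big_nil mulr1.
  by move: Uu; rewrite poly_unitE => /andP[/eqP->].
have Pp : prime_elt p by apply: Pps; rewrite mem_head.
have [q cpq] : exists q, char_poly y = p * q.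
  by rewrite cpE big_cons mulrCA; eexists.
have [a Aa] : divides p A.
  apply: (@divides_exp _ _ _ (s * r.+1)) => //; rewrite exprM eD cpq -mulrA.
  by eexists.
have : (n.+1 < size p)%N.
  apply: (@form_factor_size F F_C1 n p q r.+1); rewrite -?cpq.
  - exact: char_poly_monic.
  - rewrite /char_poly -det_map_mx; apply: det_homog => k k'.
    rewrite char_poly_generic !mxE summxE rpredD ?rpredMn //.
      by rewrite dhomogX /= mdeg1.
    apply: rpred_sum => i0 _; rewrite !mxE mulrC mul_mpolyC; apply: rpredZ.
    by rewrite dhomogX /= mdeg1.
  (* A zero of the form would be a singular element of [S], nilpotent by locality and hence radical;
     freeness modulo the radical makes its coordinates vanish. *)
  - move=> w [i0 wi0]; rewrite /char_poly -det_map_mx char_poly_generic.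
    set z := _ + _; have zE : z = \sum_(k < n) w (inord k) *: d k + (w (inord n))%:M.
      rewrite /z addrC; congr (_ + _); apply: eq_bigr => k _; congr (_ *: _).
      by apply/matrixP => k1 k2; rewrite mxE.
    have Sz : S z.
      rewrite zE; apply: (SD); last by rewrite -[w _]mulr1 -scale_scalar_mx; apply: (SZ).
      by apply: nualg_sum => // k _; apply: (SZ).
    have [nz|] := lS Sz; last by rewrite unitmxE unitfE.
    have := local_rad nS lS Sz nz; rewrite zE => /(free (fun k => w (inord k))) [h0 hn].
    case/eqP: wi0; case: (unliftP ord_max i0) => [k ->|->]; last by rewrite -[ord_max]inord_val.
    rewrite -(h0 k); congr w; apply: ord_inj; rewrite lift_max inordK //.
    exact: leq_trans (ltn_ord k) (leqnSn n).
  - by case: Pp.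
rewrite ltnNge (leq_trans _ sA) // Aa.
have a0 : a != 0 by apply: contraNneq A0 => a0; rewrite Aa a0 mulr0.
have p0 : p != 0 by case: Pp.
rewrite size_mul //; move: a0; rewrite -size_poly_gt0.
by case: (size a) => // b _; rewrite addnS leq_addr.
Qed.

End LocalAlgebra.

(** * Representations and generators *)

Lemma local_lie_nil (F : fieldType) (F_C1 : C1_field F) r (S : 'M[F]_r -> Prop) :
  nualg S -> S 1%:M -> (forall x, S x -> nilmx x \/ x \in unitmx) ->
  forall x y, S x -> S y -> nilmx (lie x y).
Proof.
case: r S => [|r] S nS S1 lS x y Sx Sy.
  by exists 0%N; rewrite [LHS]flatmx0 [RHS]flatmx0.
by apply: (rad_nil S1); apply: local_commutator.
Qed.

(** In a full-rank factorisation [e = C B], the outer factors of [C B C B = C B] can be cancelled,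
    which leaves [B C = 1]. *)
Lemma split_idem (k : fieldType) n (e : 'M[k]_n) : e *m e = e ->
  exists (C : 'M[k]_(n, \rank e)) (B : 'M[k]_(\rank e, n)),
    [/\ C *m B = e, B *m C = 1%:M, e *m C = C & B *m e = B].
Proof.
move=> ee; move: (mulmx_base e) (col_base_full e) (row_base_free e).
move: (col_base e) (row_base e); move: (\rank e) => r C B CB Cfull Bfree.
exists C, B.
have BC : B *m C = 1%:M.
  apply: (row_full_inj Cfull); apply: (row_free_inj Bfree).
  by rewrite mulmx1 mulmxA CB -mulmxA CB ee.
by split=> //; rewrite -CB ?mulmxA ?BC ?mul1mx // -mulmxA BC mulmx1.
Qed.

Section Reps.
Variables (F : fieldType) (A : falgType F).

(* Modules are spaces of row vectors, on which [a] acts by right multiplication with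
   [X a]; hence the reversal of products. *)
Definition is_rep (k : fieldType) (i : {rmorphism F -> k}) n (X : A -> 'M[k]_n) :=
  [/\ forall a b, X (a + b) = X a + X b, forall c a, X (c *: a) = i c *: X a,
      X 1 = 1%:M & forall a b, X (a * b) = X b *m X a].

Definition hom (k : fieldType) m n (X : A -> 'M[k]_m) (Y : A -> 'M[k]_n)
  (f : 'M[k]_(m, n)) := forall a, X a *m f = f *m Y a.

Section Hom.
Variables (k : fieldType).

Lemma hom0 m n (X : A -> 'M[k]_m) (Y : A -> 'M[k]_n) : hom X Y 0.
Proof. by move=> a; rewrite mulmx0 mul0mx. Qed.

Lemma homD m n (X : A -> 'M[k]_m) (Y : A -> 'M[k]_n) f g :
  hom X Y f -> hom X Y g -> hom X Y (f + g).
Proof. by move=> hf hg a; rewrite mulmxDr mulmxDl hf hg. Qed.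

Lemma homZ m n (X : A -> 'M[k]_m) (Y : A -> 'M[k]_n) c f :
  hom X Y f -> hom X Y (c *: f).
Proof. by move=> hf a; rewrite -scalemxAr -scalemxAl hf. Qed.

Lemma homM m n p (X : A -> 'M[k]_m) (Y : A -> 'M[k]_n) (Z : A -> 'M[k]_p) f g :
  hom X Y f -> hom Y Z g -> hom X Z (f *m g).
Proof. by move=> hf hg a; rewrite mulmxA hf -!mulmxA hg. Qed.

Lemma hom1 n (X : A -> 'M[k]_n) : hom X X 1%:M.
Proof. by move=> a; rewrite mulmx1 mul1mx. Qed.

Lemma homN m n (X : A -> 'M[k]_m) (Y : A -> 'M[k]_n) f :
  hom X Y f -> hom X Y (- f).
Proof. by rewrite -scaleN1r; apply: homZ. Qed.

Lemma homB m n (X : A -> 'M[k]_m) (Y : A -> 'M[k]_n) f g :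
  hom X Y f -> hom X Y g -> hom X Y (f - g).
Proof. by move=> hf hg; apply: homD => //; apply: homN. Qed.

Lemma hom_sum m n (X : A -> 'M[k]_m) (Y : A -> 'M[k]_n) (I : Type) (r : seq I)
    (P : pred I) f :
  (forall i, P i -> hom X Y (f i)) -> hom X Y (\sum_(i <- r | P i) f i).
Proof. by move=> h; apply: (big_ind (hom X Y)) => //; [exact: hom0|exact: homD]. Qed.

Lemma nualg_hom n (X : A -> 'M[k]_n) : nualg (hom X X).
Proof. by split; [exact: hom0|exact: homD|exact: homZ|move=> x y; exact: homM]. Qed.

(* [X] is a direct summand of a finite power of [N]. *)
Definition in_add m n (N : A -> 'M[k]_n) (X : A -> 'M[k]_m) :=
  exists (I : finType) (al : I -> 'M[k]_(m, n)) (be : I -> 'M[k]_(n, m)),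
    [/\ forall c, hom X N (al c), forall c, hom N X (be c) &
        \sum_c al c *m be c = 1%:M].

Lemma in_add_trans m n p (N : A -> 'M[k]_n) (N' : A -> 'M[k]_p) (X : A -> 'M[k]_m) :
  in_add N' N -> in_add N X -> in_add N' X.
Proof.
move=> [I' [al' [be' [hal' hbe' e']]]] [I [al [be [hal hbe e]]]].
exists (I * I')%type, (fun c => al c.1 *m al' c.2), (fun c => be' c.2 *m be c.1); split.
- by move=> c; apply: homM (hal _) (hal' _).
- by move=> c; apply: homM (hbe' _) (hbe _).
rewrite -e -(pair_bigA _ (fun c c' => al c *m al' c' *m (be' c' *m be c))) /=.
apply: eq_bigr => c _.
under eq_bigr => c' _ do rewrite -!mulmxA (mulmxA (al' c')).
by rewrite -mulmx_sumr -mulmx_suml e' mul1mx.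
Qed.

Lemma sub_rep (i : {rmorphism F -> k}) n r (X : A -> 'M[k]_n) (C : 'M[k]_(n, r))
    (B : 'M[k]_(r, n)) : is_rep i X -> B *m C = 1%:M -> hom X X (C *m B) ->
  let Y := fun a => B *m X a *m C in
  [/\ is_rep i Y, hom X Y C & hom Y X B].
Proof.
move=> [XD XZ X1 XM] BC hCB Y; split.
- split=> [a b|c a||a b]; rewrite /Y.
  + by rewrite XD mulmxDr mulmxDl.
  + by rewrite XZ -scalemxAr -scalemxAl.
  + by rewrite X1 mulmx1.
  + by rewrite XM !mulmxA -[_ *m C *m B]mulmxA -[_ *m X b *m (C *m B)]mulmxA hCB
      !mulmxA BC mul1mx.
- move=> a; rewrite /Y !mulmxA -hCB -!mulmxA BC mulmx1 //.
- by move=> a; rewrite /Y -!mulmxA hCB !mulmxA BC mul1mx.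
Qed.

End Hom.

(** An additive generator of the finite-dimensional modules; its endomorphism ring is, up to Morita
    equivalence, the Auslander algebra of [A]. *)
Definition generator n (N : A -> 'M[F]_n) :=
  forall m (X : A -> 'M[F]_m), is_rep idfun X -> in_add N X.

(** * Generators of least dimension *)

Section Minimal.
Variables (d : nat) (N : A -> 'M[F]_d).
Hypotheses (N_rep : is_rep idfun N) (N_gen : generator N).
Hypothesis N_min : forall d' (N' : A -> 'M[F]_d'),
  is_rep idfun N' -> generator N' -> (d <= d')%N.

Local Notation Gam := (hom N N).
Let nG : nualg Gam := nualg_hom N.
Let G1 : Gam 1%:M := @hom1 F d N.

(* [e] is the image of a summand of [N (1 - e)], which is then a smaller generator unless
   [e = 0]. *)
Lemma min_idem e a b : Gam e -> Gam a -> Gam b -> e *m e = e ->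
  e = a *m (1%:M - e) *m b -> e = 0.
Proof.
move=> Ge Ga Gb ee eE; have G1e := homB G1 Ge.
have ee' : (1%:M - e) *m (1%:M - e) = 1%:M - e.
  by rewrite mulmxBr mulmx1 mulmxBl mul1mx ee subrr subr0.
have [C [B [CB BC eC Be]]] := split_idem ee'.
have [|Yrep hC hB] := sub_rep N_rep BC; first by rewrite CB.
set Y := fun _ => _ in Yrep hC hB.
have addN : in_add Y N.
  exists bool, (fun c => if c then C else a *m C), (fun c => if c then B else B *m b).
  split=> [[]|[]|] //.
  - exact: homM Ga hC.
  - exact: homM hB Gb.
  by rewrite big_bool /= CB -mulmxA (mulmxA C) CB mulmxA -eE subrK.
have Ygen : generator Y by move=> m X Xrep; apply: in_add_trans addN (N_gen Xrep).
have := N_min Yrep Ygen; rewrite leqNgt => ltn.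
have : row_full (1%:M - e) by rewrite /row_full eqn_leq rank_leq_row leqNgt.
rewrite row_full_unit => u.
have : e = 1%:M *m e by rewrite mul1mx.
rewrite -(mulVmx u) -mulmxA mulmxBl mul1mx ee subrr mulmx0 //.
Qed.

(** Modulo the radical, an [x] of square zero behaves like a matrix unit between two isomorphic
    summands of [N], and minimality forbids a repeated summand. Concretely a nonzero idempotent
    [e = x w] factors through [1 - e], against [min_idem]. *)
Lemma min_rad_sqr x : Gam x -> rad Gam (x *m x) -> rad Gam x.
Proof.
move=> Gx rxx; split=> // y Gy; apply: contrapT => nxy.
have [w0 [Gw0 _ ee e0]] := idem_notnil nG (homM Gx Gy) nxy.
have [e Ee] : {e | e = x *m y *m w0} by exists (x *m y *m w0).
rewrite -Ee in ee e0.
have Ge : Gam e by rewrite Ee; do !apply: homM.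
have [w Ew] : {w | w = y *m w0 *m e} by exists (y *m w0 *m e).
have Gw : Gam w by rewrite Ew; do !apply: homM.
have xw : x *m w = e by rewrite Ew !mulmxA -Ee ee.
(* [j] is the error in the factorisation of [e] through [1 - e]; replacing its inner [e] by [x w]
   makes [x x] appear, so [j] is radical and [1 - j] invertible. *)
have [j Ej] : {j | j = e *m (x *m w *m x *m e *m w) *m e} by eexists.
have rj : rad Gam j.
  rewrite Ej; apply: radMr => //; apply: radMl => //.
  have -> : x *m w *m x *m e *m w = x *m (w *m (x *m x *m w)) *m w.
    by rewrite -xw !mulmxA.
  by apply: radMr => //; apply: radMl => //; apply: radMl => //; apply: radMr.
have Gj := radS rj.
have u1 := nil_unit (rad_nil G1 rj).
have Gu : Gam (invmx (1%:M - j)).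
  by move=> a; apply: (can_inj (mulmxK u1)); rewrite mulmxKV //;
   rewrite -[RHS]mulmxA [N a *m _](homB G1 Gj) mulmxA mulVmx // mul1mx.
apply: e0; apply: (@min_idem e (e *m x *m w *m x) (w *m e *m invmx (1%:M - j))) => //.
- by do !apply: homM.
- by do !apply: homM.
have h : e *m x *m w *m x *m (1%:M - e) *m (w *m e) = e *m (1%:M - j).
  rewrite mulmxBr mulmx1 mulmxBl mulmxBr mulmx1 Ej !mulmxA.
  rewrite -(mulmxA e x w) xw !ee -(mulmxA e x w) xw ee.
  by rewrite ee.
by rewrite mulmxA h mulmxK.
Qed.

Lemma min_rad_nil x : Gam x -> nilmx x -> rad Gam x.
Proof.
move=> Gx [s xs0].
have : rad Gam (x ^+ (2 ^ s)).
  have -> : x ^+ (2 ^ s) = 0.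
    by rewrite -(subnK (ltnW (ltn_expl s (isT : (1 < 2)%N)))) exprD xs0 mulr0.
  exact: rad0.
elim: s {xs0} => [|s IH]; first by rewrite expr1.
rewrite expnS mulnC exprM expr2 => h; apply: IH; apply: min_rad_sqr h.
have [m ->] : exists m, (2 ^ s = m.+1)%N by exists (2 ^ s).-1; rewrite prednK ?expn_gt0.
exact: (@nualgX _ _ Gam x m nG Gx).
Qed.

Hypothesis F_C1 : C1_field F.

Let eGe_rank (e e1 : 'M[F]_d) : e *m e = e -> e1 *m e1 = e1 -> e *m e1 = e1 -> e1 *m e = e1 ->
  e1 <> e -> (\rank e1 < \rank e)%N.
Proof.
move=> ee ee1 l1 r1 ne.
have le : (e1 <= e)%MS by rewrite -r1 submxMl.
rewrite ltn_neqAle mxrankS // andbT (mxrank_leqif_eq le); apply/negP => /eqmxP e'.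
apply: ne; have /submxP[D eD] : (e <= e1)%MS by rewrite e'.
by rewrite -l1 eD -mulmxA ee1.
Qed.

(* By C1, [e Gam e] is commutative modulo the radical when [e] is primitive; otherwise
   [e] splits, since idempotents are central modulo the radical. *)
Let min_lie_idem m (e : 'M[F]_d) : (\rank e <= m)%N -> Gam e -> e *m e = e ->
  forall x y, Gam x -> Gam y -> e *m x *m e = x -> e *m y *m e = y -> rad Gam (lie x y).
Proof.
elim: m e => [|m IH] e re Ge ee x y Gx Gy ex ey.
  move: re; rewrite leqn0 mxrank_eq0 => /eqP e0.
  by rewrite -ex e0 !mul0mx /lie mul0mx mulmx0 subrr; apply: rad0.
(* In the first case [z] is neither radical nor right invertible in the corner of [e], so its
   Fitting idempotent [e1] is neither 0 nor [e], and both [e1] and [e - e1] have smaller rank. *)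
have [[z [Gz ez nz nu]]|prim] := pselect (exists z, [/\ Gam z, e *m z *m e = z,
    ~ rad Gam z & ~ exists w, Gam w /\ z *m w = e]).
- have nS : nualg (fun z => Gam z /\ e *m z *m e = z).
    split=> [|u v [Gu eu] [Gv ev]|c u [Gu eu]|u v [Gu eu] [Gv ev]].
    + by split; [exact: hom0|rewrite mulmx0 mul0mx].
    + by split; [exact: homD|rewrite mulmxDr mulmxDl eu ev].
    + by split; [exact: homZ|rewrite -scalemxAr -scalemxAl eu].
    split; first exact: homM.
    have eu' : e *m u = u by rewrite -eu !mulmxA ee.
    have ve' : v *m e = v by rewrite -ev -!mulmxA ee.
    by rewrite mulmxA eu' -mulmxA ve'.
  have [w [[Gw ew] cw ee1 [s hs]]] := fitting nS (conj Gz ez).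
  have ez' : e *m z = z by rewrite -ez !mulmxA ee.
  have we' : w *m e = w by rewrite -ew -!mulmxA ee.
  have [e1 E1] : {e1 | e1 = z *m w} by eexists.
  rewrite -E1 in ee1 hs.
  have ee1l : e *m e1 = e1 by rewrite E1 mulmxA ez'.
  have ee1r : e1 *m e = e1 by rewrite E1 -mulmxA we'.
  have Ge1 : Gam e1 by rewrite E1; apply: homM.
  have ne1 : e1 <> e by move=> h; apply: nu; exists w; rewrite -E1.
  have ne0 : e1 <> 0.
    by move=> h; apply: nz; apply: min_rad_nil => //; exists s; rewrite h subr0 mulmx1 in hs.
  have [e2 E2] : {e2 | e2 = e - e1} by eexists.
  have ee2 : e2 *m e2 = e2.
    by rewrite E2 mulmxBl !mulmxBr ee ee1 ee1l ee1r subrr subr0.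
  have ee2l : e *m e2 = e2 by rewrite E2 mulmxBr ee ee1l.
  have ee2r : e2 *m e = e2 by rewrite E2 mulmxBl ee ee1r.
  have Ge2 : Gam e2 by rewrite E2; apply: homB.
  have e12 : e1 *m e2 = 0 by rewrite E2 mulmxBr ee1r ee1 subrr.
  have e21 : e2 *m e1 = 0 by rewrite E2 mulmxBl ee1l ee1 subrr.
  have ne2 : e2 <> e.
    rewrite E2 => /eqP; rewrite -subr_eq0 addrC addrA addNr sub0r oppr_eq0 => /eqP.
    exact: ne0.
  have r1 : (\rank e1 <= m)%N by rewrite -ltnS; apply: leq_trans re; apply: eGe_rank.
  have r2 : (\rank e2 <= m)%N by rewrite -ltnS; apply: leq_trans re; apply: eGe_rank.
  (* Off-diagonal Peirce components have square zero, hence are radical. *)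
  have off f g u : Gam f -> Gam g -> Gam u -> g *m f = 0 -> rad Gam (f *m u *m g).
    move=> Gf Gg Gu gf; apply: min_rad_sqr; first by do !apply: homM.
    rewrite !mulmxA -(mulmxA _ g f) gf mulmx0 !mul0mx; exact: rad0.
  have dec u : Gam u -> e *m u *m e = u ->
      exists2 j, rad Gam j & u = e1 *m u *m e1 + e2 *m u *m e2 + j.
    move=> Gu eu; exists (e1 *m u *m e2 + e2 *m u *m e1).
      by apply: radD => //; apply: off.
    have {1}<- : (e1 + e2) *m u *m (e1 + e2) = u by rewrite E2 addrC subrK.
    by rewrite !mulmxDl !mulmxDr [e2 *m u *m e1 + _]addrC addrACA.
  have [j rj xE] := dec x Gx ex; have [j' rj' yE] := dec y Gy ey.
  have hj := radS rj; have hj' := radS rj'.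
  have [JD JZ] : (forall u v, rad Gam u -> rad Gam v -> rad Gam (u + v)) /\
      (forall c u, rad Gam u -> rad Gam (c *: u)).
    by have [_ h1 h2 _] := nualg_rad nG.
  have Lj u v : rad Gam u -> Gam v -> rad Gam (lie u v) by exact: rad_lie.
  have Lj' u v : rad Gam u -> Gam v -> rad Gam (lie v u).
    by move=> ru Gv; rewrite lieN -scaleN1r; apply: (JZ); apply: Lj.
  have diag f : f = e1 \/ f = e2 -> rad Gam (lie (f *m x *m f) (f *m y *m f)).
    move=> hf; have [Gf ff rf] : [/\ Gam f, f *m f = f & (\rank f <= m)%N].
      by case: hf => ->.
    by apply: (IH f) => //; do ?apply: homM => //; rewrite !mulmxA ff -!mulmxA ff.
  have orth (f g u v : 'M[F]_d) : f *m g = 0 -> g *m f = 0 -> lie (f *m u *m f) (g *m v *m g) = 0.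
    move=> fg gf; rewrite /lie !mulmxA -(mulmxA _ f g) fg mulmx0 !mul0mx sub0r.
    by rewrite -(mulmxA _ g f) gf mulmx0 !mul0mx oppr0.
  rewrite xE lieDl; apply: (JD); last exact: Lj.
  rewrite yE lieDr; apply: (JD); last by apply: Lj' => //; apply: homD; do !apply: homM.
  rewrite lieDl !lieDr (orth e1 e2) // (orth e2 e1) // addr0 add0r.
  by apply: (JD); apply: diag; [left|right].
have [C [B [CB BC eC Be]]] := split_idem ee.
have [|Yrep hC hB] := sub_rep N_rep BC; first by rewrite CB.
set Y := fun _ => _ in Yrep hC hB.
(* The corner of [e] is the endomorphism ring of the image [Y] of [e]. In the remaining case it is
   local: an endomorphism is radical, hence nilpotent, or invertible. *)
have lY z : hom Y Y z -> nilmx z \/ z \in unitmx.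
  move=> hz; have Gz : Gam (C *m z *m B) by apply: homM hB; apply: homM hC hz.
  have ez : e *m (C *m z *m B) *m e = C *m z *m B by rewrite !mulmxA eC -mulmxA Be.
  have BzC : B *m (C *m z *m B) *m C = z by rewrite !mulmxA BC mul1mx -mulmxA BC mulmx1.
  have [rz|nrz] := pselect (rad Gam (C *m z *m B)).
    left; rewrite -[z]mulmx1 -BC mulmxA; apply: nilM.
    by rewrite mulmxA; apply: (rad_nil G1 rz).
  right; have [w [Gw hw]] : exists w, Gam w /\ C *m z *m B *m w = e.
    by apply: contrapT => nw; apply: prim; exists (C *m z *m B).
  have : z *m (B *m w *m C) = 1%:M.
    have -> : z *m (B *m w *m C) = B *m (C *m z *m B *m w) *m C.
      by rewrite !mulmxA BC mul1mx.
    by rewrite hw Be BC.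
  by case/mulmx1_unit.
have := local_lie_nil F_C1 (nualg_hom Y) (@hom1 F _ Y) lY
  (homM hB (homM Gx hC)) (homM hB (homM Gy hC)).
case=> s hs; apply: min_rad_nil.
  by apply: homB; apply: homM.
exists s.+1.
have -> : lie x y = C *m (lie (B *m (x *m C)) (B *m (y *m C)) *m B).
  have comp u v : e *m u *m e = u -> e *m v *m e = v ->
      u *m v = C *m (B *m (u *m C) *m (B *m (v *m C)) *m B).
    move=> eu ev; have eu1 : e *m u = u by rewrite -eu !mulmxA ee.
    have eu2 : u *m e = u by rewrite -eu -!mulmxA ee.
    have ev2 : v *m e = v by rewrite -ev -!mulmxA ee.
    by rewrite !mulmxA CB eu1 -(mulmxA u) CB eu2 -(mulmxA _ C) CB -mulmxA ev2.
  by rewrite /lie mulmxBl mulmxBr -!comp.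
by rewrite exprMM -(mulmxA (lie _ _) B C) BC mulmx1 hs mulmx0 mul0mx.
Qed.

Lemma min_lie x y : Gam x -> Gam y -> rad Gam (lie x y).
Proof.
move=> Gx Gy; apply: (@min_lie_idem d 1%:M) => //; rewrite ?mulmx1 ?mul1mx //.
exact: rank_leq_row.
Qed.

End Minimal.
End Reps.

(** * Finite intermediate fields *)

Section FiniteSubring.
Variables (F K : fieldType) (iota : {rmorphism F -> K}).

Definition fin_span (I : finType) (V : I -> K) x := exists c : I -> F, x = \sum_i iota (c i) * V i.

Definition fin_ring (T : K -> Prop) :=
  [/\ exists n (V : 'I_n -> K), forall x, T x <-> fin_span V x, T 1 &
      forall x y, T x -> T y -> T (x * y)].

Lemma fin_span_enum (I : finType) (V : I -> K) x :
  fin_span V x <-> fin_span (fun u : 'I_#|I| => V (enum_val u)) x.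
Proof.
split=> -[c ->].
  exists (fun u => c (enum_val u)).
  by rewrite (reindex _ (onW_bij _ (@enum_val_bij I))).
exists (fun i => c (enum_rank i)); rewrite [RHS](reindex _ (onW_bij _ (@enum_val_bij I))) /=.
by apply: eq_bigr => u _; rewrite enum_valK.
Qed.

Section Ops.
Variables (T : K -> Prop) (fT : fin_ring T).

Lemma fin_ringD x y : T x -> T y -> T (x + y).
Proof.
have [[n [V TV]] _ _] := fT; move=> /TV[c ->] /TV[d ->]; apply/TV.
exists (fun i => c i + d i); rewrite -big_split; apply: eq_bigr => i _.
by rewrite rmorphD mulrDl.
Qed.

Lemma fin_ringZ a x : T x -> T (iota a * x).
Proof.
have [[n [V TV]] _ _] := fT; move=> /TV[c ->]; apply/TV.
exists (fun i => a * c i); rewrite mulr_sumr; apply: eq_bigr => i _.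
by rewrite rmorphM mulrA.
Qed.

Lemma fin_ringC a : T (iota a).
Proof. by rewrite -[iota a]mulr1; apply: fin_ringZ; case: fT. Qed.

Lemma fin_ring0 : T 0.
Proof. by rewrite -(rmorph0 iota); apply: fin_ringC. Qed.

Lemma fin_ring_horner (p : {poly F}) x : T x -> T (map_poly iota p).[x].
Proof.
move=> Tx; elim/poly_ind: p => [|p c IH]; first by rewrite rmorph0 horner0; apply: fin_ring0.
rewrite rmorphD rmorphM /= map_polyX map_polyC !hornerE.
by have [_ _ TM] := fT; apply: fin_ringD; [apply: TM|apply: fin_ringC].
Qed.

(** Multiplication by [x] has a matrix over [F] on the spanning family [V], of which [V] is an
    eigenvector, nonzero because 1 lies in its span. *)
Lemma fin_ring_algebraic x : T x -> algebraicOver iota x.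
Proof.
have [[n [V TV]] T1 TM] := fT; move=> Tx.
have VT u : T (V u).
  apply/TV; exists (fun i => (i == u)%:R).
  rewrite (bigD1 u) //= eqxx rmorph1 mul1r.
  by rewrite big1 ?addr0 // => i /negPf->; rewrite rmorph0 mul0r.
have [X hX] := choice (fun u => proj1 (TV _) (TM _ _ (VT u) Tx)).
pose M : 'M[F]_n := \matrix_(u, v) X v u.
exists (char_poly M); first by rewrite monic_neq0 // char_poly_monic.
rewrite map_char_poly -eigenvalue_root_char; apply/eigenvalueP.
exists (\row_u V u).
  apply/rowP => v; rewrite !mxE mulrC hX; apply: eq_bigr => u _.
  by rewrite !mxE mulrC.
have [c e] := proj1 (TV 1) T1; apply: contraTneq (oner_neq0 K) => V0; rewrite e big1 ?eqxx // => u _.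
by have := congr1 (fun r : 'rV_n => r 0 u) V0; rewrite !mxE => ->; rewrite mulr0.
Qed.

(** A relation for [x] with nonzero constant term expresses the inverse as a polynomial in [x]. *)
Lemma fin_ringV x : T x -> T x^-1.
Proof.
have [->|x0] := eqVneq x 0; first by rewrite invr0.
move=> Tx; have [p p0 px] := fin_ring_algebraic Tx.
have [m [q q0 pE]] := multiplicity_XsubC p 0.
rewrite p0 /= in q0; have qx : root (map_poly iota q) x.
  move: px; rewrite pE rmorphM rootM /= => /orP[//|].
  rewrite polyC0 subr0 rmorphXn /= map_polyX.
  by rewrite rootE hornerXn expf_eq0 (negPf x0) andbF.
elim/poly_ind: q q0 qx {pE} => [|r c _]; first by rewrite root0.
rewrite !rootE !hornerE ?mulr0 ?add0r => c0.
rewrite rmorphD rmorphM /= map_polyX map_polyC !hornerE addr_eq0 => /eqP e.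
have [_ _ TM] := fT.
have -> : x^-1 = iota (- c^-1) * (map_poly iota r).[x].
  apply: (mulIf x0); rewrite mulVf // -mulrA e rmorphN mulNr mulrN opprK.
  by rewrite -rmorphM mulVf // rmorph1.
exact/fin_ringZ/fin_ring_horner.
Qed.

Lemma fin_ring_interfield : exists E : interfield iota,
  (forall x, (x \in if_pred E) = `[<T x>]) /\ finite_degree E.
Proof.
have [[n [V TV]] T1 TM] := fT.
pose S : {pred K} := fun x => `[<T x>].
have SP x : (x \in S) = `[<T x>] by [].
have dS : GRing.divring_closed S.
  split; rewrite ?SP; first exact/asboolP.
    move=> x y; rewrite !SP => /asboolP Tx /asboolP Ty; apply/asboolP/fin_ringD => //.
    by rewrite -mulN1r -(rmorphN1 iota); apply: fin_ringZ.
  by move=> x y; rewrite !SP => /asboolP Tx /asboolP Ty; apply/asboolP/TM => //; apply: fin_ringV.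
pose D : divringClosed K := HB.pack S (GRing.isDivringClosed.Build K S dS).
have D0 c : iota c \in D by apply/asboolP/fin_ringC.
exists (Interfield D0); split=> //.
have VD u : V u \in D.
  apply/asboolP/TV; exists (fun i => (i == u)%:R).
  rewrite (bigD1 u) //= eqxx rmorph1 mul1r.
  by rewrite big1 ?addr0 // => i /negPf->; rewrite rmorph0 mul0r.
exists n, (fun u => Sub (V u) (VD u)) => x.
have /asboolP/TV[c e] : if_val (Interfield D0) x \in D by apply: (valP x).
exists c; apply: val_inj; rewrite -[val x]/(if_val _ x) e.
rewrite -[RHS]/(if_val (Interfield D0) _) raddf_sum; apply: eq_bigr => u _.
by [].
Qed.

End Ops.

Lemma fin_ring_base : fin_ring (fun x => exists c, x = iota c).
Proof.
split; last 1 first.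
- by move=> _ _ [a ->] [b ->]; exists (a * b); rewrite rmorphM.
- exists 1%N, (fun=> 1) => x; split=> [[c ->]|[c ->]].
    by exists (fun=> c); rewrite big_ord1 mulr1.
  by exists (c ord0); rewrite big_ord1 mulr1.
by exists 1; rewrite rmorph1.
Qed.

(** [T'] is [T[a]]: the powers of [a] below the degree of a monic relation suffice as generators
    over [T]. *)
Lemma fin_ring_adjoin T a : fin_ring T -> algebraicOver iota a ->
  exists T', [/\ fin_ring T', forall x, T x -> T' x & T' a].
Proof.
move=> fT /integral_algebraic[p mp pa].
have [[n [V TV]] T1 TM] := fT.
pose m := (size p).-1.
have aE : a ^+ m = - \sum_(k < m) iota p`_k * a ^+ k.
  move: pa; rewrite rootE horner_coef size_map_poly.
  have ps : size p = m.+1 by rewrite /m prednK // size_poly_gt0 monic_neq0.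
  rewrite ps big_ord_recr /= coef_map /= -[p`_m]/(lead_coef p) (monicP mp) rmorph1 mul1r.
  rewrite addrC addr_eq0 => /eqP ->; congr (- _); apply: eq_bigr => k _.
  by rewrite coef_map.
pose T' x := exists2 c : nat -> K, (forall k, T (c k)) & x = \sum_(k < m) c k * a ^+ k.
have T'D x y : T' x -> T' y -> T' (x + y).
  move=> [c hc ->] [d hd ->]; exists (fun k => c k + d k).
    by move=> k; apply: fin_ringD.
  by rewrite -big_split; apply: eq_bigr => k _; rewrite mulrDl.
have T'Z t x : T t -> T' x -> T' (t * x).
  move=> Tt [c hc ->]; exists (fun k => t * c k); first by move=> k; apply: TM.
  by rewrite mulr_sumr; apply: eq_bigr => k _; rewrite mulrA.
have T'0 : T' 0.
  exists (fun=> 0); first by move=> _; apply: fin_ring0.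
  by rewrite big1 // => k _; rewrite mul0r.
have T'sum (I : Type) (r : seq I) (P : pred I) f :
    (forall i, P i -> T' (f i)) -> T' (\sum_(i <- r | P i) f i).
  by move=> h; apply: (big_ind T').
have T'k k : (k < m)%N -> T' (a ^+ k).
  move=> lt; exists (fun l => (l == k)%:R).
    by move=> l; case: eqP => _; [exact: T1|exact: fin_ring0].
  rewrite (bigD1 (Ordinal lt)) //= eqxx mul1r big1 ?addr0 // => l /negPf ne.
  by rewrite -val_eqE /= in ne; rewrite ne mul0r.
have T'X x : T' x -> T' (a * x).
  move=> [c hc ->]; rewrite mulr_sumr; apply: (T'sum) => k _.
  rewrite mulrCA -exprS; apply: (T'Z) => //.
  have [lt|] := ltnP k.+1 m; first exact: T'k.
  rewrite leq_eqVlt ltnNge ltn_ord orbF => /eqP <-.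
  rewrite aE -mulN1r -(rmorphN1 iota); apply: (T'Z); first exact: fin_ringC.
  by apply: (T'sum) => l _; apply: (T'Z); [exact: fin_ringC|exact: T'k].
have T'M x y : T' x -> T' y -> T' (x * y).
  move=> [c hc ->] Ty; rewrite mulr_suml; apply: (T'sum) => k _; rewrite -mulrA.
  apply: (T'Z) => //; elim: (val k) => [|l IH]; first by rewrite mul1r.
  by rewrite exprS -mulrA; apply: (T'X).
have m0 : (0 < m)%N.
  rewrite lt0n; apply: contraTneq pa => m0.
  have := aE; rewrite m0 big_ord0 oppr0 expr0 => /eqP; rewrite oner_eq0 //.
have T'1 : T' 1 by rewrite -(expr0 a); apply: T'k.
exists T'; split=> //; last by rewrite -[a]mulr1; apply: (T'X).
  split=> //; exists _, (fun u : 'I_#|{: 'I_n * 'I_m}| =>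
    V (enum_val u).1 * a ^+ (enum_val u).2) => x.
  rewrite -(fin_span_enum (fun u : 'I_n * 'I_m => V u.1 * a ^+ u.2)); split.
    move=> [c hc ->]; have [C hC] := choice (fun k => proj1 (TV _) (hc k)).
    exists (fun u : 'I_n * 'I_m => C u.2 u.1).
    rewrite -(pair_bigA _ (fun i k : 'I_ _ => iota (C k i) * (V i * a ^+ k))) exchange_big /=.
    apply: eq_bigr => k _; rewrite {1}hC mulr_suml; apply: eq_bigr => i _.
    by rewrite mulrA.
  move=> [c ->]; apply: (T'sum) => -[i k] _ /=; rewrite mulrA.
  apply: (T'Z); last exact: T'k.
  apply: fin_ringZ => //; apply/TV; exists (fun l => (l == i)%:R).
  rewrite (bigD1 i) //= eqxx rmorph1 mul1r.
  by rewrite big1 ?addr0 // => l /negPf->; rewrite rmorph0 mul0r.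
by move=> x Tx; rewrite -[x]mulr1; apply: (T'Z).
Qed.

Lemma algebraic_interfield (s : seq K) : (forall x, x \in s -> algebraicOver iota x) ->
  exists E : interfield iota, finite_degree E /\ {subset s <= if_pred E}.
Proof.
move=> alg.
have [T [fT hT]] : exists T, fin_ring T /\ forall x, x \in s -> T x.
  elim: s alg => [|a s IH] alg; first by eexists; split; first exact: fin_ring_base.
  have [|T [fT hT]] := IH; first by move=> x xs; apply: alg; rewrite in_cons xs orbT.
  have [|T' [fT' TT' T'a]] := @fin_ring_adjoin T a fT; first by apply: alg; rewrite mem_head.
  exists T'; split=> // x; rewrite in_cons => /orP[/eqP->//|/hT]; exact: TT'.
have [E [ET fE]] := fin_ring_interfield fT; exists E; split=> // x xs.
by rewrite ET; apply/asboolP/hT.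
Qed.

(** The coordinate vectors of the elements of [E'] over a generating family of [E] form a subspace
    of [F^n]; a spanning set of it yields generators of [E']. *)
Lemma finite_degree_sub (E E' : interfield iota) : {subset if_pred E' <= if_pred E} ->
  finite_degree E -> finite_degree E'.
Proof.
move=> sub [n [e he]].
pose S (c : 'rV[F]_n) := \sum_i iota (c 0 i) * if_val E (e i).
have SD u v : S (u + v) = S u + S v.
  by rewrite /S -big_split; apply: eq_bigr => i _; rewrite mxE rmorphD mulrDl.
have SZ c u : S (c *: u) = iota c * S u.
  by rewrite /S mulr_sumr; apply: eq_bigr => i _; rewrite mxE rmorphM mulrA.
have [|||U HU] := @subspace_mx F n (fun c => S c \in if_pred E').
- by rewrite /S big1 ?rpred0 // => i _; rewrite mxE rmorph0 mul0r.
- by move=> u v; rewrite SD; apply: rpredD.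
- by move=> c u; rewrite SZ => h; apply: rpredM => //; apply: if_base.
have UE k : S (row k U) \in if_pred E' by apply/HU; apply: row_sub.
exists n, (fun k => Sub (S (row k U)) (UE k)) => x.
have xE : if_val E' x \in if_pred E by apply: sub; apply: (valP x).
have [c cE] := he (Sub (if_val E' x) xE).
have xS : if_val E' x = S (\row_i c i).
  rewrite -[LHS]/(if_val E (Sub (if_val E' x) xE)) cE.
  rewrite [LHS](raddf_sum (if_val E)); apply: eq_bigr => i _; rewrite mxE //.
have /submxP[D DE] : (\row_i c i <= U)%MS by apply/HU; rewrite -xS; apply: (valP x).
exists (fun k => D 0 k); apply: val_inj; rewrite -[val x]/(if_val E' x) xS DE.
rewrite -[RHS]/(if_val E' _) raddf_sum mulmx_sum_row.
have Ssum (I : Type) (r : seq I) (P : pred I) (f : I -> 'rV_n) :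
  S (\sum_(i <- r | P i) f i) = \sum_(i <- r | P i) S (f i).
  apply: (big_morph S SD); rewrite /S big1 // => i _; by rewrite mxE rmorph0 mul0r.
by rewrite Ssum; apply: eq_bigr => k _; rewrite SZ.
Qed.

End FiniteSubring.

(** * Bases and descent of relations *)

Lemma basis_mod (k : fieldType) m n (Q J : 'M[k]_(m, n) -> Prop) :
  Q 0 -> (forall x y, Q x -> Q y -> Q (x + y)) -> (forall c x, Q x -> Q (c *: x)) ->
  J 0 -> (forall x y, J x -> J y -> J (x + y)) -> (forall c x, J x -> J (c *: x)) ->
  exists t (g : 'I_t -> 'M[k]_(m, n)) (P : 'M[k]_(m * n, t)),
  [/\ forall i, Q (g i), forall i, mxvec (g i) *m P = delta_mx 0 i,
      forall x, J x -> mxvec x *m P = 0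
    & forall x, Q x -> J (x - \sum_i (mxvec x *m P) 0 i *: g i)].
Proof.
move=> Q0 QD QZ J0 JD JZ.
have [|||U HU] := @subspace_mx k _ (fun v => Q (vec_mx v)).
- by rewrite linear0.
- by move=> u v; rewrite linearD; apply: QD.
- by move=> a u; rewrite linearZ; apply: QZ.
have [|||V HV] := @subspace_mx k _ (fun v => J (vec_mx v)).
- by rewrite linear0.
- by move=> u v; rewrite linearD; apply: JD.
- by move=> a u; rewrite linearZ; apply: JZ.
have [t [B [P [BP VP BU UB]]]] := compl_basis U V.
exists t, (fun i => vec_mx (row i B)), P; split.
- by move=> i; apply/HU; apply: submx_trans BU; apply: row_sub.
- by move=> i; rewrite vec_mxK -row_mul BP row1.
- move=> x Jx; have /submxP[D ->] : (mxvec x <= V)%MS by apply/HV; rewrite mxvecK.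
  by rewrite -mulmxA VP mulmx0.
- move=> x Qx; have /UB : (mxvec x <= U)%MS by apply/HU; rewrite mxvecK.
  move/HV; rewrite linearB /= mxvecK mulmx_sum_row linear_sum /=.
  by under eq_bigr => i _ do rewrite linearZ.
Qed.

Lemma basis_mod_ext (k : fieldType) (R : comNzRingType) (j : {rmorphism k -> R}) m n
    (Q J : 'M[k]_(m, n) -> Prop) t (g : 'I_t -> 'M[k]_(m, n)) (P : 'M[k]_(m * n, t)) :
  (forall x, Q x -> J (x - \sum_i (mxvec x *m P) 0 i *: g i)) ->
  forall z, ext_span j Q z ->
  ext_span j J (z - \sum_i (mxvec z *m map_mx j P) 0 i *: map_mx j (g i)).
Proof.
move=> h z; elim/ext_span_ind' => [|c y IH|y y' IH IH'|x Qx].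
- rewrite linear0 mul0mx sub0r big1 ?oppr0; first exact: ext_span0.
  by move=> i _; rewrite mxE scale0r.
- have := ext_spanZ c IH; rewrite scalerBr scaler_sumr.
  congr (ext_span _ _ (_ - _)); apply: eq_bigr => i _.
  by rewrite scalerA [mxvec (c *: y)]linearZ /= -scalemxAl [in RHS]mxE.
- have := ext_spanD IH IH'; rewrite addrACA -opprD -big_split.
  congr (ext_span _ _ (_ - _)); apply: eq_bigr => i _.
  by rewrite [mxvec (y + y')]linearD /= mulmxDl [in RHS]mxE scalerDl.
- have := ext_span_map j (h x Qx); rewrite map_mxB map_mx_sum.
  congr (ext_span _ _ (_ - _)); apply: eq_bigr => i _.
  by rewrite map_mxZ -map_mxvec -map_mxM [in RHS]mxE.
Qed.

Lemma ext_span_eq0 (k : fieldType) (R : comNzRingType) (j : {rmorphism k -> R}) m n z :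
  ext_span j (fun x : 'M[k]_(m, n) => x = 0) z -> z = 0.
Proof.
elim/ext_span_ind' => [//|c y ->|y y' -> ->|x ->]; rewrite ?scaler0 ?addr0 //.
exact: map_mx0.
Qed.

(** The rank of a matrix over [F] does not change over [K]. Reducedness and the computation of
    homomorphisms both pass to [K] through such a linear system. *)
Lemma lin_descent (F K : fieldType) (iota : {rmorphism F -> K}) n (U : finType)
    (D : 'I_n -> U -> F) :
  (forall b : 'I_n -> F, (forall u, \sum_i b i * D i u = 0) -> forall i, b i = 0) ->
  forall c : 'I_n -> K, (forall u, \sum_i c i * iota (D i u) = 0) -> forall i, c i = 0.
Proof.
move=> h c hc; pose M : 'M[F]_(n, #|U|) := \matrix_(i, u) D i (enum_val u).
have Mfree : row_free M.
  rewrite -kermx_eq0; apply/eqP/row_matrixP => i; rewrite row0.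
  have e : row i (kermx M) *m M = 0 by rewrite -row_mul mulmx_ker row0.
  apply/rowP => l; rewrite mxE [RHS]mxE; apply: (h (fun l => kermx M i l)) => u.
  have := congr1 (fun r : 'rV_ _ => r 0 (enum_rank u)) e; rewrite !mxE => {2}<-.
  by apply: eq_bigr => l' _; rewrite !mxE enum_rankK.
have e : (\row_i c i) *m map_mx iota M = 0 *m map_mx iota M.
  rewrite mul0mx; apply/rowP => u; rewrite !mxE -[RHS](hc (enum_val u)).
  by apply: eq_bigr => i _; rewrite !mxE.
move=> i; have : \row_i c i = 0 by apply: row_free_inj e; rewrite row_free_map.
by move/rowP/(_ i); rewrite !mxE.
Qed.

(** * p-th powers and p-bases *)

Section CharP.
Variables (p : nat) (K : fieldType) (hp : p \in [pchar K]).

(* If [a] is not a p-th power, then 1, a, ..., a^(p-1) are independent over [K^p]: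
   otherwise a proper factor [('X - a)^k] of ['X^p - a^p] has coefficients in [K^p],
   among which [- k a]. *)
Lemma pth_power_free a (v : 'I_p -> K) : (forall b, b ^+ p != a) ->
  \sum_s v s ^+ p * a ^+ s = 0 -> forall s, v s = 0.
Proof.
move=> na; pose fr := pFrobenius_aut hp.
pose phi : {rmorphism {poly K} -> K} := horner_eval a \o map_poly fr.
have p0 : (0 < p)%N by apply: prime_gt0; case/andP: hp.
pose h := \poly_(s < p) (if insub s is Some s' then v s' else 0).
have hs (s : 'I_p) : h`_s = v s by rewrite coef_poly ltn_ord valK.
move=> e; have ph : phi h = 0.
  rewrite -[RHS]e /phi /= /horner_eval (horner_coef_wide _ (n := p)); last first.
    by rewrite (leq_trans (size_poly _ _)) // size_poly.
  by apply: eq_bigr => s _; rewrite coef_map /= hs pFrobenius_autE.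
suff h0 : h = 0 by move=> s; rewrite -hs h0 coef0.
apply/eqP; apply: contraT => h0.
pose X := 'X^p - a%:P; have X0 : X != 0 by rewrite monic_neq0 // monicXnsubC.
have frX : map_poly fr X = ('X - a%:P) ^+ p.
  rewrite rmorphB /= map_polyXn map_polyC /=.
  have hpX : p \in [pchar {poly K}].
    by rewrite inE; case/andP: hp => -> /=; rewrite -polyC_natr => /eqP->.
  rewrite -[RHS](pFrobenius_autE hpX) pFrobenius_autB_comm; last exact: mulrC.
  by rewrite !pFrobenius_autE -polyC_exp.
have pX : phi X = 0 by rewrite /phi /= /horner_eval frX !hornerE subrr expr0n gtn_eqF.
pose g := gcdp h X.
have g0 : g != 0 by rewrite gcdp_eq0 negb_and h0.
have pg : phi g = 0.
  have [[u w] /= /eqpP[[c d] /= /andP[c0 d0] euw]] := Bezoutp h X.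
  have : phi (d *: gcdp h X) = 0.
    by rewrite -euw -mul_polyC (rmorphM phi) (rmorphD phi) !(rmorphM phi) ph pX !mulr0 addr0 mulr0.
  rewrite -mul_polyC (rmorphM phi) => /eqP; rewrite mulf_eq0 => /orP[|/eqP//].
  by rewrite /phi /= /horner_eval map_polyC hornerC /= pFrobenius_autE expf_eq0 (negPf d0) andbF.
have : map_poly fr g %| ('X - a%:P) ^+ p by rewrite -frX dvdp_map dvdp_gcdr.
case/dvdp_exp_XsubCP => k le eqk.
have [c c0 gE] : exists2 c, c != 0 & map_poly fr g = c *: ('X - a%:P) ^+ k.
  have /eqpP[[c d] /= /andP[c0 d0] e'] := eqk; exists (c^-1 * d).
    by rewrite mulf_neq0 ?invr_eq0.
  by rewrite -scalerA -e' scalerA mulVf // scale1r.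
have sk : size (('X - a%:P) ^+ k) = k.+1 by rewrite size_exp_XsubC.
have sg : size g = k.+1 by rewrite -(size_map_poly fr) gE size_scale.
have kp : (k < p)%N.
  have h0' : h != 0 := h0.
  by rewrite -sg (leq_trans (leq_gcdpl _ h0')) // size_poly.
have k0 : (0 < k)%N.
  rewrite lt0n; apply: contra_eq_neq pg => k0; rewrite k0 in gE.
  by rewrite /phi /= /horner_eval gE !hornerE.
have kK : k%:R != 0 :> K.
  by rewrite -(dvdn_pcharf hp) gtnNdvd.
pose r := ('X - a%:P) ^+ k.
have r1 : r`_k.-1 = - (a *+ k).
  have := @coefPn_prod_XsubC K (nseq k a).
  by rewrite size_nseq -lt0n k0 !big_nseq iter_mulr_1 iter_addr_0 => /(_ isT).
have r0 : r`_k = 1.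
  by have := monicXsubC a => /(monic_exp k)/monicP; rewrite lead_coefE sk.
have gk i : g`_i ^+ p = c * r`_i.
  by have := congr1 (fun f : {poly K} => f`_i) gE; rewrite coef_map coefZ /= pFrobenius_autE.
have g1 := gk k; rewrite r0 mulr1 in g1.
have g2 := gk k.-1; rewrite r1 -g1 in g2.
have gk0 : g`_k != 0 by apply: contraNneq c0 => e'; rewrite -g1 e' expr0n gtn_eqF.
have kf : k%:R ^+ p = k%:R :> K by rewrite -(pFrobenius_autE hp) pFrobenius_aut_nat.
case/eqP: (na (- (g`_k.-1 / (g`_k * k%:R)))).
rewrite -(pFrobenius_autE hp) pFrobenius_autN pFrobenius_autE expr_div_n exprMn g2 kf.
rewrite -mulr_natr; field.
by rewrite kK expf_neq0.
Qed.

End CharP.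

Section Fields.
Variables (F K : fieldType) (iota : {rmorphism F -> K}).
Variables (p : nat) (hp : p \in [pchar F]).

Let p_gt0 : (0 < p)%N. Proof. by apply: prime_gt0; case/andP: hp. Qed.
Let hpK : p \in [pchar K]. Proof. by rewrite (fmorph_pchar iota). Qed.

Lemma Xn_subC_pchar (a : K) : 'X^p - (a ^+ p)%:P = ('X - a%:P) ^+ p.
Proof.
have hpX : p \in [pchar {poly K}].
  by rewrite inE; case/andP: hpK => -> /=; rewrite -polyC_natr => /eqP->.
rewrite -[RHS](pFrobenius_autE hpX) pFrobenius_autB_comm; last exact: mulrC.
by rewrite !pFrobenius_autE -polyC_exp.
Qed.

(** The minimal polynomial of [b] over [F] divides ['X^p - a], which is [('X - b)^p] over [K]; being
    separable, it equals ['X - b], so [b] comes from [F]. *)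
Lemma perfectly_closed_root a b : perfectly_closed iota -> b ^+ p = iota a ->
  exists c, c ^+ p = a.
Proof.
move=> pc ba.
pose X : {poly F} := 'X^p - a%:P.
have X0 : X != 0 by rewrite monic_neq0 // monicXnsubC.
have mX : map_poly iota X = ('X - b%:P) ^+ p.
  by rewrite rmorphB /= map_polyXn map_polyC /= -ba Xn_subC_pchar.
have rX : root (map_poly iota X) b by rewrite mX rootE !hornerE subrr expr0n gtn_eqF.
have [x|E [fE sE]] := @algebraic_interfield F K iota [:: b].
  by rewrite inE => /eqP->; exists X.
have [|f [mf irf rf sf]] := pc E fE b; first by apply: sE; rewrite mem_head.
have fX : f %| X.
  have [cop|/eqP] := boolP (size (gcdp f X) == 1%N).
    have copK : coprimep (map_poly iota f) (map_poly iota X) by rewrite coprimep_map.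
    by have := coprimep_root copK rf; rewrite -rootE rX.
  move/eqP/(irf.2 _) => /(_ (dvdp_gcdl _ _)) e.
  by rewrite -(eqp_dvdl _ e) dvdp_gcdr.
have : map_poly iota f %| ('X - b%:P) ^+ p by rewrite -mX dvdp_map.
case/dvdp_exp_XsubCP => k le eqk.
have k1 : k = 1%N.
  apply/eqP; rewrite eqn_leq; apply/andP; split.
    rewrite leqNgt; apply/negP => k2.
    have sfK : separable_poly (map_poly iota f) by rewrite separable_map.
    case/separable_polyP: sfK => /(_ ('X - b%:P) ('X - b%:P)).
    rewrite (eqp_dvdr _ eqk) -expr2 dvdp_exp2l // => /(_ isT).
    by rewrite coprimepp size_XsubC.
  rewrite lt0n; apply: contraTneq irf.1 => k0; move/eqp_size: eqk.
  by rewrite k0 expr0 size_poly1 size_map_poly => ->.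
have mfE : map_poly iota f = 'X - b%:P.
  apply/eqP; rewrite -eqp_monic ?monicXsubC ?monic_map //.
  by rewrite k1 expr1 in eqk.
exists (- f`_0); apply: (fmorph_inj iota); rewrite -ba rmorphXn rmorphN.
have := congr1 (fun q : {poly K} => q`_0) mfE; rewrite coef_map coefB coefX coefC /= => ->.
by rewrite sub0r opprK.
Qed.

Hypothesis F_C1 : C1_field F.

Lemma C1_pth_powers (f : 'I_p.+1 -> F) :
  exists v : 'I_p.+1 -> F, (exists i, v i != 0) /\ \sum_i f i * v i ^+ p = 0.
Proof.
pose P : {mpoly F[p.+1]} := \sum_i f i *: 'X_i ^+ p.
have hom : P \is p.-homog.
  apply: rpred_sum => i _; apply: rpredZ.
  have : ('X_i : {mpoly F[p.+1]}) ^+ p \is (1 * p).-homog by apply: dhomogMn; rewrite dhomogX /= mdeg1.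
  by rewrite mul1n.
have [|v [v0 e]] := F_C1 (n := p.+1) _ hom; first by rewrite p_gt0 leqnn.
exists v; split=> //; rewrite -[RHS]e raddf_sum; apply: eq_bigr => i _.
by rewrite /= mevalZ rmorphXn /= mevalXU.
Qed.

(* A C1 field has p-degree at most 1, so a single element generates it over its p-th powers;
   perfect closedness keeps the resulting p-basis free over [K^p]. *)
Lemma C1_pbasis : perfectly_closed iota -> exists t (b : 'I_t -> F),
  (forall c, exists d : 'I_t -> F, c = \sum_s d s ^+ p * b s) /\
  (forall k : 'I_t -> K, \sum_s k s ^+ p * iota (b s) = 0 -> forall s, k s = 0).
Proof.
move=> pc; have [[a na]|per] := pselect (exists a : F, forall c, c ^+ p != a); last first.
  exists 1%N, (fun=> 1); split=> [c|k].
    have [d de] : exists d, d ^+ p = c.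
      apply: contrapT => nd; apply: per; exists c => d; apply/eqP => e.
      by apply: nd; exists d.
    by exists (fun=> d); rewrite big_ord1 mulr1 de.
  rewrite big_ord1 rmorph1 mulr1 => /eqP; rewrite expf_eq0 => /andP[_ /eqP k0] s.
  by rewrite ord1.
have naK (b : K) : b ^+ p != iota a.
  apply/eqP => /(perfectly_closed_root pc)[c]; exact/eqP.
exists p, (fun s => a ^+ s); split=> [c|k]; last first.
  by under eq_bigr => s _ do rewrite rmorphXn; apply: pth_power_free.
(* The form is [c v_0^p + sum a^s v_(s+1)^p]. Freeness of the powers of [a] over the p-th powers
   forces [v_0] to be nonzero, so the equation can be solved for [c]. *)
have [v [[i0 vi0]]] := C1_pth_powers (fun i => if unlift ord0 i is Some s then a ^+ s else c).
rewrite big_ord_recl unlift_none; under eq_bigr => s _ do rewrite liftK.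
move=> e; have v0 : v ord0 != 0.
  apply: contraNneq vi0 => v0.
  case: (unliftP ord0 i0) => [s ->|->]; last by rewrite v0.
  apply/eqP; apply: (pth_power_free hp (v := fun s => v (lift ord0 s)) na).
  rewrite v0 expr0n gtn_eqF // mulr0 add0r in e; rewrite -[RHS]e.
  by apply: eq_bigr => s' _; rewrite mulrC.
exists (fun s => - v (lift ord0 s) / v ord0).
apply: (mulIf (expf_neq0 p v0)); rewrite mulr_suml.
move/eqP: e; rewrite addr_eq0 => /eqP ->; rewrite -sumrN; apply: eq_bigr => s _.
rewrite exprMn exprVn -(pFrobenius_autE hp (- _)) pFrobenius_autN pFrobenius_autE.
rewrite -mulrA mulrCA [RHS]mulrC; field.
by rewrite expf_neq0.
Qed.

End Fields.

(** * Commutative reduced algebras *)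

Lemma exprp_sum (R : nzRingType) p (hp : p \in [pchar R]) s (I : Type) (r : seq I) (f : I -> R) :
  (forall i j, GRing.comm (f i) (f j)) ->
  (\sum_(i <- r) f i) ^+ (p ^ s) = \sum_(i <- r) f i ^+ (p ^ s).
Proof.
move=> cf; elim: s => [|s IH]; first by rewrite expn0 expr1; under [RHS]eq_bigr => i _ do rewrite expr1.
rewrite expnSr exprM IH; under [RHS]eq_bigr => i _ do rewrite exprM.
have cf' i j : GRing.comm (f i ^+ (p ^ s)) (f j ^+ (p ^ s)) by apply/commrX/commr_sym/commrX.
elim: r {IH} => [|i r IH].
  by rewrite !big_nil expr0n gtn_eqF // prime_gt0 //; case/andP: hp.
rewrite !big_cons -IH -!(pFrobenius_autE hp) pFrobenius_autD_comm //.
exact: commr_sum.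
Qed.

Lemma pchar_mx (K : fieldType) q p : p \in [pchar K] -> p \in [pchar 'M[K]_q.+1].
Proof.
by rewrite !inE => /andP[-> /eqP p0] /=; rewrite -(rmorph_nat scalar_mx) p0 rmorph0.
Qed.

Lemma trace_sqr0 (K : fieldType) q (x : 'M[K]_q) : x *m x = 0 -> \tr x = 0.
Proof.
move: (mulmx_base x) (col_base_full x) (row_base_free x).
move: (col_base x) (row_base x); move: (\rank x) => r C B CB Cf Bf xx.
suff BC : B *m C = 0 by rewrite -CB mxtrace_mulC BC linear0.
apply: (row_full_inj Cf); apply: (row_free_inj Bf).
by rewrite mulmx0 mul0mx mulmxA CB -mulmxA CB.
Qed.

Lemma trace_idem (K : fieldType) q (e : 'M[K]_q) : e *m e = e -> \tr e = (\rank e)%:R.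
Proof.
move: (mulmx_base e) (col_base_full e) (row_base_free e).
move: (col_base e) (row_base e); move: (\rank e) => r C B CB Cf Bf ee.
have BC : B *m C = 1%:M.
  apply: (row_full_inj Cf); apply: (row_free_inj Bf).
  by rewrite mulmx1 mulmxA CB -mulmxA CB ee.
by rewrite -CB mxtrace_mulC BC mxtrace1.
Qed.

Section CommReduced.
Variables (F : fieldType) (q : nat) (E : 'M[F]_q.+1 -> Prop).
Hypothesis nE : nualg E.
Hypothesis Ec : forall x y, E x -> E y -> x *m y = y *m x.
Hypothesis Er : forall x, E x -> x *m x = 0 -> x = 0.

Let E0 : E 0. Proof. by case: nE. Qed.
Let ED x y : E x -> E y -> E (x + y). Proof. by case: nE => _ + _ _; apply. Qed.
Let EZ c x : E x -> E (c *: x). Proof. by case: nE => _ _ + _; apply. Qed.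
Lemma reduced_nil x : E x -> nilmx x -> x = 0.
Proof.
move=> Ex [s xs0]; have : x ^+ (2 ^ s) = 0.
  by rewrite -(subnK (ltnW (ltn_expl s (isT : (1 < 2)%N)))) exprD xs0 mulr0.
elim: s {xs0} => [|s IH]; first by rewrite expr1.
rewrite expnS mulnC exprM expr2 => h; apply: IH; apply: Er h.
have [m ->] : exists m, (2 ^ s = m.+1)%N by exists (2 ^ s).-1; rewrite prednK ?expn_gt0.
exact: nualgX.
Qed.

Lemma basis_comm_reduced : exists n (eps : 'I_n -> 'M[F]_q.+1) P,
  [/\ forall i, E (eps i), forall i, mxvec (eps i) *m P = delta_mx 0 i &
    forall x, E x -> x - \sum_i (mxvec x *m P) 0 i *: eps i = 0].
Proof.
have [||n [eps [P [h1 h2 _ h3]]]] := @basis_mod F _ _ E (fun x => x = 0) E0 ED EZ (erefl 0).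
- by move=> x y -> ->; rewrite addr0.
- by move=> c x ->; rewrite scaler0.
by exists n, eps, P.
Qed.

(** A nonzero [x] is not nilpotent, so some multiple [x w] is a nonzero idempotent, and its trace is
    its rank, nonzero in characteristic 0. *)
Lemma trace_nondeg x : [pchar F] =i pred0 -> E x ->
  (forall y, E y -> \tr (x *m y) = 0) -> x = 0.
Proof.
move=> ch0 Ex tr0; apply: reduced_nil => //; apply: contrapT => nx.
have [w [Ew _ ee e0]] := idem_notnil nE Ex nx.
apply: e0; apply/eqP; rewrite -mxrank_eq0; have := tr0 w Ew.
by rewrite trace_idem // => /eqP; rewrite ((pcharf0P F).1 ch0).
Qed.

Lemma coord_free n (eps : 'I_n -> 'M[F]_q.+1) P (c : 'I_n -> F) :
  (forall i, mxvec (eps i) *m P = delta_mx 0 i) ->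
  \sum_i c i *: eps i = 0 -> forall l, c l = 0.
Proof.
move=> h e l; have := congr1 (fun x => (mxvec x *m P) 0 l) e.
rewrite linear0 mul0mx [RHS]mxE => <-; rewrite linear_sum mulmx_suml summxE /=.
rewrite (bigD1 l) //= big1 ?addr0 => [|i ne]; rewrite linearZ /= -scalemxAl h !mxE /=.
  by rewrite eqxx mulr1.
by rewrite eq_sym (negPf ne) mulr0.
Qed.

Section Ext.
Variables (K : fieldType) (iota : {rmorphism F -> K}).
Local Notation EK := (ext_span iota E).

Lemma ext_comm x y : EK x -> EK y -> x *m y = y *m x.
Proof.
move=> sx sy; elim/ext_span_ind': sx => [|c t IH|t t' IH IH'|x0 Ex].
- by rewrite mulmx0 mul0mx.
- by rewrite -scalemxAl -scalemxAr IH.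
- by rewrite mulmxDl mulmxDr IH IH'.
elim/ext_span_ind': sy => [|c t IH|t t' IH IH'|y0 Ey].
- by rewrite mulmx0 mul0mx.
- by rewrite -scalemxAl -scalemxAr IH.
- by rewrite mulmxDl mulmxDr IH IH'.
by rewrite -!map_mxM Ec.
Qed.

Lemma coord_ext n (eps : 'I_n -> 'M[F]_q.+1) P (Q : 'M[F]_q.+1 -> Prop) :
  (forall x, Q x -> x - \sum_i (mxvec x *m P) 0 i *: eps i = 0) ->
  forall z, ext_span iota Q z ->
  z = \sum_i (mxvec z *m map_mx iota P) 0 i *: map_mx iota (eps i).
Proof.
move=> h z sz; apply/eqP; rewrite -subr_eq0; apply/eqP.
exact/(ext_span_eq0 (j := iota))/(basis_mod_ext h sz).
Qed.

Lemma coord_sum n (eps : 'I_n -> 'M[F]_q.+1) P (c : 'I_n -> K) :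
  (forall i, mxvec (eps i) *m P = delta_mx 0 i) ->
  mxvec (\sum_i c i *: map_mx iota (eps i)) *m map_mx iota P = \row_i c i.
Proof.
move=> h; rewrite linear_sum mulmx_suml /= [RHS]row_sum_delta; apply: eq_bigr => i _.
by rewrite linearZ /= -scalemxAl -map_mxvec -map_mxM h map_delta_mx mxE.
Qed.

End Ext.

Section Reduced.
Variables (K : fieldType) (iota : {rmorphism F -> K}).
Hypotheses (F_C1 : C1_field F) (pc : perfectly_closed iota).
Local Notation EK := (ext_span iota E).

(** In both cases [z z = 0] becomes a linear system over [F] in the coordinates of [z], with only
    the trivial solution over [F]. In characteristic 0 the system is orthogonality for the trace
    form; in characteristic [p] it is extracted from [z^p = 0] by means of a p-basis that stays free
    over [K^p]. *)
Lemma reduced_ext z : EK z -> z *m z = 0 -> z = 0.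
Proof.
move=> sz zz; have [n [eps [P [Eeps delta dec]]]] := basis_comm_reduced.
have zE := coord_ext dec sz; set c := (fun i => (mxvec z *m map_mx iota P) 0 i).
rewrite zE big1 // => i _; rewrite -/(c i); suff -> : c i = 0 by rewrite scale0r.
have zE' : z = \sum_i c i *: map_mx iota (eps i) by [].
clearbody c.
have [[p hp]|ch0] := pselect (exists p, p \in [pchar F]); last first.
  have {}ch0 : [pchar F] =i pred0 by move=> p; apply/negP => hp; apply: ch0; exists p.
  apply: (@lin_descent F K iota n _ (fun i j => \tr (eps i *m eps j)) _ c _ i) => [b hb|j].
    have x0 : \sum_i b i *: eps i = 0.
      apply: (trace_nondeg ch0); first by apply: nualg_sum => // l _; apply: EZ.
      move=> y Ey; have /eqP := dec y Ey; rewrite subr_eq0 => /eqP ->.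
      rewrite mulmx_sumr linear_sum big1 // => j _.
      rewrite -scalemxAr linearZ mulmx_suml linear_sum /=.
      by under eq_bigr => l _ do rewrite -scalemxAl linearZ; rewrite hb mulr0.
    exact: coord_free delta x0.
  have cz : map_mx iota (eps j) *m z = z *m map_mx iota (eps j).
    by apply: (ext_comm (iota := iota)) => //; apply: ext_span_map.
  have : \tr (z *m map_mx iota (eps j)) = 0.
    by apply: trace_sqr0; rewrite mulmxA -[_ *m _ *m z]mulmxA cz !mulmxA zz !mul0mx.
  rewrite zE' mulmx_suml linear_sum /= => e0; rewrite -[RHS]e0; apply: eq_bigr => l _.
  by rewrite -scalemxAl linearZ /= -map_mxM trace_map_mx.
have hpK : p \in [pchar K] by rewrite (fmorph_pchar iota).
have p_pr : prime p by case/andP: hp.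
have [t [b [bspan bfree]]] := C1_pbasis hp F_C1 pc.
have [C EC] : exists C : 'I_n -> 'I_n -> F, forall i j, C i j = (mxvec (eps i ^+ p) *m P) 0 j.
  by exists (fun i j => (mxvec (eps i ^+ p) *m P) 0 j).
have [D' hD'] := choice (fun u : 'I_n * 'I_n => bspan (C u.1 u.2)).
pose D i j := D' (i, j); have hD i j : C i j = \sum_s D i j s ^+ p * b s := hD' (i, j).
(* Frobenius is semilinear: coordinate [j] of the p-th power of a combination is a sum of p-th
   powers of linear forms over [F], weighted by the p-basis [b]. *)
have frob (k : fieldType) (f : {rmorphism F -> k}) (hk : p \in [pchar k]) (a : 'I_n -> k) j :
    (mxvec ((\sum_i a i *: map_mx f (eps i)) ^+ p) *m map_mx f P) 0 j =
    \sum_s (\sum_i a i * f (D i j s)) ^+ p * f (b s).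
  rewrite -{1}[p]expn1 (exprp_sum (pchar_mx q hk)); last first.
    move=> l l'; rewrite /GRing.comm -![_ * _]/(_ *m _) -!scalemxAl -!scalemxAr.
    by rewrite scalerA mulrC -scalerA -!map_mxM Ec.
  rewrite expn1 linear_sum mulmx_suml summxE /=.
  transitivity (\sum_i a i ^+ p * f (C i j)).
    apply: eq_bigr => l _; rewrite exprZn linearZ /= -scalemxAl mxE; congr (_ * _).
    by rewrite -rmorphXn /= -map_mxvec -map_mxM EC mxE.
  transitivity (\sum_i \sum_s (a i * f (D i j s)) ^+ p * f (b s)).
    apply: eq_bigr => l _; rewrite hD rmorph_sum mulr_sumr; apply: eq_bigr => s _.
    by rewrite /= rmorphM rmorphXn exprMn mulrA.
  rewrite exchange_big; apply: eq_bigr => s _ /=.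
  by rewrite -(pFrobenius_autE hk) rmorph_sum mulr_suml.
apply: (@lin_descent F K iota n _ (fun i (u : 'I_n * 'I_t) => D i u.1 u.2) _ c _ i) => [a ha|[j s]].
  have x0 : \sum_i a i *: eps i = 0.
    apply: reduced_nil; first by apply: nualg_sum => // l _; apply: EZ.
    exists p; have Ex : E ((\sum_i a i *: eps i) ^+ p).
      by rewrite -(prednK (prime_gt0 p_pr)); apply: nualgX => //; apply: nualg_sum => // l _; apply: EZ.
    have /eqP := dec _ Ex; rewrite subr_eq0 => /eqP ->; rewrite big1 // => j _.
    have := frob F idfun hp a j; rewrite map_mx_id //.
    under eq_bigr => l _ do rewrite map_mx_id //.
    move=> ->; rewrite big1 ?scale0r // => s _.
    by have /= -> := ha (j, s); rewrite expr0n gtn_eqF ?mul0r // prime_gt0.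
  exact: coord_free delta x0.
have zp : z ^+ p = 0.
  by rewrite -(subnK (prime_gt1 p_pr)) exprD expr2 -[z * z]/(z *m z) zz mulr0.
apply: (bfree (fun s => \sum_i c i * iota (D i j s))).
have := frob K iota hpK c j; rewrite -zE' zp linear0 mul0mx mxE => <-.
by [].
Qed.

End Reduced.
End CommReduced.

(** * Algebraicity of the entries of idempotents *)

Lemma splitting_ext n (K : fieldType) (p : {poly K}) : (size p <= n.+1)%N -> p \is monic ->
  exists (L : fieldType) (j : {rmorphism K -> L}) (rs : seq L),
    map_poly j p = \prod_(r <- rs) ('X - r%:P).
Proof.
elim: n K p => [|n IH] K p sp mp.
  exists K, idfun, [::]; rewrite big_nil map_poly_id //.
  have p0 : p`_0 = 1.
    have p1 : size p = 1%N by apply/eqP; rewrite eqn_leq sp size_poly_gt0 monic_neq0.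
    by have := monicP mp; rewrite lead_coefE p1.
  by rewrite (size1_polyC sp) p0.
have [s1|s1] := leqP (size p) 1.
  by apply: IH => //; rewrite (leq_trans s1).
pose P m := `[< exists f : {poly K}, [/\ f %| p, (1 < size f)%N & size f = m] >].
have exP : exists m, P m by exists (size p); apply/asboolP; exists p; rewrite dvdpp.
case: (ex_minnP exP) => m /asboolP[f [fp sf fm]] min.
have irf : irreducible_poly f.
  have f0 : f != 0 by rewrite -size_poly_gt0 ltnW.
  split=> // g g1 gf; rewrite -(dvdp_size_eqp gf) eqn_leq (dvdp_leq f0 gf) /= fm.
  apply: min; apply/asboolP; exists g; split=> //; first exact: dvdp_trans gf fp.
  rewrite ltn_neqAle eq_sym g1 size_poly_gt0.
  by apply: contraTneq gf => ->; rewrite dvd0p.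
have [L _ [z fz _]] := irredp_FAdjoin irf.
pose j0 : {rmorphism K -> L} := in_alg L.
have pz : root (map_poly j0 p) z by apply: root_dvdp fz; rewrite dvdp_map.
have [q pE] := factor_theorem _ _ pz.
have mq : q \is monic.
  by rewrite -(monicMr _ (monicXsubC z)) -pE monic_map.
have sq : (size q <= n.+1)%N.
  have := size_map_poly j0 p; rewrite pE size_Mmonic ?monic_neq0 ?monicXsubC // size_XsubC addn2 /=.
  by move=> e; rewrite -ltnS e.
have [L' [j1 [rs e]]] := IH L q sq mq.
exists L', (j1 \o j0), (j1 z :: rs).
by rewrite map_poly_comp pE rmorphM /= e big_cons mulrC map_polyXsubC.
Qed.

Lemma algebraic_sum (F K : fieldType) (iota : {rmorphism F -> K}) (I : Type) (r : seq I)
    (P : pred I) (f : I -> K) : (forall i, P i -> algebraicOver iota (f i)) ->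
  algebraicOver iota (\sum_(i <- r | P i) f i).
Proof.
move=> h; apply: (big_ind (algebraicOver iota)) => //; first exact: algebraic0.
exact: algebraic_add.
Qed.

(** In a splitting field the trace is the sum of the eigenvalues, and each of them is a root of
    [h]. *)
Lemma trace_algebraic (F K : fieldType) (iota : {rmorphism F -> K}) q (y : 'M[K]_q.+1)
    (h : {poly F}) : h != 0 -> horner_mx y (map_poly iota h) = 0 -> algebraicOver iota (\tr y).
Proof.
move=> h0 hy; have [L [j [rs e]]] := splitting_ext (leqnSn _) (char_poly_monic y).
pose ji : {rmorphism F -> L} := j \o iota.
have alg r : r \in rs -> algebraicOver ji r.
  move=> rr; exists h => //.
  have : root (map_poly j (char_poly y)) r by rewrite e root_prod_XsubC.
  rewrite map_char_poly -eigenvalue_root_char eigenvalue_root_min => rm.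
  apply: root_dvdp rm; apply: mxminpoly_min.
  by rewrite map_poly_comp -map_horner_mx hy map_mx0.
have srs : size rs = q.+1.
  have := size_char_poly y; rewrite -(size_map_poly j) e size_prod_XsubC => -[].
  by [].
have trE : j (\tr y) = \sum_(r <- rs) r.
  have := coefPn_prod_XsubC (ps := rs); rewrite srs => /(_ isT); rewrite -e coef_map /=.
  by rewrite (char_poly_trace y) // rmorphN /= => /oppr_inj.
have [f f0 fr] : algebraicOver ji (\sum_(r <- rs) r).
  by rewrite big_seq; apply: algebraic_sum.
exists f => //; move: fr; rewrite -trE map_poly_comp.
by rewrite fmorph_root.
Qed.

(** The factor ['X] removes the constant term, the only one from which [e] could not be pulled
    out. *)
Lemma horner_mx_idemM (K : fieldType) q (e x : 'M[K]_q.+1) (p : {poly K}) :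
  e *m e = e -> e *m x = x *m e ->
  horner_mx (e *m x) ('X * p) = e *m horner_mx x ('X * p).
Proof.
move=> ee ex; elim/poly_ind: p => [|p c IH]; first by rewrite mulr0 !rmorph0 mulmx0.
have -> : 'X * (p * 'X + c%:P) = ('X * p) * 'X + c *: 'X
  by rewrite mulrDr mulrA mulrC -mul_polyC [_%:P * _]mulrC.
rewrite !rmorphD /= !horner_mxZ !horner_mx_X ![horner_mx _ (_ * 'X)]rmorphM /= !horner_mx_X IH.
rewrite mulmxDr -scalemxAr; congr (_ + _).
rewrite -![_ * _]/(_ *m _) !mulmxA -(mulmxA e _ e).
have -> : horner_mx x ('X * p) *m e = e *m horner_mx x ('X * p).
  exact/esym/(comm_mx_horner ('X * p) ex).
by rewrite mulmxA ee.
Qed.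

Section IdemAlgebraic.
Variables (F : fieldType) (q : nat) (E : 'M[F]_q.+1 -> Prop).
Hypothesis nE : nualg E.
Hypothesis Ec : forall x y, E x -> E y -> x *m y = y *m x.
Hypothesis Er : forall x, E x -> x *m x = 0 -> x = 0.
Variables (K : fieldType) (iota : {rmorphism F -> K}).
Local Notation EK := (ext_span iota E).

Let E0 : E 0. Proof. by case: nE. Qed.
Let ED x y : E x -> E y -> E (x + y). Proof. by case: nE => _ + _ _; apply. Qed.
Let EZ c x : E x -> E (c *: x). Proof. by case: nE => _ _ + _; apply. Qed.
Let EM x y : E x -> E y -> E (x *m y). Proof. by case: nE => _ _ _ +; apply. Qed.

Lemma entries_algebraic n (eps : 'I_n -> 'M[F]_q.+1) (c : 'I_n -> K) i j :
  (forall l, algebraicOver iota (c l)) ->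
  algebraicOver iota ((\sum_l c l *: map_mx iota (eps l)) i j).
Proof.
move=> h; rewrite summxE; apply: algebraic_sum => l _; rewrite !mxE.
by apply: algebraic_mul => //; apply: algebraic_id.
Qed.

(** The Gram matrix of the trace form is invertible over [F], so the coordinates of [e] are
    [F]-combinations of the traces of the [e eps_l], and each [e eps_l] is annihilated by a
    polynomial over [F]. *)
Lemma idem_algebraic_char0 e i j : [pchar F] =i pred0 -> EK e -> e *m e = e ->
  algebraicOver iota (e i j).
Proof.
move=> ch0 se ee; have [n [eps [P [Eeps delta dec]]]] := basis_comm_reduced nE.
have eE := coord_ext dec se.
set c := (fun l => (mxvec e *m map_mx iota P) 0 l) in eE.
have {}eE : e = \sum_l c l *: map_mx iota (eps l) by [].
clearbody c.
pose G : 'M[F]_n := \matrix_(k, l) \tr (eps k *m eps l).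
have GU : G \in unitmx.
  rewrite -row_free_unit -kermx_eq0; apply/eqP/row_matrixP => k; rewrite row0.
  have vG : row k (kermx G) *m G = 0 by rewrite -row_mul mulmx_ker row0.
  move: (row k (kermx G)) vG => v vG.
  have x0 : \sum_l v 0 l *: eps l = 0.
    apply: (trace_nondeg nE Er ch0); first by apply: nualg_sum => // l _; apply: EZ.
    move=> y Ey; have /eqP := dec y Ey; rewrite subr_eq0 => /eqP ->.
    rewrite mulmx_sumr linear_sum big1 // => l _.
    rewrite -scalemxAr linearZ mulmx_suml linear_sum /=.
    have := congr1 (fun r : 'rV_n => r 0 l) vG; rewrite [RHS]mxE mxE => e0.
    rewrite (_ : \sum_(_ < _) _ = 0) ?mulr0 // -[RHS]e0.
    by apply: eq_bigr => l' _; rewrite -scalemxAl linearZ /= [in RHS]mxE.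
  by apply/rowP => l; rewrite [RHS]mxE; apply: (coord_free delta x0).
pose tau : 'rV[K]_n := \row_l \tr (e *m map_mx iota (eps l)).
have cE : \row_l c l = tau *m map_mx iota (invmx G).
  rewrite -[LHS]mulmx1 -(map_mx1 iota) -(mulmxV GU) map_mxM mulmxA; congr (_ *m _).
  apply/rowP => l; rewrite !mxE [in RHS]eE mulmx_suml linear_sum /=; apply: eq_bigr => k _.
  by rewrite -scalemxAl linearZ /= -map_mxM trace_map_mx !mxE.
rewrite eE; apply: entries_algebraic => l.
have -> : c l = (tau *m map_mx iota (invmx G)) 0 l by rewrite -cE mxE.
rewrite mxE; apply: algebraic_sum => k _; apply: algebraic_mul; last by rewrite mxE; apply: algebraic_id.
rewrite mxE; apply: (@trace_algebraic _ _ _ _ _ ('X * char_poly (eps k))).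
  by rewrite mulf_neq0 ?polyX_eq0 // monic_neq0 // char_poly_monic.
rewrite rmorphM /= map_polyX horner_mx_idemM //.
  by rewrite map_char_poly rmorphM /= Cayley_Hamilton mulr0 mulmx0.
by apply: (ext_comm Ec se); apply: ext_span_map.
Qed.

Section CharP.
Variables (p : nat) (hp : p \in [pchar F]).
Let hpK : p \in [pchar K]. Proof. by rewrite (fmorph_pchar iota). Qed.
Let p_pr : prime p. Proof. by case/andP: hp. Qed.

Let Q s := ext_span (idfun : {rmorphism F -> F}) (fun y => exists2 x, E x & y = x ^+ (p ^ s)).

Let EX x s : E x -> E (x ^+ (p ^ s)).
Proof.
have [m ->] : exists m, (p ^ s = m.+1)%N by exists (p ^ s).-1; rewrite prednK // expn_gt0 prime_gt0.
exact: nualgX.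
Qed.

Let QE s x : Q s x -> E x.
Proof.
by elim/ext_span_ind' => [//|c y|y z|_ [y Ey ->]]; [exact: EZ|exact: ED|rewrite map_mx_id //; exact: EX].
Qed.

Let exprp_lin (k : fieldType) (f : {rmorphism F -> k}) (hk : p \in [pchar k]) n (a : 'I_n -> k)
    (y : 'I_n -> 'M[F]_q.+1) s : (forall i, E (y i)) ->
  (\sum_i a i *: map_mx f (y i)) ^+ (p ^ s) =
  \sum_i a i ^+ (p ^ s) *: map_mx f (y i ^+ (p ^ s)).
Proof.
move=> Ey; rewrite (exprp_sum (pchar_mx q hk)); last first.
  move=> l l'; rewrite /GRing.comm -![_ * _]/(_ *m _) -!scalemxAl -!scalemxAr.
  by rewrite scalerA mulrC -scalerA -!map_mxM Ec.
by apply: eq_bigr => i _; rewrite exprZn rmorphXn.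
Qed.

(* The spans [Q s] decrease; on the stable one [T], the p-th powers of a basis [y] form a
   basis again, so the coordinates [b] of an idempotent [e = e ^+ p] over [y] satisfy
   [b ^ (p) = b A] with [A] over [F], and [b_i, b_i^p, b_i^(p^2), ...] span a finite
   dimensional [F]-space. *)
Lemma stable_power_basis : exists n (y : 'I_n -> 'M[F]_q.+1) (C A : 'M[F]_n),
  [/\ forall i, E (y i), forall i, y i ^+ p = \sum_l C i l *: y l, A *m C = 1%:M &
      forall e, EK e -> e *m e = e -> exists b : 'I_n -> K,
        e = \sum_i b i *: map_mx iota (y i) /\
        forall l, b l = \sum_i b i ^+ p * iota (C i l)].
Proof.
have nQ s : nualg (Q s).
  split; [exact: ext_span0|exact: ext_spanD|exact: ext_spanZ|].
  move=> u v; apply: (@ext_spanM F F idfun q.+1 q.+1 q.+1) => _ _ [x Ex ->] [y Ey ->].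
  exists (x *m y); first exact: EM.
  by rewrite -[x *m y]/(x * y) exprMn_comm //; apply: Ec.
have Qbase s x : E x -> Q s (x ^+ (p ^ s)).
  by move=> Ex; rewrite -(map_mx_id (f := idfun) _ (x ^+ _)) //; apply: ext_span_map; exists x.
have exU s : exists U : 'M[F]_(q.+1 * q.+1),
    forall v : 'rV_(q.+1 * q.+1), (v <= U)%MS <-> Q s (vec_mx v).
  have [Q0 QD QZ _] := nQ s; apply: subspace_mx; first by rewrite linear0.
    by move=> u v; rewrite linearD; apply: QD.
  by move=> c u; rewrite linearZ; apply: QZ.
pose R r := `[< exists s (U : 'M[F]_(q.+1 * q.+1)),
  (forall v : 'rV_(q.+1 * q.+1), (v <= U)%MS <-> Q s (vec_mx v)) /\ \rank U = r >].
have exR : exists r, R r.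
  by have [U hU] := exU 0%N; exists (\rank U); apply/asboolP; exists 0%N, U.
case: (ex_minnP exR) => r /asboolP[s [U [hU rU]]] min.
have Qstab x : Q s x -> Q s.+1 x.
  have [U' hU'] := exU s.+1.
  have UU' : (U' <= U)%MS.
    apply/rV_subP => v /hU' Qv; apply/hU; apply: ext_span_mono Qv => _ [z Ez ->].
    by exists (z ^+ (p ^ 1)); [exact: EX|rewrite -exprM -expnD addnC addn1].
  have : (U == U')%MS.
    rewrite andbC UU' /=; apply/negPn/negP => nle.
    have := mxrank_leqif_eq UU'; rewrite UU' (negPf nle) => -[le /eqP ne].
    have : R (\rank U') by apply/asboolP; exists s.+1, U'.
    by move/min; rewrite -rU => ge; case: ne; apply/eqP; rewrite eqn_leq le ge.
  move/eqmxP => eU Qx; rewrite -[x]mxvecK; apply/hU'; rewrite -eU; apply/hU.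
  by rewrite mxvecK.
have [Q0 QD QZ QM] := nQ s.
have [||n [y [P [Qy delta _ dec]]]] := @basis_mod F _ _ (Q s) (fun x => x = 0) Q0 QD QZ (erefl 0).
- by move=> ? ? -> ->; rewrite addr0.
- by move=> ? ? ->; rewrite scaler0.
have Ey i : E (y i) by apply: (QE (Qy i)).
have decE x : Q s x -> x = \sum_i (mxvec x *m P) 0 i *: y i.
  by move=> /dec/eqP; rewrite subr_eq0 => /eqP.
have pow x : Q s.+1 x -> exists a : 'I_n -> F, x = \sum_i a i *: y i ^+ p.
  elim/ext_span_ind' => [|c z [a ->]|z z' [a ->] [a' ->]|_ [x0 Ex0 ->]].
  - by exists (fun=> 0); rewrite big1 // => i _; rewrite scale0r.
  - exists (fun i => c * a i); rewrite scaler_sumr; apply: eq_bigr => i _.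
    by rewrite scalerA.
  - exists (fun i => a i + a' i); rewrite -big_split; apply: eq_bigr => i _.
    by rewrite scalerDl.
  exists (fun i => (mxvec (x0 ^+ (p ^ s)) *m P) 0 i ^+ p).
  rewrite map_mx_id // expnSr exprM {1}(decE _ (Qbase s x0 Ex0)).
  have := @exprp_lin F idfun hp n (fun i => (mxvec (x0 ^+ (p ^ s)) *m P) 0 i) y 1 Ey.
  rewrite expn1; under eq_bigr => i _ do rewrite map_mx_id //.
  by move=> ->; apply: eq_bigr => i _; rewrite map_mx_id.
have [A hA] := choice (fun i => pow _ (Qstab _ (Qy i))).
pose C i l := (mxvec (y i ^+ p) *m P) 0 l.
have yC i : y i ^+ p = \sum_l C i l *: y l.
  by apply: decE; rewrite -(prednK (prime_gt0 p_pr)); apply: nualgX.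
exists n, y, (\matrix_(i, l) C i l), (\matrix_(i, l) A i l); split=> //.
- by move=> i; rewrite yC; apply: eq_bigr => l _; rewrite mxE.
- apply/matrixP => i k; rewrite !mxE; apply/eqP; rewrite -subr_eq0; apply/eqP.
  apply: (@coord_free F q n y P (fun k =>
    \sum_l (\matrix_(i, l) A i l) i l * (\matrix_(i, l) C i l) l k - (i == k)%:R) delta).
  under eq_bigr => l _ do rewrite scalerBl scaler_suml.
  have S : \sum_l (i == l)%:R *: y l = y i.
    rewrite (bigD1 i) //= eqxx scale1r big1 ?addr0 // => l ne.
    by rewrite eq_sym (negPf ne) scale0r.
  rewrite sumrB exchange_big /= S.
  apply/eqP; rewrite subr_eq0 [X in _ == X]hA; apply/eqP; apply: eq_bigr => l _.
  by rewrite yC scaler_sumr; apply: eq_bigr => l' _; rewrite !mxE scalerA.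
move=> e se ee.
have eX m : e ^+ m.+1 = e.
  by elim: m => [|m IH]; rewrite ?expr1 // exprS IH.
have pX t : e ^+ (p ^ t) = e.
  have -> : (p ^ t = (p ^ t).-1.+1)%N by rewrite prednK // expn_gt0 prime_gt0.
  exact: eX.
(* An idempotent equals its [p^s]-th power, hence lies in the stable span. *)
have sQ : ext_span iota (Q s) e.
  have [m [eps [P' [Eeps _ dec']]]] := basis_comm_reduced nE.
  rewrite -(pX s) (coord_ext dec' se) (exprp_lin iota hpK) //.
  apply: ext_span_sum => i _; apply: ext_spanZ; apply: ext_span_map; exact: Qbase.
have eE := coord_ext dec sQ.
set b := (fun i => (mxvec e *m map_mx iota P) 0 i) in eE.
exists b; split=> // l.
have e2 : e = \sum_l (\sum_i b i ^+ p * iota (C i l)) *: map_mx iota (y l).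
  rewrite -{1}(pX 1%N) {1}eE (exprp_lin iota hpK) //.
  under [RHS]eq_bigr => l' _ do rewrite scaler_suml.
  rewrite exchange_big; apply: eq_bigr => i _; rewrite expn1 yC map_mx_sum scaler_sumr.
  by apply: eq_bigr => l' _; rewrite map_mxZ scalerA.
have := coord_sum iota (fun l => \sum_i b i ^+ p * iota (C i l)) delta.
rewrite -e2 => /(congr1 (fun r : 'rV_ _ => r 0 l)); rewrite [RHS]mxE => e3.
by rewrite [LHS]e3; apply: eq_bigr => i _; rewrite mxE.
Qed.

Lemma idem_algebraic_charp e i j : EK e -> e *m e = e -> algebraicOver iota (e i j).
Proof.
move=> se ee; have [n [y [C [A [Ey yC AC h]]]]] := stable_power_basis.
have [b [eE bE]] := h e se ee; rewrite eE; apply: entries_algebraic => l.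
have bA k : b k ^+ p = \sum_l b l * iota (A l k).
  have CA : C *m A = 1%:M by apply: mulmx1C.
  have e1 : \row_l b l = (\row_k b k ^+ p) *m map_mx iota C.
    by apply/rowP => l'; rewrite !mxE bE; apply: eq_bigr => i' _; rewrite !mxE.
  have : (\row_l b l) *m map_mx iota A = \row_k b k ^+ p.
    by rewrite e1 -mulmxA -map_mxM CA map_mx1 mulmx1.
  move/rowP/(_ k); rewrite !mxE => <-; apply: eq_bigr => l' _; by rewrite !mxE.
have bM t : exists M : 'I_n -> F, b l ^+ (p ^ t) = \sum_k b k * iota (M k).
  elim: t => [|t [M IH]].
    exists (fun k => (k == l)%:R); rewrite expn0 expr1 (bigD1 l) //= eqxx rmorph1 mulr1.
    by rewrite big1 ?addr0 // => k /negPf ->; rewrite rmorph0 mulr0.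
  exists (fun k => \sum_l' A k l' * M l' ^+ p).
  rewrite expnSr exprM IH -(pFrobenius_autE hpK) rmorph_sum /=.
  transitivity (\sum_k \sum_l' b l' * iota (A l' k * M k ^+ p)).
    apply: eq_bigr => k _; rewrite pFrobenius_autE exprMn bA mulr_suml.
    by apply: eq_bigr => l' _; rewrite rmorphM rmorphXn mulrA.
  rewrite exchange_big; apply: eq_bigr => k _; rewrite rmorph_sum mulr_sumr.
  by apply: eq_bigr => l' _.
have [M hM] := choice bM.
pose T : 'M[F]_(n.+1, n) := \matrix_(t, k) M t k.
(* Here [n + 1] powers of [b l] lie in the span of [n] elements; a dependency [v] gives an additive
   polynomial with root [b l]. *)
have : ~~ row_free T by rewrite -row_leq_rank -ltnNge ltnS rank_leq_col.
rewrite -kermx_eq0 => /rowV0Pn[v vT v0]; have {}vT : v *m T = 0 by apply/sub_kermxP.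
exists (\sum_t v 0 t *: 'X^(p ^ t)).
  have [t0 vt0] := rV0Pn _ v0; apply: contraNneq vt0 => /(congr1 (fun f : {poly F} => f`_(p ^ t0))).
  rewrite coef0 coef_sum (bigD1 t0) //= coefZ coefXn eqxx mulr1 big1 ?addr0 => [->//|t ne].
  rewrite -val_eqE /= in ne.
  by rewrite coefZ coefXn eqn_exp2l ?prime_gt1 // eq_sym (negPf ne) mulr0.
rewrite rootE rmorph_sum horner_sum /=; apply/eqP.
transitivity (\sum_k b k * iota ((v *m T) 0 k)); last first.
  by rewrite vT big1 // => k _; rewrite mxE rmorph0 mulr0.
transitivity (\sum_t \sum_k b k * iota (v 0 t * T t k)).
  apply: eq_bigr => t _; rewrite linearZ /= map_polyXn hornerZ hornerXn hM mulr_sumr.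
  by apply: eq_bigr => k _; rewrite mxE rmorphM mulrCA.
rewrite exchange_big; apply: eq_bigr => k _.
by rewrite mxE rmorph_sum mulr_sumr.
Qed.

End CharP.

Lemma idem_algebraic e i j : EK e -> e *m e = e -> algebraicOver iota (e i j).
Proof.
have [[p hp]|ch0] := pselect (exists p, p \in [pchar F]).
  exact: idem_algebraic_charp hp _ _ _.
apply: idem_algebraic_char0 => p; apply/negP => hp; apply: ch0; by exists p.
Qed.

End IdemAlgebraic.

(** * Endomorphisms modulo the radical *)

Section BaseChange.
Variables (F : fieldType) (A : falgType F).

Definition bc (k : fieldType) (j : {rmorphism F -> k}) n (X : A -> 'M[F]_n) : A -> 'M[k]_n :=
  fun a => map_mx j (X a).

Lemma hom_bc (k : fieldType) (j : {rmorphism F -> k}) m n (X : A -> 'M[F]_m) (Y : A -> 'M[F]_n) f :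
  hom X Y f -> hom (bc j X) (bc j Y) (map_mx j f).
Proof. by move=> h a; rewrite /bc -!map_mxM h. Qed.

Lemma rep_basis (k : fieldType) (i : {rmorphism F -> k}) n (X : A -> 'M[k]_n) a :
  is_rep i X -> X a = \sum_l i (coord (vbasis {:A}) l a) *: X (vbasis {:A})`_l.
Proof.
move=> [XD XZ _ _]; rewrite {1}(coord_vbasis (memvf a)).
have X0 : X 0 = 0 by have := XZ 0 0; rewrite !scale0r rmorph0 scale0r.
by rewrite (big_morph X XD X0); apply: eq_bigr => l _; rewrite XZ.
Qed.

Lemma hom_basis (k : fieldType) (i : {rmorphism F -> k}) m n (X : A -> 'M[k]_m) (Y : A -> 'M[k]_n) f :
  is_rep i X -> is_rep i Y ->
  (forall l : 'I_(\dim {:A}), X (vbasis {:A})`_l *m f = f *m Y (vbasis {:A})`_l) -> hom X Y f.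
Proof.
move=> rX rY h a; rewrite (rep_basis a rX) (rep_basis a rY) mulmx_suml mulmx_sumr.
by apply: eq_bigr => l _; rewrite -scalemxAl -scalemxAr h.
Qed.

Lemma rep_bc (k : fieldType) (j : {rmorphism F -> k}) n (X : A -> 'M[F]_n) :
  is_rep idfun X -> is_rep j (bc j X).
Proof.
move=> [XD XZ X1 XM]; split=> [a b|c a||a b]; rewrite /bc.
- by rewrite XD map_mxD.
- by rewrite XZ map_mxZ.
- by rewrite X1 map_mx1.
- by rewrite XM map_mxM.
Qed.

(** The intertwining equations have coefficients in [F]. On a complement of the homomorphisms in all
    matrices they have only the trivial solution over [F], hence over [k]. *)
Lemma hom_ext_span (k : fieldType) (j : {rmorphism F -> k}) n (X : A -> 'M[F]_n) x :
  is_rep idfun X -> hom (bc j X) (bc j X) x <-> ext_span j (hom X X) x.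
Proof.
move=> rX; split; last first.
  elim/ext_span_ind' => [|c y|y z|y hy]; [exact: hom0|exact: homZ|exact: homD|exact: hom_bc].
move=> hx; have [||||||t [w [P [_ delta Pz dec]]]] := @basis_mod F n n (fun _ => True) (hom X X) => //.
- exact: hom0.
- exact: homD.
- exact: homZ.
have sx : ext_span j (fun _ => True) x.
  have -> : x = \sum_i \sum_l x i l *: map_mx j (delta_mx i l).
    rewrite {1}[x]matrix_sum_delta; apply: eq_bigr => i _; apply: eq_bigr => l _.
    by rewrite map_delta_mx.
  by do 2!(apply: ext_span_sum => ? _); apply: ext_spanZ; apply: ext_span_map.
have := basis_mod_ext (fun x _ => dec x I) sx.
set y := \sum_i _ => sy.
suff y0 : y = 0 by rewrite y0 subr0 in sy.
have hy : hom (bc j X) (bc j X) y.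
  rewrite -[y]opprK; apply: homN; rewrite -[- y](addKr x); apply: homD; first exact: homN.
  elim/ext_span_ind': sy => [|c z|z z'|z hz]; [exact: hom0|exact: homZ|exact: homD|exact: hom_bc].
rewrite /y big1 // => i _; rewrite [X in X *: _](_ : _ = 0) ?scale0r //.
pose U := ('I_(\dim {:A}) * ('I_n * 'I_n))%type.
pose D (l : 'I_t) (u : U) := (X (vbasis {:A})`_u.1 *m w l - w l *m X (vbasis {:A})`_u.1) u.2.1 u.2.2.
apply: (@lin_descent F k j t U D _ (fun i => (mxvec x *m map_mx j P) 0 i)) => [b hb|u].
  have hw : hom X X (\sum_l b l *: w l).
    apply: (hom_basis rX rX) => l; apply/eqP; rewrite -subr_eq0; apply/eqP/matrixP => i1 i2.
    rewrite [RHS]mxE -[RHS](hb (l, (i1, i2))) mulmx_sumr mulmx_suml -sumrB summxE.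
    by apply: eq_bigr => l' _; rewrite -scalemxAr -scalemxAl -scalerBr mxE.
  move=> l; have := Pz _ hw; rewrite linear_sum mulmx_suml => /rowP/(_ l).
  rewrite summxE mxE (bigD1 l) //= big1 ?addr0 => [|l' ne]; rewrite linearZ /= -scalemxAl delta !mxE /=.
    by rewrite eqxx mulr1.
  by rewrite eq_sym (negPf ne) mulr0.
have := hy (vbasis {:A})`_u.1; rewrite /bc /y mulmx_sumr mulmx_suml => /eqP.
rewrite -subr_eq0 -sumrB => /eqP/matrixP/(_ u.2.1 u.2.2); rewrite [RHS]mxE summxE => e0.
rewrite -[RHS]e0; apply: eq_bigr => l _.
by rewrite -scalemxAr -scalemxAl -scalerBr -!map_mxM -map_mxB [RHS]mxE [X in _ = _ * X]mxE.
Qed.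

End BaseChange.

(** * The quotient by the radical and its regular representation *)

Section Quotient.
Variables (F : fieldType) (d : nat) (G : 'M[F]_d -> Prop).
Hypotheses (nG : nualg G) (G1 : G 1%:M).
Hypothesis Glie : forall x y, G x -> G y -> rad G (lie x y).
Hypothesis Gsqr : forall x, G x -> rad G (x *m x) -> rad G x.
Variables (q : nat) (g : 'I_q -> 'M[F]_d) (P : 'M[F]_(d * d, q)).
Hypothesis Gg : forall i, G (g i).
Hypothesis JP : forall x, rad G x -> mxvec x *m P = 0.
Hypothesis GJ : forall x, G x -> rad G (x - \sum_i (mxvec x *m P) 0 i *: g i).

Section Ext.
Variables (k : fieldType) (j : {rmorphism F -> k}).
Local Notation Gk := (ext_span j G).
Local Notation Jk := (ext_span j (rad G)).

Lemma nualg_ext (S : 'M[F]_d -> Prop) : nualg S -> nualg (ext_span j S).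
Proof.
move=> [S0 SD SZ SM]; split; [exact: ext_span0|exact: ext_spanD|exact: ext_spanZ|].
by move=> x y; apply: ext_spanM.
Qed.

Lemma ext_one : Gk 1%:M.
Proof. by rewrite -(map_mx1 j); apply: ext_span_map. Qed.

Lemma ext_radG x : Jk x -> Gk x.
Proof. by apply: ext_span_mono => y []. Qed.

Lemma ext_radMr x y : Jk x -> Gk y -> Jk (x *m y).
Proof. by apply: ext_spanM => u v; apply: radMr. Qed.

Lemma ext_radMl x y : Jk x -> Gk y -> Jk (y *m x).
Proof. by move=> Jx Gy; apply: ext_spanM Gy Jx => u v Gu Jv; apply: radMl. Qed.

Lemma ext_lie x y : Gk x -> Gk y -> Jk (lie x y).
Proof.
move=> sx sy; elim/ext_span_ind': sx => [|c t|t t'|x0 Ex].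
- by rewrite /lie mul0mx mulmx0 subrr; apply: ext_span0.
- by rewrite lieZl; apply: ext_spanZ.
- by rewrite lieDl; apply: ext_spanD.
elim/ext_span_ind': sy => [|c t|t t'|y0 Ey].
- by rewrite /lie mul0mx mulmx0 subrr; apply: ext_span0.
- by rewrite lieZr; apply: ext_spanZ.
- by rewrite lieDr; apply: ext_spanD.
by rewrite /lie -!map_mxM -map_mxB; apply: ext_span_map; apply: Glie.
Qed.

(* coordinates modulo the radical *)
Definition coordJ (x : 'M[k]_d) : 'rV[k]_q := mxvec x *m map_mx j P.

Lemma coordJ0 x : Jk x -> coordJ x = 0.
Proof.
rewrite /coordJ; elim/ext_span_ind' => [|c y h|y z h h'|y ry].
- by rewrite linear0 mul0mx.
- by rewrite linearZ /= -scalemxAl h scaler0.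
- by rewrite linearD /= mulmxDl h h' addr0.
- by rewrite -map_mxvec -map_mxM JP // map_mx0.
Qed.

Lemma coordJD x y : coordJ (x + y) = coordJ x + coordJ y.
Proof. by rewrite /coordJ linearD /= mulmxDl. Qed.

Lemma coordJZ c x : coordJ (c *: x) = c *: coordJ x.
Proof. by rewrite /coordJ linearZ /= -scalemxAl. Qed.

Lemma coordJ_sum (I : Type) (r : seq I) (Q : pred I) f :
  coordJ (\sum_(i <- r | Q i) f i) = \sum_(i <- r | Q i) coordJ (f i).
Proof. by rewrite /coordJ linear_sum mulmx_suml. Qed.

Lemma coordJ_dec x : Gk x -> Jk (x - \sum_i coordJ x 0 i *: map_mx j (g i)).
Proof. exact: (basis_mod_ext GJ). Qed.

(* right multiplication by [x] on the quotient by the radical *)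
Definition repJ (x : 'M[k]_d) : 'M[k]_q := \matrix_i coordJ (map_mx j (g i) *m x).

Lemma repJD x y : repJ (x + y) = repJ x + repJ y.
Proof. by apply/row_matrixP => i; rewrite linearD /= !rowK mulmxDr coordJD. Qed.

Lemma repJZ c x : repJ (c *: x) = c *: repJ x.
Proof. by apply/row_matrixP => i; rewrite linearZ /= !rowK -scalemxAr coordJZ. Qed.

Lemma repJN x : repJ (- x) = - repJ x.
Proof. by rewrite -scaleN1r repJZ scaleN1r. Qed.

Lemma repJB x y : repJ (x - y) = repJ x - repJ y.
Proof. by rewrite repJD repJN. Qed.

Lemma coordJM x y : Gk x -> Gk y -> coordJ (x *m y) = coordJ x *m repJ y.
Proof.
move=> Gx Gy; have := coordJ_dec Gx; set s := \sum_i _ => Jx.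
rewrite -{1}(subrK s x) mulmxDl coordJD coordJ0 ?add0r; last exact: ext_radMr.
rewrite /s mulmx_suml coordJ_sum mulmx_sum_row; apply: eq_bigr => i _.
by rewrite -scalemxAl coordJZ rowK.
Qed.

Lemma repJM x y : Gk x -> Gk y -> repJ (x *m y) = repJ x *m repJ y.
Proof.
move=> Gx Gy; apply/row_matrixP => i; rewrite row_mul !rowK mulmxA coordJM //.
have [_ _ _ GM] := nG.
by apply: (ext_spanM GM) => //; apply: ext_span_map.
Qed.

Lemma repJ_eq0 x : Gk x -> repJ x = 0 <-> Jk x.
Proof.
move=> Gx; split=> [r0|Jx].
  have k0 : coordJ x = 0 by rewrite -[x]mul1mx coordJM ?r0 ?mulmx0 //; apply: ext_one.
  have := coordJ_dec Gx; rewrite big1 ?subr0 // => i _; by rewrite k0 mxE scale0r.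
apply/row_matrixP => i; rewrite rowK row0; apply: coordJ0.
by apply: ext_radMl => //; apply: ext_span_map.
Qed.

(* the section of [repJ] given by the basis [g] *)
Definition liftJ (e : 'M[k]_q) : 'M[k]_d := \sum_i (coordJ 1%:M *m e) 0 i *: map_mx j (g i).

Lemma liftJG e : Gk (liftJ e).
Proof. by apply: ext_span_sum => i _; apply: ext_spanZ; apply: ext_span_map. Qed.

(** A multiplication operator is determined by its value at 1, which is all that [liftJ] reads. *)
Lemma liftJK x : Gk x -> repJ (liftJ (repJ x)) = repJ x.
Proof.
move=> Gx; apply/esym/eqP; rewrite -subr_eq0 -repJB; apply/eqP.
have := coordJ_dec Gx; rewrite -[X in coordJ X]mul1mx coordJM //; last exact: ext_one.
by move=> h; apply/repJ_eq0 => //; apply: ext_radG.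
Qed.

End Ext.

Lemma repJ_map (k : fieldType) (j : {rmorphism F -> k}) (L : fieldType) (i : {rmorphism F -> L})
    (l : {rmorphism L -> k}) (x : 'M[L]_d) : (forall c, l (i c) = j c) ->
  repJ j (map_mx l x) = map_mx l (repJ i x).
Proof.
move=> h; have hm m n (y : 'M[F]_(m, n)) : map_mx j y = map_mx l (map_mx i y).
  by apply/matrixP => u v; rewrite !mxE h.
apply/row_matrixP => u; rewrite -map_row !rowK /coordJ !hm -map_mxM -map_mxvec.
by rewrite map_mxM.
Qed.

Lemma liftJ_map (k : fieldType) (j : {rmorphism F -> k}) (L : fieldType) (i : {rmorphism F -> L})
    (l : {rmorphism L -> k}) (e : 'M[L]_q) : (forall c, l (i c) = j c) ->
  liftJ j (map_mx l e) = map_mx l (liftJ i e).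
Proof.
move=> h; have hm m n (y : 'M[F]_(m, n)) : map_mx j y = map_mx l (map_mx i y).
  by apply/matrixP => u v; rewrite !mxE h.
rewrite /liftJ map_mx_sum; apply: eq_bigr => u _; rewrite map_mxZ -hm; congr (_ *: _).
rewrite /coordJ hm -(map_mx1 l) -map_mxvec -!map_mxM mxE //.
Qed.

(** A copy of [G / J] as an algebra of matrices over [F], to which the results on commutative
    reduced algebras apply. *)
Definition imgJ (y : 'M[F]_q) := exists2 x, G x & y = repJ (idfun : {rmorphism F -> F}) x.

Let idG x : G x -> ext_span (idfun : {rmorphism F -> F}) G x.
Proof. by move=> Gx; rewrite -(map_mx_id (f := idfun) _ x) //; apply: ext_span_map. Qed.

Let idJ x : ext_span (idfun : {rmorphism F -> F}) (rad G) x -> rad G x.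
Proof.
have [J0 JD JZ _] := nualg_rad nG.
elim/ext_span_ind' => [|c y|y z|y ry]; [exact: J0|exact: JZ|exact: JD|].
by rewrite map_mx_id.
Qed.

Lemma nualg_imgJ : nualg imgJ.
Proof.
have [S0 SD SZ SM] := nG; split.
- by exists 0; rewrite // -(scale0r (0 : 'M_d)) repJZ scale0r.
- by move=> _ _ [x Gx ->] [y Gy ->]; exists (x + y); [exact: SD|rewrite repJD].
- by move=> c _ [x Gx ->]; exists (c *: x); [exact: SZ|rewrite repJZ].
- move=> _ _ [x Gx ->] [y Gy ->]; exists (x *m y); first exact: SM.
  by rewrite repJM //; apply: idG.
Qed.

Lemma imgJ_comm x y : imgJ x -> imgJ y -> x *m y = y *m x.
Proof.
have [_ _ _ SM] := nG.
move=> [u Gu ->] [v Gv ->]; apply/eqP; rewrite -subr_eq0.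
rewrite -!repJM; try exact: idG; rewrite -repJB; apply/eqP/repJ_eq0.
  by apply: idG; apply: nualgB => //; apply: SM.
have := Glie Gu Gv; rewrite /lie => h.
by rewrite -(map_mx_id (f := idfun) _ (_ - _)) //; apply: ext_span_map.
Qed.

Lemma imgJ_reduced x : imgJ x -> x *m x = 0 -> x = 0.
Proof.
have [_ _ _ SM] := nG.
move=> [u Gu ->]; rewrite -repJM; try exact: idG.
move/repJ_eq0 => h; apply/repJ_eq0; first exact: idG.
rewrite -(map_mx_id (f := idfun) _ u) //; apply: ext_span_map; apply: Gsqr => //.
by apply: idJ; apply: h; apply: idG; apply: SM.
Qed.

Lemma ext_imgJ (k : fieldType) (j : {rmorphism F -> k}) x : ext_span j G x -> ext_span j imgJ (repJ j x).
Proof.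
elim/ext_span_ind' => [|c y|y z|y Gy].
- by rewrite -(scale0r (0 : 'M_d)) repJZ scale0r; apply: ext_span0.
- by rewrite repJZ; apply: ext_spanZ.
- by rewrite repJD; apply: ext_spanD.
rewrite (@repJ_map k j F idfun j) //; apply: ext_span_map.
by exists y.
Qed.

End Quotient.

(** * Decompositions over an extension field *)

(** The rows of [V] span over [F], not over [k], a space of finite dimension [x], of which [B] is a
    basis. *)
Lemma row_span_basis (F k : fieldType) (j : {rmorphism F -> k}) s n (V : 'M[k]_(s, n)) :
  exists x (C : 'M[F]_(s, x)) (B : 'M[k]_(x, n)) (D : 'M[F]_(x, s)),
  [/\ V = map_mx j C *m B, B = map_mx j D *m V &
      forall c : 'rV[F]_x, map_mx j c *m B = 0 -> c = 0].
Proof.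
pose P x := `[< exists (C : 'M[F]_(s, x)) (B : 'M[k]_(x, n)), V = map_mx j C *m B >].
have exP : exists x, P x by exists s; apply/asboolP; exists 1%:M, V; rewrite map_mx1 mul1mx.
case: (ex_minnP exP) => x /asboolP[C [B VE]] min.
have Cfull : row_full C.
  rewrite /row_full eqn_leq rank_leq_col /=; apply: min; apply/asboolP.
  exists (col_base C), (map_mx j (row_base C) *m B).
  by rewrite mulmxA -map_mxM mulmx_base.
have [D DC] := row_fullP Cfull.
exists x, C, B, D; split=> //.
  by rewrite VE mulmxA -map_mxM DC map_mx1 mul1mx.
move=> c cB; apply/eqP; apply: contraT => /rV0Pn[i ci].
(* [Z] fixes [B] and is killed by the nonzero [c], so its rank is below [x], against the minimality
   of [x]. *)
pose Z := 1%:M - ((c 0 i)^-1 *: (delta_mx i 0 : 'cV_x)) *m c.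
have ZB : B = map_mx j Z *m B by rewrite map_mxB map_mx1 map_mxM mulmxBl mul1mx -mulmxA cB mulmx0 subr0.
have cZ : c *m Z = 0.
  rewrite mulmxBr mulmx1 mulmxA -scalemxAr -[c *m delta_mx i 0]colE -scalemxAl.
  rewrite [col i c]mx11_scalar mxE mul_scalar_mx scalerA mulVf // scale1r subrr //.
have : (x <= \rank Z)%N.
  apply: min; apply/asboolP; exists (C *m col_base Z), (map_mx j (row_base Z) *m B).
  by rewrite map_mxM -mulmxA (mulmxA (map_mx j (col_base Z))) -map_mxM mulmx_base -ZB.
rewrite row_leq_rank => Zfree; have c0 : c = 0 by apply: (row_free_inj Zfree); rewrite cZ mul0mx.
by rewrite c0 mxE eqxx in ci.
Qed.

Lemma free_cancel (F k : fieldType) (j : {rmorphism F -> k}) m x n (B : 'M[k]_(x, n)) :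
  (forall c : 'rV[F]_x, map_mx j c *m B = 0 -> c = 0) ->
  forall Y Y' : 'M[F]_(m, x), map_mx j Y *m B = map_mx j Y' *m B -> Y = Y'.
Proof.
move=> free Y Y' e; apply/eqP; rewrite -subr_eq0; apply/eqP/row_matrixP => i.
rewrite row0; apply: free; rewrite map_row -row_mul map_mxB mulmxBl e subrr row0 //.
Qed.

Section Structure.
Variables (F : fieldType) (A : falgType F).
Variables (d : nat) (N : A -> 'M[F]_d).
Hypothesis N_gen : generator N.
Local Notation G := (hom N N).
Let nG : nualg G := nualg_hom N.

Variables (k : fieldType) (j : {rmorphism F -> k}).
Local Notation Gk := (ext_span j G).
Local Notation Jk := (ext_span j (rad G)).
Local Notation Nk := (bc j N).

Variables (n : nat) (M : A -> 'M[k]_n).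
Hypothesis M_rep : is_rep j M.
Local Notation HM := (hom Nk M).

(* Flatness of [HM] over [G]: as an [A]-module [M] is the union of its finite dimensional
   submodules, and these are in [add N]. *)
Lemma hom_flat (T : finType) (jt : T -> 'M[F]_d) (p : T -> 'M[k]_(d, n)) :
  (forall t, HM (p t)) -> \sum_t map_mx j (jt t) *m p t = 0 ->
  exists (U : finType) (ga : T -> U -> 'M[F]_d) (p' : U -> 'M[k]_(d, n)),
  [/\ forall t u, G (ga t u), forall u, HM (p' u),
      forall t, p t = \sum_u map_mx j (ga t u) *m p' u &
      forall u, \sum_t jt t *m ga t u = 0].
Proof.
move=> hp sp.
pose s := #|{: T * 'I_d}|.
pose V : 'M[k]_(s, n) := \matrix_(u < s) row (enum_val u).2 (p (enum_val u).1).
have [x [C [B [D [VE BE free]]]]] := row_span_basis j V.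
pose Q t : 'M[F]_(d, x) := \matrix_i row (enum_rank (t, i)) C.
have pQ t : p t = map_mx j (Q t) *m B.
  apply/row_matrixP => i; rewrite row_mul -map_row rowK map_row -row_mul -VE rowK enum_rankK //.
(* The action on a sum of copies of [N] indexed by [T]. It shows that the rows of all the [p t],
   stacked in [V], span over [F] an [A]-submodule of [M]; [X] below is the action on it. *)
pose N' a : 'M[F]_s := \matrix_(u, v)
  (if (enum_val u).1 == (enum_val v).1 then N a (enum_val u).2 (enum_val v).2 else 0).
have VM a : V *m M a = map_mx j (N' a) *m V.
  apply/row_matrixP => u; have := hp (enum_val u).1 a => /row_matrixP/(_ (enum_val u).2).
  rewrite !row_mul rowK => <-; rewrite -!row_mul; apply/rowP => c; rewrite !mxE.
  rewrite [RHS](reindex _ (onW_bij _ (@enum_rank_bij _))) /=.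
  pose f t i := map_mx j (N' a) u (enum_rank (t, i)) * V (enum_rank (t, i)) c.
  rewrite (eq_bigr (fun v : T * 'I_d => f v.1 v.2)) => [|[t i] _]; last by rewrite /f !mxE.
  rewrite -(pair_bigA _ f) /= (bigD1 (enum_val u).1) //= [X in _ = _ + X]big1 ?addr0 => [|t ne].
    apply: eq_bigr => i _; rewrite /f /bc !mxE !enum_rankK eqxx //.
  by rewrite big1 // => i _; rewrite /f !mxE enum_rankK /= eq_sym (negPf ne) rmorph0 mul0r.
have [X XE] : {X : A -> 'M[F]_x | forall a, map_mx j (X a) *m B = B *m M a}.
  exists (fun a => D *m N' a *m C) => a.
  by rewrite [in RHS]BE -[RHS]mulmxA VM VE !map_mxM !mulmxA.
have cancel := free_cancel free.
have [MD MZ M1 MM] := M_rep.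
have X_rep : is_rep idfun X.
  split=> [a b|c a||a b]; apply: cancel.
  - by rewrite XE MD mulmxDr map_mxD mulmxDl !XE.
  - by rewrite XE MZ -scalemxAr map_mxZ -scalemxAl XE.
  - by rewrite XE M1 mulmx1 map_mx1 mul1mx.
  - by rewrite XE MM mulmxA -XE -mulmxA -XE mulmxA map_mxM.
have Qhom t : hom N X (Q t).
  move=> a; apply: cancel; rewrite !map_mxM -[LHS]mulmxA -[RHS]mulmxA XE [in RHS]mulmxA -!pQ.
  by rewrite -hp.
have [U [al [be [hal hbe e1]]]] := N_gen X_rep.
exists U, (fun t u => Q t *m al u), (fun u => map_mx j (be u) *m B); split.
(* As [X] is a summand of a power of [N], its identity is [sum al be]; inserting it into
   [p t = Q t B] gives coefficients in [G]. The relation holds between the [Q t] already over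
   [F]. *)
- by move=> t u; apply: homM (Qhom t) (hal u).
- by move=> u a; rewrite /bc mulmxA -map_mxM hbe map_mxM -!mulmxA XE.
- move=> t; rewrite {1}pQ -{1}[Q t]mulmx1 -e1 mulmx_sumr map_mx_sum mulmx_suml.
  by apply: eq_bigr => u _; rewrite !map_mxM !mulmxA.
- move=> u; have : \sum_t jt t *m Q t = 0.
    apply: cancel; rewrite map_mx0 mul0mx -[RHS]sp map_mx_sum mulmx_suml.
    by apply: eq_bigr => t _; rewrite map_mxM -mulmxA -pQ.
  move/(congr1 (mulmx^~ (al u))); rewrite /= mul0mx mulmx_suml => h; rewrite -[RHS]h.
  by apply: eq_bigr => t _; rewrite mulmxA.
Qed.

End Structure.

Section Structure.
Variables (F : fieldType) (A : falgType F).
Variables (d : nat) (N : A -> 'M[F]_d).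
Hypotheses (N_rep : is_rep idfun N) (N_gen : generator N).
Local Notation G := (hom N N).
Hypothesis Glie : forall x y, G x -> G y -> rad G (lie x y).
Let nG : nualg G := nualg_hom N.
Let G1 : G 1%:M := @hom1 F A F d N.

Variables (k : fieldType) (j : {rmorphism F -> k}).
Local Notation Gk := (ext_span j G).
Local Notation Jk := (ext_span j (rad G)).
Local Notation Nk := (bc j N).
Variables (q : nat) (g : 'I_q -> 'M[F]_d) (P : 'M[F]_(d * d, q)).
Hypothesis Gg : forall i, G (g i).
Hypothesis JP : forall x, rad G x -> mxvec x *m P = 0.
Hypothesis GJ : forall x, G x -> rad G (x - \sum_i (mxvec x *m P) 0 i *: g i).
Local Notation rk := (repJ g P j).

Hypothesis Rk : forall x, Gk x -> Jk (x *m x) -> Jk x.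

Let nGk : nualg Gk := nualg_ext j nG.

Variables (n : nat) (M : A -> 'M[k]_n).
Hypothesis M_rep : is_rep j M.
Local Notation HM := (hom Nk M).

Let GM x y : Gk x -> Gk y -> Gk (x *m y).
Proof. by have [_ _ _] := nGk; apply. Qed.
Let Gk1 : Gk 1%:M.
Proof. exact: ext_one. Qed.
Let GB x y : Gk x -> Gk y -> Gk (x - y).
Proof. exact: nualgB. Qed.
Let JG x : Jk x -> Gk x.
Proof. exact: ext_radG. Qed.
Let Jlie x y : Gk x -> Gk y -> Jk (lie x y).
Proof. exact: ext_lie. Qed.

Let GkHom x : Gk x -> hom Nk Nk x.
Proof. by move=> Gx; apply/hom_ext_span. Qed.

(* The submodule [J HM], in terms of a basis of the radical. *)
Variables (l : nat) (jb : 'I_l -> 'M[F]_d).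
Hypothesis jb_rad : forall t, rad G (jb t).
Hypothesis jb_gen : forall z, Jk z -> exists a : 'I_l -> k, z = \sum_t a t *: map_mx j (jb t).

Definition JHM (f : 'M[k]_(d, n)) := exists2 p : 'I_l -> 'M[k]_(d, n),
  forall t, HM (p t) & f = \sum_t map_mx j (jb t) *m p t.

Lemma JHM0 : JHM 0.
Proof. by exists (fun=> 0) => [t|]; [exact: hom0|rewrite big1 // => t _; rewrite mulmx0]. Qed.

Lemma JHMD f f' : JHM f -> JHM f' -> JHM (f + f').
Proof.
move=> [p hp ->] [p' hp' ->]; exists (fun t => p t + p' t) => [t|]; first exact: homD.
by rewrite -big_split; apply: eq_bigr => t _; rewrite mulmxDr.
Qed.

Lemma JHM_sum (I : Type) (r : seq I) (Q : pred I) f :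
  (forall i, Q i -> JHM (f i)) -> JHM (\sum_(i <- r | Q i) f i).
Proof. by move=> h; apply: (big_ind JHM) => //; [exact: JHM0|exact: JHMD]. Qed.

Lemma JHM_rad z p : Jk z -> HM p -> JHM (z *m p).
Proof.
move=> /jb_gen[a ->] hp; exists (fun t => a t *: p) => [t|]; first exact: homZ.
by rewrite mulmx_suml; apply: eq_bigr => t _; rewrite -scalemxAl scalemxAr.
Qed.

Lemma JHM_mul x f : Gk x -> JHM f -> JHM (x *m f).
Proof.
move=> Gx [p hp ->]; rewrite mulmx_sumr; apply: JHM_sum => t _.
rewrite mulmxA; apply: JHM_rad => //; apply: ext_radMl => //.
exact: ext_span_map.
Qed.

Lemma JHMN f : JHM f -> JHM (- f).
Proof.
move=> h; rewrite -[f]mul1mx -mulNmx; apply: JHM_mul => //.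
exact: (nualgN nGk).
Qed.

Lemma JHMB f f' : JHM f -> JHM f' -> JHM (f - f').
Proof. by move=> h h'; apply: JHMD => //; apply: JHMN. Qed.

(** Families are indexed by [nat] and cut off at [C], so that they can be extended without a change
    of type. *)
Definition spanJ (C : nat) (f : nat -> 'M[k]_(d, n)) p :=
  exists2 x : nat -> 'M[k]_d, forall c, Gk (x c) & JHM (p - \sum_(c < C) x c *m f c).

Section Span.
Variables (C : nat) (f : nat -> 'M[k]_(d, n)).
Local Notation SP := (spanJ C f).

Lemma spanJ_J p : JHM p -> SP p.
Proof.
move=> h; exists (fun=> 0); first by move=> c; apply: ext_span0.
by rewrite big1 ?subr0 // => c _; rewrite mul0mx.
Qed.

Lemma spanJD p p' : SP p -> SP p' -> SP (p + p').
Proof.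
move=> [x Gx h] [x' Gx' h']; exists (fun c => x c + x' c).
  by move=> c; apply: ext_spanD.
have := JHMD h h'; congr JHM; rewrite addrACA -opprD -big_split; congr (_ - _).
by apply: eq_bigr => c _; rewrite mulmxDl.
Qed.

Lemma spanJM y p : Gk y -> SP p -> SP (y *m p).
Proof.
move=> Gy [x Gx h]; exists (fun c => y *m x c).
  by move=> c; apply: GM.
have := JHM_mul Gy h; congr JHM; rewrite mulmxBr mulmx_sumr; congr (_ - _).
by apply: eq_bigr => c _; rewrite mulmxA.
Qed.

Lemma spanJB p p' : SP p -> SP p' -> SP (p - p').
Proof.
move=> h h'; apply: spanJD => //; rewrite -[p']mul1mx -mulNmx; apply: spanJM => //.
exact: (nualgN nGk).
Qed.

End Span.

Lemma spanJS C f f' p : (forall c, (c < C)%N -> f c = f' c) -> spanJ C f p -> spanJ C.+1 f' p.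
Proof.
move=> ff' [x Gx h]; exists (fun c => if (c < C)%N then x c else 0).
  by move=> c; case: ifP => _ //; apply: ext_span0.
have := h; congr JHM; congr (_ - _); rewrite big_ord_recr /= ltnn mul0mx addr0.
by apply: eq_bigr => c _; rewrite ltn_ord ff'.
Qed.

(** Modulo the radical the algebra is commutative and reduced, so the ideal is generated there by an
    idempotent, and [h] is the complement. An idempotent [e] of maximal rank in [I] will do: a
    non-nilpotent element of [I] orthogonal to [e] would yield another idempotent to be added to
    it. *)
Lemma ideal_idem (I : 'M[k]_d -> Prop) :
  (forall x, I x -> Gk x) -> (forall x, Jk x -> I x) ->
  (forall x y, I x -> I y -> I (x + y)) -> (forall x y, Gk y -> I x -> I (y *m x)) ->
  exists h, [/\ Gk h, h *m h = h & forall x, Gk x -> I x <-> Jk (x *m h)].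
Proof.
move=> IG JI ID IM.
have [_ GD GZ _] := nGk.
have IMr x y : I x -> Gk y -> I (x *m y).
  move=> Ix Gy; rewrite -(subrK (y *m x) (x *m y)); apply: ID; last exact: IM.
  by apply: JI; apply: ext_lie => //; apply: IG.
have IZ c x : I x -> I (c *: x).
  by move=> Ix; rewrite -[x]mul1mx scalemxAl; apply: IM => //; apply: GZ.
have IN x : I x -> I (- x) by move=> Ix; rewrite -scaleN1r; apply: IZ.
have I0 : I 0 by apply: JI; apply: ext_span0.
pose R r := `[< exists e, [/\ I e, e *m e = e & \rank e = r] >].
have exR : exists r, R r by exists 0%N; apply/asboolP; exists 0; rewrite mulmx0 mxrank0.
have ubR r : R r -> (r <= d)%N by case/asboolP=> e [_ _ <-]; exact: rank_leq_row.
case: (ex_maxnP exR ubR) => r /asboolP[e [Ie ee re]] max.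
have Ge := IG _ Ie; have Gh : Gk (1%:M - e) by apply: nualgB.
have hh : (1%:M - e) *m (1%:M - e) = 1%:M - e.
  by rewrite mulmxBr mulmx1 mulmxBl mul1mx ee subrr subr0.
have eh : e *m (1%:M - e) = 0 by rewrite mulmxBr mulmx1 ee subrr.
have he : (1%:M - e) *m e = 0 by rewrite mulmxBl mul1mx ee subrr.
have nilJ z : Gk z -> nilmx z -> Jk z.
  move=> Gz [s zs0].
  have : Jk (z ^+ (2 ^ s)).
    have -> : z ^+ (2 ^ s) = 0.
      by rewrite -(subnK (ltnW (ltn_expl s (isT : (1 < 2)%N)))) exprD zs0 mulr0.
    exact: ext_span0.
  elim: s {zs0} => [|s IH]; first by rewrite expr1.
  by rewrite expnS mulnC exprM expr2 => h; apply: IH; apply: Rk h; apply: ext_spanX.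
exists (1%:M - e); split=> // x Gx; split=> [Ix|Jx]; last first.
  rewrite -[x]mulmx1 -(subrK e 1%:M) mulmxDr; apply: ID; first exact: JI.
  exact: IM.
have Iy : I ((1%:M - e) *m x *m (1%:M - e)) by apply: IMr => //; apply: IM.
have [y Ey] : {y | y = (1%:M - e) *m x *m (1%:M - e)} by eexists.
rewrite -Ey in Iy.
have Jy : Jk y.
  apply: nilJ; first exact: IG.
  apply: contrapT => ny.
  have ye : y *m e = 0 by rewrite Ey -mulmxA he mulmx0.
  have ey : e *m y = 0 by rewrite Ey !mulmxA eh !mul0mx.
  have nS : nualg (fun z => [/\ I z, z *m e = 0 & e *m z = 0]).
    split=> [|u v [Iu u1 u2] [Iv v1 v2]|c u [Iu u1 u2]|u v [Iu u1 u2] [Iv v1 v2]].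
    - by split; rewrite ?mul0mx ?mulmx0.
    - by split; [exact: ID|rewrite mulmxDl u1 v1 addr0|rewrite mulmxDr u2 v2 addr0].
    - by split; [exact: IZ|rewrite -scalemxAl u1 scaler0|rewrite -scalemxAr u2 scaler0].
    - by split; [apply: IM => //; apply: IG|rewrite -mulmxA v1 mulmx0|rewrite mulmxA u2 mul0mx].
  have [w [[Iw we ew] _ ee1 e10]] := idem_notnil nS (And3 Iy ye ey) ny.
  have [e1 E1] : {e1 | e1 = y *m w} by eexists.
  rewrite -E1 in ee1 e10.
  have Ie1 : I e1 by rewrite E1; apply: IM => //; apply: IG.
  have e1e : e1 *m e = 0 by rewrite E1 -mulmxA we mulmx0.
  have ee1' : e *m e1 = 0 by rewrite E1 mulmxA ey mul0mx.
  have le : (e <= (e + e1)%R)%MS.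
    have E : e *m (e + e1) = e by rewrite mulmxDr ee ee1' addr0.
    by rewrite -{1}E submxMl.
  have : R (\rank (e + e1)%R).
    apply/asboolP; exists (e + e1); split=> //; first exact: ID.
    by rewrite mulmxDl !mulmxDr ee ee1 e1e ee1' addr0 add0r.
  move/max; rewrite -re => rle.
  have : ((e + e1)%R <= e)%MS.
    by rewrite -(geq_leqif (mxrank_leqif_sup le)) .
  case/submxP=> D DE; apply: e10.
  have : e1 *m (e + e1) = e1 by rewrite mulmxDr e1e ee1 add0r.
  move=> <-; rewrite DE.
  have : e1 *m D *m e *m e = 0.
    by rewrite -!mulmxA (mulmxA D) -DE mulmxDl ee e1e addr0 e1e.
  by rewrite -!mulmxA ee.
have -> : x *m (1%:M - e) = lie x (1%:M - e) *m (1%:M - e) + y.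
  by rewrite /lie mulmxBl -(mulmxA x) hh -Ey subrK.
by apply: ext_spanD => //; apply: ext_radMr => //; apply: ext_lie.
Qed.

Let ideal C f p := fun x => Gk x /\ spanJ C f (x *m p).

Let ideal_gen C f p : HM p -> exists h, [/\ Gk h, h *m h = h &
  forall x, Gk x -> spanJ C f (x *m p) <-> Jk (x *m h)].
Proof.
move=> hp; have [||||h [Gh hh hI]] := @ideal_idem (ideal C f p).
- by move=> x [].
- by move=> x Jx; split; [exact: JG|apply: spanJ_J; apply: JHM_rad].
- by move=> x y [Gx sx] [Gy sy]; split; [exact: ext_spanD|rewrite mulmxDl; exact: spanJD].
- by move=> x y Gx [Gy sy]; split; [exact: GM|rewrite -mulmxA; exact: spanJM].
exists h; split=> // x Gx; have [h1 h2] := hI x Gx.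
by split=> [s|Jx]; [apply: h1; split|case: (h2 Jx)].
Qed.

(* The [f c] form a minimal generating family of a submodule of [HM] modulo [J HM], with
   annihilators generated by the [1 - h c]; each [h c] has maximal rank among the possible
   choices, whence [fam_max] and the nesting. *)
Record family C (f : nat -> 'M[k]_(d, n)) (h : nat -> 'M[k]_d) : Prop := Family {
  fam_f : forall c, (c < C)%N -> HM (f c);
  fam_h : forall c, (c < C)%N -> Gk (h c);
  fam_idem : forall c, (c < C)%N -> h c *m h c = h c;
  fam_hf : forall c, (c < C)%N -> h c *m f c = f c;
  fam_neq : forall c, (c < C)%N -> ~ Jk (h c);
  fam_ind : forall x : nat -> 'M[k]_d, (forall c, Gk (x c)) ->
    JHM (\sum_(c < C) x c *m f c) -> forall c, (c < C)%N -> Jk (x c *m h c);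
  fam_max : forall p c, HM p -> (c < C)%N -> spanJ C f (p - h c *m p);
  fam_nested : forall c c', (c < c' < C)%N -> Jk (h c' - h c *m h c')
}.

(** The [f c] are linearly independent over [k]: in a relation with scalar coefficients, [fam_ind]
    would make some [h c] radical. *)
Lemma family_bound C f h : family C f h -> (C <= d * n)%N.
Proof.
move=> fam; pose V : 'M[k]_(C, d * n) := \matrix_(c < C) mxvec (f c).
suff : row_free V by rewrite /row_free => /eqP <-; exact: rank_leq_col.
rewrite -kermx_eq0; apply/eqP/row_matrixP => i; rewrite row0.
move: (row i _) (sub_kermxP (row_sub i (kermx V))) => {i} v vV.
have s0 : \sum_(c < C) v 0 c *: f c = 0.
  apply: (can_inj mxvecK); rewrite linear0 linear_sum -[RHS]vV mulmx_sum_row.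
  by apply: eq_bigr => c _; rewrite linearZ /= rowK.
pose x c : 'M[k]_d := (if insub c is Some c' then v 0 (c' : 'I_C) else 0)%:M.
apply/rowP => c; rewrite [RHS]mxE; apply/eqP; apply: contraT => nz.
have xE (c' : 'I_C) : x c' = (v 0 c')%:M by rewrite /x valK.
have : Jk (x c *m h c).
  apply: (fam_ind fam) => // [c'|]; first by rewrite /x -scalemx1; apply: ext_spanZ.
  rewrite (eq_bigr (fun c => v 0 c *: f c)) ?s0; first exact: JHM0.
  by move=> c' _; rewrite xE mul_scalar_mx.
rewrite xE mul_scalar_mx => /(ext_spanZ (v 0 c)^-1); rewrite scalerA mulVf // scale1r.
by case/(fam_neq fam (ltn_ord c)).
Qed.

Let rJ x : Gk x -> rk x = 0 -> Jk x.
Proof. by move=> Gx; apply: (repJ_eq0 nG G1 Gg JP GJ Gx).1. Qed.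
Let rJ0 x : Gk x -> Jk x -> rk x = 0.
Proof. by move=> Gx; apply: (repJ_eq0 nG G1 Gg JP GJ Gx).2. Qed.
Let rM x y : Gk x -> Gk y -> rk (x *m y) = rk x *m rk y.
Proof. exact: repJM. Qed.

(** The new generator [f0] lies outside the span, and the idempotent [h0] complementary to its
    annihilator modulo the span has the largest possible rank. This maximality puts all [(1 - h0) p]
    in the span already found. *)
Lemma family_extend C f h p : family C f h -> HM p -> ~ spanJ C f p ->
  exists f' h', family C.+1 f' h'.
Proof.
move=> fam hp np.
pose R r := `[< exists p h, [/\ HM p, ~ spanJ C f p, Gk h, h *m h = h &
  (forall x, Gk x -> spanJ C f (x *m p) <-> Jk (x *m h)) /\ \rank (rk h) = r] >].
have exR : exists r, R r.
  have [h0 [G0 hh0 I0]] := ideal_gen C f hp; exists (\rank (rk h0)); apply/asboolP.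
  by exists p, h0.
have ubR r : R r -> (r <= q)%N by case/asboolP=> p' [h' [_ _ _ _ [_ <-]]]; exact: rank_leq_row.
case: (ex_maxnP exR ubR) => r /asboolP[f0 [h0 [Hf0 nf0 Gh0 hh0 [I0 rh0]]]] max {exR ubR p hp np}.
have nh0 : ~ Jk h0.
  by move=> Jh; apply: nf0; rewrite -[f0]mul1mx; apply: (I0 _ Gk1).2; rewrite mul1mx.
have maxp p : HM p -> spanJ C f (p - h0 *m p).
  move=> hp; apply: contrapT => np.
  (* [f1] agrees with [f0] on [h0] and with [p] on [1 - h0]; its idempotent [h1] would contain [h0]
     strictly modulo the radical, against the choice of [h0]. *)
  have [f1 E1] : {f1 | f1 = h0 *m f0 + (p - h0 *m p)} by eexists.
  have Hf1 : HM f1.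
    rewrite E1; apply: homD; first exact: homM (GkHom Gh0) Hf0.
    by apply: homB => //; apply: homM (GkHom Gh0) hp.
  have [h1 [Gh1 hh1 I1]] := ideal_gen C f Hf1.
  have G1h : Gk (1%:M - h0) by apply: GB.
  have comm x y v : Gk x -> Gk y -> HM v -> JHM (x *m y *m v - y *m x *m v).
    by move=> Gx Gy hv; rewrite -mulmxBl; apply: JHM_rad => //; apply: Jlie.
  have part x : Gk x -> spanJ C f (x *m f1) ->
      spanJ C f (x *m h0 *m f0) /\ spanJ C f (x *m (p - h0 *m p)).
    move=> Gx sx.
    have s1 : spanJ C f (x *m h0 *m f0).
      have := spanJM Gh0 sx.
      have c1 := spanJ_J C f (comm _ _ _ Gx Gh0 Hf1).
      move=> s; have := spanJD c1 s; rewrite [X in _ + X]mulmxA subrK E1.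
      by rewrite mulmxDr mulmxBr !mulmxA -!(mulmxA x h0 h0) hh0 subrr addr0.
    split=> //; have := spanJB sx s1.
    by rewrite E1 mulmxDr mulmxA addrC addrA addNr add0r.
  have nf1 : ~ spanJ C f f1.
    by rewrite -[f1]mul1mx => /(part _ Gk1)[_]; rewrite mul1mx.
  have J1 : Jk ((1%:M - h1) *m h0).
    have Gx1 : Gk (1%:M - h1) := GB Gk1 Gh1.
    have [|s0 _] := part _ Gx1.
      by apply: (I1 _ Gx1).2; rewrite mulmxBl mul1mx hh1 subrr; apply: ext_span0.
    by have := (I0 _ (GM Gx1 Gh0)).1 s0; rewrite -mulmxA hh0.
  have n1 : ~ Jk ((1%:M - h0) *m h1).
    move=> /(I1 _ G1h).2/(part _ G1h)[_]; rewrite mulmxBl mul1mx mulmxBr mulmxA hh0 subrr subr0.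
    exact: np.
  apply: n1; apply: rJ; first exact: GM.
  have e1 : rk h0 = rk h1 *m rk h0.
    have := rJ0 (GM (GB Gk1 Gh1) Gh0) J1.
    by rewrite mulmxBl mul1mx repJB rM // => /eqP; rewrite subr_eq0 => /eqP.
  have e2 : rk h0 *m rk h1 = rk h1 *m rk h0.
    have := rJ0 (JG (Jlie Gh0 Gh1)) (Jlie Gh0 Gh1).
    by rewrite /lie repJB !rM // => /eqP; rewrite subr_eq0 => /eqP.
  have le : (rk h0 <= rk h1)%MS by rewrite e1 -e2 submxMl.
  have rk1 : (\rank (rk h1) <= \rank (rk h0))%N.
    by rewrite rh0; apply: max; apply/asboolP; exists f1, h1.
  have /submxP[D DE] : (rk h1 <= rk h0)%MS by rewrite -(geq_leqif (mxrank_leqif_sup le)).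
  have ee0 : rk h0 *m rk h0 = rk h0 by rewrite -rM // hh0.
  have e3 : rk h1 = rk h0 by rewrite {1}DE -{1}ee0 mulmxA -DE -e1.
  by rewrite mulmxBl mul1mx repJB rM // e3 ee0 subrr.

pose f' c := if (c < C)%N then f c else h0 *m f0.
pose h' c := if (c < C)%N then h c else h0.
have f'E c : (c < C)%N -> f' c = f c by rewrite /f' => ->.
have h'E c : (c < C)%N -> h' c = h c by rewrite /h' => ->.
have f'C : f' C = h0 *m f0 by rewrite /f' ltnn.
have h'C : h' C = h0 by rewrite /h' ltnn.
have Hhf0 : HM (h0 *m f0) by apply: homM (GkHom Gh0) Hf0.
exists f', h'; split.
- by move=> c; rewrite ltnS leq_eqVlt => /predU1P[->|lc]; rewrite ?f'C ?f'E //; apply: fam_f fam _ lc.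
- by move=> c; rewrite ltnS leq_eqVlt => /predU1P[->|lc]; rewrite ?h'C ?h'E //; apply: fam_h fam _ lc.
- by move=> c; rewrite ltnS leq_eqVlt => /predU1P[->|lc]; rewrite ?h'C ?h'E //; apply: fam_idem fam _ lc.
- move=> c; rewrite ltnS leq_eqVlt => /predU1P[->|lc]; first by rewrite f'C h'C mulmxA hh0.
  by rewrite f'E // h'E //; apply: fam_hf fam _ lc.
- by move=> c; rewrite ltnS leq_eqVlt => /predU1P[->|lc]; rewrite ?h'C ?h'E //; apply: fam_neq fam _ lc.
- move=> x Gx; rewrite big_ord_recr /= f'C => sx.
  rewrite (eq_bigr (fun c : 'I_C => x c *m f c)) in sx; last by move=> c _; rewrite f'E.
  have Jx : Jk (x C *m h0).
    rewrite -{1}hh0 mulmxA; apply: (I0 _ (GM (Gx C) Gh0)).1.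
    exists (fun c => - x c); first by move=> c; apply: (nualgN nGk).
    have := sx; rewrite addrC mulmxA; congr (JHM (_ + _)).
    by rewrite -sumrN; apply: eq_bigr => c _; rewrite mulNmx opprK.
  move=> c; rewrite ltnS leq_eqVlt => /predU1P[->|lc]; first by rewrite h'C.
  rewrite h'E //; apply: (fam_ind fam Gx) lc.
  have Js : JHM (x C *m (h0 *m f0)) by rewrite mulmxA; apply: JHM_rad.
  by have := JHMB sx Js; rewrite addrK.
- move=> p c hp; rewrite ltnS leq_eqVlt => /predU1P[->|lc].
    by rewrite h'C; apply: (@spanJS C f) (maxp p hp) => c' lc'; rewrite f'E.
  by rewrite h'E //; apply: (@spanJS C f) (fam_max fam hp lc) => c' lc'; rewrite f'E.
(* Origin of the nesting: for an earlier [c], [(1 - h c) h0 f0] lies in the span by [fam_max], so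
   [(1 - h c) h0] is radical. *)
- move=> c c' /andP[lcc']; rewrite ltnS leq_eqVlt => /predU1P[c'C|lc'].
    rewrite {}c'C in lcc' *; rewrite h'C h'E //.
    rewrite -{1}[h0]mul1mx -mulmxBl -hh0 mulmxA; apply: (I0 _ _).1.
      by apply: GM => //; apply: GB => //; apply: fam_h fam _ lcc'.
    rewrite -mulmxA mulmxBl mul1mx; apply: (fam_max fam) => //.
  rewrite !h'E ?(ltn_trans lcc') //; apply: (fam_nested fam); by rewrite lcc'.
Qed.

Lemma family_full : exists C f h, family C f h /\ forall p, HM p -> spanJ C f p.
Proof.
pose R C := `[< exists f h, family C f h >].
have exR : exists C, R C.
  by exists 0%N; apply/asboolP; exists (fun=> 0), (fun=> 0); split=> // c c'; rewrite andbF.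
have ubR C : R C -> (C <= d * n)%N by move=> /asboolP[f [h]]; apply: family_bound.
case: (ex_maxnP exR ubR) => C /asboolP[f [h fam]] max; exists C, f, h; split=> // p hp.
apply: contrapT => np; have [f' [h' fam']] := family_extend fam hp np.
have /max : R C.+1 by apply/asboolP; exists f', h'.
by rewrite ltnn.
Qed.

Variables (s : nat) (W : nat -> 'M[F]_d).
Hypotheses (W0 : W 0%N = 1%:M) (Ws : W s = 0).
Hypothesis Wflag : forall i x, rad G x -> (W i *m x <= W i.+1)%MS.

(* [J^i HM] *)
Fixpoint Jpow i (p : 'M[k]_(d, n)) := if i is i'.+1 then
  exists2 r : 'I_l -> 'M[k]_(d, n), forall t, Jpow i' (r t) & p = \sum_t map_mx j (jb t) *m r t
  else HM p.

Lemma Jpow_eq0 p : Jpow s p -> p = 0.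
Proof.
suff gen i i' p' : (i + i')%N = s -> Jpow i p' -> map_mx j (W i') *m p' = 0.
  by move/(gen _ 0%N _ (addn0 s)); rewrite W0 map_mx1 mul1mx.
elim: i i' p' => [|i IH] i' p' e; first by move=> _; rewrite (_ : i' = s) ?Ws ?map_mx0 ?mul0mx.
move=> [r hr ->]; rewrite mulmx_sumr big1 // => t _.
have /submxP[D DE] := Wflag i' (jb_rad t).
have e' : (i + i'.+1)%N = s by rewrite -addSnnS.
by rewrite mulmxA -map_mxM DE map_mxM -mulmxA (IH _ _ e' (hr t)) mulmx0.
Qed.

Section Full.
Variables (C : nat) (f : nat -> 'M[k]_(d, n)) (h : nat -> 'M[k]_d).
Hypotheses (fam : family C f h) (full : forall p, HM p -> spanJ C f p).

Lemma Jpow_reduce i p : Jpow i p ->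
  exists2 x : nat -> 'M[k]_d, forall c, Gk (x c) & Jpow i.+1 (p - \sum_(c < C) x c *m f c).
Proof.
elim: i p => [|i IH] p; first exact: full.
move=> [r hr ->].
have /choice[x hx] t : exists x : nat -> 'M[k]_d, (forall c, Gk (x c)) /\
    Jpow i.+1 (r t - \sum_(c < C) x c *m f c) by have [x] := IH _ (hr t); exists x.
exists (fun c => \sum_t map_mx j (jb t) *m x t c) => [c|].
  apply: (nualg_sum _ nGk) => t _; apply: GM; last exact: (hx t).1.
  by apply: ext_span_map; case: (jb_rad t).
exists (fun t => r t - \sum_(c < C) x t c *m f c) => [t|]; first exact: (hx t).2.
rewrite (eq_bigr (fun c : 'I_C => \sum_t map_mx j (jb t) *m x t c *m f c)); last first.
  by move=> c _; rewrite mulmx_suml.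
rewrite exchange_big -sumrB; apply: eq_bigr => t _; rewrite mulmxBr mulmx_sumr.
by congr (_ - _); apply: eq_bigr => c _; rewrite mulmxA.
Qed.

(** Nakayama: generation modulo [J HM] is corrected by one power of the radical at a time, until a
    power vanishes. *)
Lemma family_span p : HM p ->
  exists2 x : nat -> 'M[k]_d, forall c, Gk (x c) & p = \sum_(c < C) x c *m f c.
Proof.
move=> hp; suff [x Gx] : exists2 x : nat -> 'M[k]_d, forall c, Gk (x c) &
    Jpow s (p - \sum_(c < C) x c *m f c).
  by move/Jpow_eq0/eqP; rewrite subr_eq0 => /eqP ->; exists x.
elim: (s) => [|i [x Gx h1]].
  by exists (fun=> 0) => // [c|]; [exact: ext_span0|rewrite big1 ?subr0 // => c _; rewrite mul0mx].
have [x' Gx' h2] := Jpow_reduce h1; exists (fun c => x c + x' c) => [c|]; first exact: ext_spanD.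
move: h2; congr (Jpow _ _); rewrite -addrA -opprD -big_split; congr (_ - _).
by apply: eq_bigr => c _; rewrite mulmxDl.
Qed.

(** The classical argument that a finitely generated flat module over an Artinian ring is
    projective. The [y c h c] are radical, flatness resolves the relation they define, and comparing
    this resolution with the family gives relations to which induction applies one step deeper in
    the flag. *)
Lemma family_free (y : nat -> 'M[k]_d) : (forall c, Gk (y c)) -> \sum_(c < C) y c *m f c = 0 ->
  forall c, (c < C)%N -> y c *m h c = 0.
Proof.
suff gen i i' (y' : nat -> 'M[k]_d) : (i + i')%N = s -> (forall c, Gk (y' c)) ->
    \sum_(c < C) y' c *m f c = 0 -> forall c, (c < C)%N -> map_mx j (W i') *m (y' c *m h c) = 0.
  by move=> Gy sy c lc; have := gen _ 0%N _ (addn0 s) Gy sy c lc; rewrite W0 map_mx1 mul1mx.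
elim: i i' y' => {y} [|i IH] i' y e Gy sy.
  by move=> c _; rewrite (_ : i' = s) ?Ws ?map_mx0 ?mul0mx.
have Jy c : (c < C)%N -> Jk (y c *m h c).
  by move=> lc; apply: (fam_ind fam Gy) lc; rewrite sy; apply: JHM0.
have /choice[a aE] c : exists a : 'I_l -> k, (c < C)%N -> y c *m h c = \sum_t a t *: map_mx j (jb t).
  case: (ltnP c C) => lc; last by exists (fun=> 0).
  by have [a] := jb_gen (Jy c lc); exists a.
pose p t := \sum_(c < C) a c t *: f c.
have hp t : HM (p t) by apply: hom_sum => c _; apply: homZ; apply: (fam_f fam).
have sp : \sum_t map_mx j (jb t) *m p t = 0.
  rewrite -[RHS]sy (eq_bigr (fun t => \sum_(c < C) a c t *: map_mx j (jb t) *m f c)); last first.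
    by move=> t _; rewrite mulmx_sumr; apply: eq_bigr => c _; rewrite -scalemxAr scalemxAl.
  rewrite exchange_big; apply: eq_bigr => c _; rewrite -mulmx_suml -aE // -mulmxA.
  by rewrite (fam_hf fam).
have [U [ga [p' [Gga hp' pE ga0]]]] := hom_flat N_gen M_rep hp sp.
have /choice[x hx] u : exists x : nat -> 'M[k]_d, (forall c, Gk (x c)) /\
    p' u = \sum_(c < C) x c *m f c by have [x] := family_span (hp' u); exists x.
(* Both parts of the coefficient expand [p t] over the family, so their difference is a relation. *)
have rel t c : (c < C)%N ->
    map_mx j (W i'.+1) *m (((a c t)%:M - \sum_u map_mx j (ga t u) *m x u c) *m h c) = 0.
  apply: (IH i'.+1 (fun c => (a c t)%:M - \sum_u map_mx j (ga t u) *m x u c)); first by rewrite -addSnnS.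
    move=> c'; apply: GB; first by rewrite -scalemx1; apply: ext_spanZ.
    apply: (nualg_sum _ nGk) => u _; apply: GM; last exact: (hx u).1.
    exact: ext_span_map.
  rewrite (eq_bigr (fun c : 'I_C => a c t *: f c - \sum_u map_mx j (ga t u) *m (x u c *m f c))).
    rewrite sumrB exchange_big /= -/(p t) pE -sumrB big1 // => u _.
    by rewrite -mulmx_sumr (hx u).2 subrr.
  move=> c' _; rewrite mulmxBl mul_scalar_mx mulmx_suml; congr (_ - _).
  by apply: eq_bigr => u _; rewrite mulmxA.
move=> c lc; have -> : y c *m h c = \sum_t map_mx j (jb t) *m ((a c t)%:M *m h c).
  rewrite -{1}(fam_idem fam lc) mulmxA aE // mulmx_suml; apply: eq_bigr => t _.
  by rewrite mul_scalar_mx -scalemxAl scalemxAr.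
have step t : map_mx j (W i') *m (map_mx j (jb t) *m ((a c t)%:M *m h c)) =
    \sum_u map_mx j (W i' *m (jb t *m ga t u)) *m (x u c *m h c).
  have /submxP[D DE] := Wflag i' (jb_rad t).
  rewrite mulmxA -map_mxM DE map_mxM -mulmxA.
  have := rel t c lc; rewrite mulmxBl mulmxBr => /eqP; rewrite subr_eq0 => /eqP ->.
  rewrite [LHS]mulmxA -map_mxM -DE mulmx_suml mulmx_sumr; apply: eq_bigr => u _.
  by rewrite !map_mxM !mulmxA.
rewrite mulmx_sumr (eq_bigr _ (fun t _ => step t)) exchange_big big1 // => u _.
by rewrite -mulmx_suml -map_mx_sum -mulmx_sumr ga0 mulmx0 map_mx0 mul0mx.
Qed.

End Full.

End Structure.

(** * The regular module *)

Section Regular.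
Variables (F : fieldType) (A : falgType F).
Local Notation m := (\dim {:A}).
Local Notation e := (vbasis {:A}).

Definition reg (a : A) : 'M[F]_m := \matrix_(i, l) coord e l (a * e`_i).

Variables (k : fieldType) (j : {rmorphism F -> k}).

(* the homomorphism from the regular module that maps 1 to [v] *)
Definition reg_hom n (M : A -> 'M[k]_n) (v : 'rV[k]_n) : 'M[k]_(m, n) := \matrix_i (v *m M e`_i).

Definition reg_one : 'rV[k]_m := \row_l j (coord e l 1).

Lemma reg_homP n (M : A -> 'M[k]_n) v : is_rep j M -> hom (bc j reg) M (reg_hom M v).
Proof.
move=> rM a; have [_ _ _ MM] := rM; apply/row_matrixP => i.
rewrite !row_mul rowK -mulmxA -MM (rep_basis (a * e`_i) rM) mulmx_sumr mulmx_sum_row.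
by apply: eq_bigr => l _; rewrite rowK -scalemxAr !mxE.
Qed.

Lemma reg_hom_one n (M : A -> 'M[k]_n) v : is_rep j M -> reg_one *m reg_hom M v = v.
Proof.
move=> rM; have [_ _ M1 _] := rM; rewrite -[RHS]mulmx1 -M1 (rep_basis 1 rM) mulmx_sumr mulmx_sum_row.
by apply: eq_bigr => l _; rewrite rowK -scalemxAr !mxE.
Qed.

Lemma reg_homM n n' (M : A -> 'M[k]_n) (M' : A -> 'M[k]_n') f v :
  hom M M' f -> reg_hom M v *m f = reg_hom M' (v *m f).
Proof. by move=> hf; apply/row_matrixP => i; rewrite row_mul !rowK -!mulmxA hf. Qed.

Lemma reg_hom0 n (M : A -> 'M[k]_n) : reg_hom M 0 = 0.
Proof. by apply/row_matrixP => i; rewrite rowK mul0mx row0. Qed.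

Lemma reg_hom_sum n (M : A -> 'M[k]_n) (I : Type) (r : seq I) (Q : pred I) v :
  reg_hom M (\sum_(i <- r | Q i) v i) = \sum_(i <- r | Q i) reg_hom M (v i).
Proof.
apply: (big_morph _ _ (reg_hom0 M)) => u w.
by apply/row_matrixP => i; rewrite linearD /= !rowK mulmxDl.
Qed.

Lemma reg_rep : is_rep idfun reg.
Proof.
have hE (a : A) (v : 'rV[F]_m) : \sum_l (v *m reg a) 0 l *: e`_l = a * \sum_i v 0 i *: e`_i.
  rewrite mulr_sumr (eq_bigr (fun l => \sum_i v 0 i *: (coord e l (a * e`_i) *: e`_l))).
    rewrite exchange_big; apply: eq_bigr => i _.
    by rewrite -scaler_sumr -(coord_vbasis (memvf _)) scalerAr.
  by move=> l _; rewrite mxE scaler_suml; apply: eq_bigr => i _; rewrite mxE scalerA.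
have inj (v w : 'rV[F]_m) : \sum_l v 0 l *: e`_l = \sum_l w 0 l *: e`_l -> v = w.
  move=> h; apply/rowP => l.
  have cE (u : 'rV[F]_m) : coord e l (\sum_l u 0 l *: e`_l) = u 0 l.
    by rewrite coord_sum_free // (basis_free (vbasisP _)).
  by rewrite -cE h cE.
have ext (X Y : 'M[F]_m) : (forall v : 'rV[F]_m, v *m X = v *m Y) -> X = Y.
  by move=> h; apply/row_matrixP => i; rewrite !rowE h.
split=> [a b|c a||a b]; apply: ext => v; apply: inj.
- rewrite hE mulrDl -!hE -big_split; apply: eq_bigr => l _.
  by rewrite mulmxDr [in RHS]mxE scalerDl.
- rewrite hE -scalerAl -hE scaler_sumr; apply: eq_bigr => l _.
  by rewrite -scalemxAr [in RHS]mxE scalerA.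
- by rewrite hE mul1r mulmx1.
- by rewrite mulmxA !hE mulrA.
Qed.

End Regular.

Section Presentation.
Variables (F : fieldType) (A : falgType F).
Variables (d : nat) (N : A -> 'M[F]_d).

(* [M] is the direct sum of the images of the [h c] on [N] over [k]. *)
Definition presents (k : fieldType) (j : {rmorphism F -> k}) n (M : A -> 'M[k]_n)
    (C : finType) (h : C -> 'M[k]_d) (f : C -> 'M[k]_(d, n)) (g : C -> 'M[k]_(n, d)) :=
  [/\ forall c, ext_span j (hom N N) (h c),
      forall c, hom (bc j N) M (f c), forall c, hom M (bc j N) (g c),
      forall c c', f c *m g c' = if c == c' then h c else 0 &
      (\sum_c g c *m f c = 1%:M)].

Hypotheses (N_rep : is_rep idfun N) (N_gen : generator N).
Variables (k : fieldType) (j : {rmorphism F -> k}).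
Local Notation Gk := (ext_span j (hom N N)).
Local Notation Nk := (bc j N).
Variables (n : nat) (M : A -> 'M[k]_n).
Hypothesis M_rep : is_rep j M.
Variables (C : nat) (f : 'I_C -> 'M[k]_(d, n)) (h : 'I_C -> 'M[k]_d).
Hypotheses (hf : forall c, hom Nk M (f c)) (Gh : forall c, Gk (h c)).
Hypotheses (hh : forall c, h c *m h c = h c) (hfE : forall c, h c *m f c = f c).
Hypothesis span : forall p, hom Nk M p -> exists2 x : 'I_C -> 'M[k]_d,
  forall c, Gk (x c) & p = \sum_c x c *m f c.
Hypothesis free : forall y : 'I_C -> 'M[k]_d, (forall c, Gk (y c)) ->
  \sum_c y c *m f c = 0 -> forall c, y c *m h c = 0.

Let GkHom x : Gk x <-> hom Nk Nk x.
Proof. by split=> Gx; apply/hom_ext_span. Qed.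

Let Nk_rep : is_rep j Nk.
Proof. exact: rep_bc. Qed.

(** Spanning and freeness are known for homomorphisms from [N]. The regular module is a summand of a
    power of [N] and its homomorphisms to [M] are the vectors of [M], so both properties pass to
    vectors. *)
Lemma presentation : exists g, presents j M h f g.
Proof.
have [U [al [be [hal hbe ab]]]] := N_gen (reg_rep A).
have abk : \sum_u map_mx j (al u) *m map_mx j (be u) = 1%:M.
  by rewrite -(map_mx1 j) -ab map_mx_sum; apply: eq_bigr => u _; rewrite map_mxM.
have bek u n' (M' : A -> 'M[k]_n') v : is_rep j M' -> hom Nk M' (map_mx j (be u) *m reg_hom M' v).
  by move=> rM; apply: homM (hom_bc j (hbe u)) (reg_homP _ rM).
have freeR (w : 'I_C -> 'rV[k]_d) : \sum_c w c *m f c = 0 -> forall c, w c *m h c = 0.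
  move=> sw c; rewrite -[LHS](reg_hom_one _ Nk_rep) -(reg_homM _ ((GkHom _).1 (Gh c))).
  rewrite -[reg_hom _ _]mul1mx -abk mulmx_suml mulmx_suml big1 ?mulmx0 // => u _.
  rewrite -!mulmxA [X in _ *m X]mulmxA; set y := fun c => map_mx j (be u) *m reg_hom Nk (w c).
  rewrite -/(y c) (free (y := y)) ?mulmx0 // => [c'|]; first by apply/GkHom; apply: bek.
  rewrite (eq_bigr (fun c => map_mx j (be u) *m reg_hom M (w c *m f c))); last first.
    by move=> c' _; rewrite /y -mulmxA (reg_homM _ (hf c')).
  by rewrite -mulmx_sumr -reg_hom_sum sw reg_hom0 mulmx0.
have freeM s (w : 'I_C -> 'M[k]_(s, d)) : \sum_c w c *m f c = 0 -> forall c, w c *m h c = 0.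
  move=> sw c; apply/row_matrixP => i; rewrite row_mul row0.
  apply: (freeR (fun c => row i (w c))); have := congr1 (row i) sw; rewrite row0 linear_sum => s0.
  rewrite -[RHS]s0; by apply: eq_bigr => c' _; exact: esym (row_mul _ _ _).
have spanR (v : 'rV[k]_n) : exists w : 'I_C -> 'rV[k]_d, v = \sum_c w c *m f c.
  have /choice[y hy] u : exists x : 'I_C -> 'M[k]_d,
      map_mx j (be u) *m reg_hom M v = \sum_c x c *m f c.
    by have [y _] := span (bek u _ _ v M_rep); exists y.
  exists (fun c => reg_one A j *m \sum_u map_mx j (al u) *m y u c).
  rewrite -[LHS](reg_hom_one _ M_rep) -[reg_hom M v]mul1mx -abk mulmx_suml.
  rewrite (eq_bigr (fun u => \sum_c map_mx j (al u) *m y u c *m f c)); last first.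
    by move=> u _; rewrite -mulmxA hy mulmx_sumr; apply: eq_bigr => c _; rewrite mulmxA.
  rewrite exchange_big mulmx_sumr; apply: eq_bigr => c _.
  by rewrite -mulmxA mulmx_suml.
have /choice[w wE] i := spanR (row i 1%:M).
(* [g c] collects the coordinates of the standard basis of [M] on [f c]; the factor [h c] makes them
   unique, and uniqueness makes [g c] a homomorphism. *)
have [g [gh gf]] : exists g : 'I_C -> 'M[k]_(n, d),
    (forall c, g c *m h c = g c) /\ \sum_c g c *m f c = 1%:M.
  exists (fun c => (\matrix_i w i c) *m h c); split=> [c|]; first by rewrite -mulmxA hh.
  apply/row_matrixP => i; rewrite wE linear_sum; apply: eq_bigr => c _.
  by rewrite /= -mulmxA hfE row_mul rowK.
exists g; split=> //.
- move=> c a.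
  have sE : \sum_c (M a *m g c - g c *m Nk a) *m f c = 0.
    rewrite (eq_bigr (fun c => M a *m (g c *m f c) - g c *m f c *m M a)); last first.
      by move=> c' _; rewrite mulmxBl -!mulmxA hf.
    by rewrite sumrB -mulmx_sumr -mulmx_suml gf mulmx1 mul1mx subrr.
  have /= := freeM _ _ sE c; rewrite mulmxBl -!mulmxA gh ((GkHom _).1 (Gh c)) mulmxA gh.
  by move/eqP; rewrite subr_eq0 => /eqP.
- move=> c c'; apply/eqP; rewrite -subr_eq0; apply/eqP.
  have sE : \sum_c' (f c *m g c' - if c == c' then h c else 0) *m f c' = 0.
    rewrite (eq_bigr (fun c' => f c *m (g c' *m f c') - (if c == c' then h c else 0) *m f c')).
      rewrite sumrB -mulmx_sumr gf mulmx1 (bigD1 c) //= eqxx hfE big1 ?addr0 ?subrr // => i ne.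
      by rewrite eq_sym (negPf ne) mul0mx.
    by move=> i _; rewrite mulmxBl mulmxA.
  have /= := freeM _ _ sE c'; rewrite mulmxBl -mulmxA gh.
  suff -> : (if c == c' then h c else 0) *m h c' = if c == c' then h c else 0 by [].
  by case: eqP => [->|_]; rewrite ?hh ?mul0mx.
Qed.

End Presentation.

(** * Uniqueness of nested decompositions *)

(** The identity of size [m r] would factor through a space of dimension [b r]. *)
Lemma block_pigeonhole (k : fieldType) r m b
    (X : 'I_m -> 'I_b -> 'M[k]_r) (Y : 'I_b -> 'I_m -> 'M[k]_r) :
  (forall i i', \sum_l X i l *m Y l i' = if i == i' then 1%:M else 0) -> (b < m)%N -> r = 0%N.
Proof.
move=> XY lbm; have e : \mxblock_(i < m, l < b) X i l *m \mxblock_(l < b, i < m) Y l i = 1%:M.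
  rewrite mul_mxblock -mxdiagZ; apply/eq_mxblock => i i'.
  by rewrite XY; case: eqP => // _; rewrite conform_mx_id.
have := mxrankM_maxl (\mxblock_(i < m, l < b) X i l) (\mxblock_(l < b, i < m) Y l i).
rewrite e mxrank1 => /leq_trans/(_ (rank_leq_col _)); rewrite !sum_nat_const !card_ord.
by case: r {X Y XY e} => // r; rewrite leq_pmul2r // leqNgt lbm.
Qed.

(** Extension by zero, for the comparison of decompositions of different lengths. *)
Definition pad (V : zmodType) C (v : 'I_C -> V) (c : nat) : V :=
  if insub c is Some c' then v c' else 0.

Lemma pad_ord (V : zmodType) C (v : 'I_C -> V) (c : 'I_C) : pad v c = v c.
Proof. by rewrite /pad valK. Qed.

Lemma pad_ge (V : zmodType) C (v : 'I_C -> V) c : (C <= c)%N -> pad v c = 0.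
Proof. by move=> h; rewrite /pad insubF // ltnNge h. Qed.

Lemma sum_ord_supp (V : zmodType) n1 n2 (f : nat -> V) :
  (forall c, (n1 <= c)%N -> f c = 0) -> (forall c, (n2 <= c)%N -> f c = 0) ->
  \sum_(c < n1) f c = \sum_(c < n2) f c.
Proof.
have trunc m1 m2 : (m1 <= m2)%N -> (forall c, (m1 <= c)%N -> f c = 0) ->
    \sum_(c < m1) f c = \sum_(c < m2) f c.
  move=> le f0; rewrite (big_ord_widen m2 f le) big_mkcond; apply: eq_bigr => c _.
  by case: ltnP => // /f0.
by move=> f1 f2; case: (leqP n1 n2) => [|/ltnW] le; [|symmetry]; apply: trunc.
Qed.

Section Uniqueness.
Variables (F : fieldType) (A : falgType F).
Variables (d : nat) (N : A -> 'M[F]_d).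
Hypothesis N_rep : is_rep idfun N.
Local Notation G := (hom N N).
Hypothesis Glie : forall x y, G x -> G y -> rad G (lie x y).
Let nG : nualg G := nualg_hom N.
Let G1 : G 1%:M := @hom1 F A F d N.
Variables (q : nat) (gb : 'I_q -> 'M[F]_d) (P : 'M[F]_(d * d, q)).
Hypothesis Gg : forall i, G (gb i).
Hypothesis JP : forall x, rad G x -> mxvec x *m P = 0.
Hypothesis GJ : forall x, G x -> rad G (x - \sum_i (mxvec x *m P) 0 i *: gb i).
Variables (k : fieldType) (j : {rmorphism F -> k}).
Local Notation rk := (repJ gb P j).
Local Notation Gk := (ext_span j G).
Local Notation Jk := (ext_span j (rad G)).
Local Notation Nk := (bc j N).
Variables (n : nat) (M : A -> 'M[k]_n).

Definition nested C (h : 'I_C -> 'M[k]_d) :=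
  forall c c' : 'I_C, (c < c')%N -> Jk (h c' - h c *m h c').

Section Presented.
Variables (C : finType) (h : C -> 'M[k]_d) (f : C -> 'M[k]_(d, n)) (g : C -> 'M[k]_(n, d)).
Hypothesis pr : presents N j M h f g.

Lemma presents_hf c : h c *m f c = f c.
Proof.
have [_ _ _ fg gf] := pr; rewrite -[RHS]mulmx1 -gf mulmx_sumr (bigD1 c) //= mulmxA fg eqxx.
by rewrite big1 ?addr0 // => c' ne; rewrite mulmxA fg eq_sym (negPf ne) mul0mx.
Qed.

Lemma presents_gh c : g c *m h c = g c.
Proof.
have [_ _ _ fg gf] := pr; rewrite -[RHS]mul1mx -gf mulmx_suml (bigD1 c) //= -mulmxA fg eqxx.
by rewrite big1 ?addr0 // => c' ne; rewrite -mulmxA fg (negPf ne) mulmx0.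
Qed.

Lemma presents_idem c : h c *m h c = h c.
Proof.
have [_ _ _ fg _] := pr; have := fg c c; rewrite eqxx => e.
by rewrite -{2}e mulmxA presents_hf e.
Qed.

End Presented.

Let rM x y : Gk x -> Gk y -> rk (x *m y) = rk x *m rk y.
Proof. exact: repJM. Qed.

Let rC x y : Gk x -> Gk y -> rk x *m rk y = rk y *m rk x.
Proof.
move=> Gx Gy; have J := ext_lie Glie Gx Gy.
have [_ J0] := repJ_eq0 nG G1 Gg JP GJ (ext_radG J).
by have := J0 J; rewrite /lie repJB !rM // => /eqP; rewrite subr_eq0 => /eqP.
Qed.

Let r0 : rk 0 = 0.
Proof. by rewrite -(scale0r (0 : 'M_d)) repJZ scale0r. Qed.

Let homG x : hom Nk Nk x -> Gk x.
Proof. by move=> hx; apply/hom_ext_span. Qed.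

(* If [u = e_b (1 - e'_b)] were nonzero for the [b]-th idempotents, then over [u] the module
   would be both free of rank at least [b + 1] and generated by [b] elements. *)
Lemma nested_le C C' (h : 'I_C -> 'M[k]_d) f g (h' : 'I_C' -> 'M[k]_d) f' g' :
  presents N j M h f g -> nested h -> presents N j M h' f' g' -> nested h' ->
  forall c : 'I_C, rk (h c) = rk (h c) *m pad (fun c => rk (h' c)) c.
Proof.
move=> pr nest pr' nest' c.
have [Gh hf hg fg gf] := pr; have [Gh' hf' hg' fg' gf'] := pr'.
have hh := presents_idem pr; have hh' := presents_idem pr'.
have rnest C0 (h0 : 'I_C0 -> 'M[k]_d) : nested h0 -> (forall c, Gk (h0 c)) ->
    (forall c, h0 c *m h0 c = h0 c) ->
    forall c c' : 'I_C0, (c <= c')%N -> rk (h0 c') = rk (h0 c) *m rk (h0 c').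
  move=> n0 Gh0 hh0 c1 c2; rewrite leq_eqVlt => /predU1P[/ord_inj->|lt].
    by rewrite -rM // hh0.
  have J := n0 _ _ lt; have [_ /(_ J)] := repJ_eq0 nG G1 Gg JP GJ (ext_radG J).
  by rewrite repJB rM // => /eqP; rewrite subr_eq0 => /eqP.
(* [E'] is [h' c], or 0 when the second decomposition stops before [c]. *)
have [E' [GE' EE' E'c]] : exists E', [/\ Gk E', E' *m E' = E' /\ rk E' = pad (fun c => rk (h' c)) c &
    forall c' : 'I_C', (c <= c')%N -> rk (h' c') = rk E' *m rk (h' c')].
  case: (ltnP c C') => lt.
    exists (h' (Ordinal lt)); split=> //; last by move=> c' le; apply: (rnest _ h').
    by rewrite -(pad_ord (fun c => rk (h' c)) (Ordinal lt)).
  exists 0; split; first exact: ext_span0.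
    by rewrite r0 mulmx0 pad_ge.
  by move=> c' le; have := leq_ltn_trans (leq_trans lt le) (ltn_ord c'); rewrite ltnn.
case: EE' => EE' <-; set e := rk (h c); set e' := rk E'.
have ee : e *m e = e by rewrite -rM // hh.
have ee' : e' *m e' = e' by rewrite -rM // EE'.
have ec : e *m e' = e' *m e by apply: rC.
apply/eqP; rewrite -subr_eq0 -{1}[e]mulmx1 -mulmxBr.
have [u uE] : {u | u = e *m (1%:M - e')} by eexists.
have [_ _ _ GM] := nG.
have Gu : Gk (h c - h c *m E') by apply: ext_spanB => //; apply: (ext_spanM GM).
rewrite -uE; have ur : u = rk (h c - h c *m E') by rewrite repJB rM // uE mulmxBr mulmx1.
have eu : e *m u = u by rewrite uE mulmxA ee.
have e'u : e' *m u = 0 by rewrite uE mulmxA -ec -mulmxA mulmxBr mulmx1 ee' subrr mulmx0.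
have uu : u *m u = u by rewrite {1}uE -mulmxA mulmxBl mul1mx e'u subr0 eu.
have uC x : Gk x -> u *m rk x = rk x *m u.
  by move=> Gx; rewrite ur; apply: rC.
have u0 (c' : 'I_C') : (c <= c')%N -> u *m rk (h' c') = 0.
  by move=> le; rewrite uE (E'c _ le) -mulmxA mulmxBl mul1mx mulmxA ee' subrr mulmx0.
have u1 (c1 : 'I_C) : (c1 <= c)%N -> u *m rk (h c1) = u.
  move=> le; rewrite uC // uE mulmxA /e -(rnest _ _ nest Gh hh) //.
have [Cm [B [CB BC uCm Bu]]] := split_idem uu.
have lt := ltn_ord c.
pose w (i : 'I_c.+1) : 'I_C := widen_ord lt i.
(* On the image of [u] the idempotents [h 0, ..., h c] act as 1, and the [h' l] with [l >= c] act as
   0. The transition matrices between the two decompositions thus factor an identity of [c + 1]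
   blocks through [c] blocks. *)
pose X (i : 'I_c.+1) (l : 'I_c) := B *m rk (f (w i) *m pad g' l) *m Cm.
pose Y (l : 'I_c) (i : 'I_c.+1) := B *m rk (pad f' l *m g (w i)) *m Cm.
rewrite -mxrank_eq0; apply/eqP; apply: (@block_pigeonhole _ _ _ _ X Y) => // i i'.
have Gpad l i0 : Gk (f i0 *m pad g' l).
  apply: homG; rewrite /pad; case: insubP => [c' _ _|_]; last by rewrite mulmx0; apply: hom0.
  exact: homM (hf _) (hg' _).
have Gpad' l i0 : Gk (pad f' l *m g i0).
  apply: homG; rewrite /pad; case: insubP => [c' _ _|_]; last by rewrite mul0mx; apply: hom0.
  exact: homM (hf' _) (hg _).
pose T l := B *m (rk (f (w i) *m pad g' l) *m rk (pad f' l *m g (w i'))) *m Cm.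
rewrite (eq_bigr (fun l : 'I_c => T l)); last first.
  move=> l _; rewrite /X /Y !mulmxA -(mulmxA _ Cm B) CB -(mulmxA B) -uC // mulmxA Bu.
  by rewrite /T !mulmxA.
rewrite (@sum_ord_supp _ c C' T) => [|l le|l le].
- rewrite (eq_bigr (fun l => B *m rk (f (w i) *m (g' l *m f' l) *m g (w i')) *m Cm)); last first.
    move=> l _; rewrite /T !pad_ord -rM ?mulmxA //; apply: homG.
      exact: homM (hf _) (hg' _).
    exact: homM (hf' _) (hg _).
  rewrite -mulmx_suml -mulmx_sumr.
  have rsum (v : 'I_C' -> 'M[k]_d) : \sum_l rk (v l) = rk (\sum_l v l).
    symmetry; apply: big_morph => [x y|]; first exact: repJD.
    by rewrite r0.
  rewrite rsum -mulmx_suml -mulmx_sumr gf' mulmx1 fg.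
  have -> : (w i == w i') = (i == i') by [].
  case: eqP => _; last first.
    by rewrite r0 mulmx0 mul0mx.
  rewrite -Bu -(mulmxA B) u1; last exact: (ltn_ord i).
  by rewrite Bu BC.
- case: (ltnP l C') => lt'; last first.
    rewrite /T (pad_ge g' lt') mulmx0 r0 mul0mx mulmx0 mul0mx //.
  rewrite /T; set l' := Ordinal lt'; rewrite -[l]/(val l') !pad_ord.
  have Gfg : Gk (f (w i) *m g' l') by apply: homG (homM (hf _) (hg' _)).
  rewrite -(presents_gh pr' l') [f (w i) *m (_ *m h' l')]mulmxA rM // -rC //.
  by rewrite !mulmxA -Bu -(mulmxA B) u0 // mulmx0 !mul0mx.
- by rewrite /T (pad_ge g' le) mulmx0 r0 mul0mx mulmx0 mul0mx.
Qed.

Lemma nested_unique C C' (h : 'I_C -> 'M[k]_d) f g (h' : 'I_C' -> 'M[k]_d) f' g' :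
  presents N j M h f g -> nested h -> presents N j M h' f' g' -> nested h' ->
  forall c : 'I_C, rk (h c) = pad (fun c => rk (h' c)) c.
Proof.
move=> pr nest pr' nest' c; have e := nested_le pr nest pr' nest' c.
case: (ltnP c C') => lt; last by rewrite e pad_ge // mulmx0.
have e' := nested_le pr' nest' pr nest (Ordinal lt).
have [Gh _ _ _ _] := pr; have [Gh' _ _ _ _] := pr'.
have pc : pad (fun c => rk (h' c)) c = rk (h' (Ordinal lt)).
  by rewrite -(pad_ord (fun c => rk (h' c)) (Ordinal lt)).
have pc' : pad (fun c => rk (h c)) (Ordinal lt) = rk (h c) by rewrite -(pad_ord (fun c => rk (h c)) c).
by rewrite pc e' pc' rC // -pc -e.
Qed.

End Uniqueness.

(** * Descent of representations *)

Section Iso.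
Variables (F : fieldType) (A : falgType F).

Definition rep_iso (k : fieldType) n n' (X : A -> 'M[k]_n) (Y : A -> 'M[k]_n') :=
  exists f g, [/\ hom X Y f, hom Y X g, f *m g = 1%:M & g *m f = 1%:M].

Variables (d : nat) (N : A -> 'M[F]_d).
Hypothesis N_rep : is_rep idfun N.

Section Fixed.
Variables (k : fieldType) (j : {rmorphism F -> k}).
Local Notation Nk := (bc j N).
Local Notation Gk := (ext_span j (hom N N)).
Local Notation Jk := (ext_span j (rad (hom N N))).

Lemma presents_iso_transfer n n' (X : A -> 'M[k]_n) (Y : A -> 'M[k]_n') (C : finType)
    (h : C -> 'M[k]_d) f g :
  rep_iso X Y -> presents N j X h f g -> exists f' g', presents N j Y h f' g'.
Proof.
move=> [u [v [hu hv uv vu]]] [Gh hf hg fg gf].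
exists (fun c => f c *m u), (fun c => v *m g c); split=> // [c|c|c c'|].
- exact: homM (hf c) hu.
- exact: homM hv (hg c).
- by rewrite -mulmxA (mulmxA u) uv mul1mx fg.
- rewrite (eq_bigr (fun c => v *m (g c *m f c) *m u)) => [|c _]; last by rewrite !mulmxA.
  by rewrite -mulmx_suml -mulmx_sumr gf mulmx1 vu.
Qed.

Lemma presents_iso n n' (X : A -> 'M[k]_n) (Y : A -> 'M[k]_n') (C : finType)
    (h : C -> 'M[k]_d) f g f' g' :
  presents N j X h f g -> presents N j Y h f' g' -> rep_iso X Y.
Proof.
suff main n1 n2 (X1 : A -> 'M[k]_n1) (Y1 : A -> 'M[k]_n2) f1 g1 f2 g2 :
    presents N j X1 h f1 g1 -> presents N j Y1 h f2 g2 ->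
    hom X1 Y1 (\sum_c g1 c *m f2 c) /\ (\sum_c g1 c *m f2 c) *m (\sum_c g2 c *m f1 c) = 1%:M.
  move=> pr pr'; have [h1 e1] := main _ _ _ _ _ _ _ _ pr pr'.
  have [h2 e2] := main _ _ _ _ _ _ _ _ pr' pr.
  by exists (\sum_c g c *m f' c), (\sum_c g' c *m f c).
move=> pr pr'; have gh := presents_gh pr.
have [Gh hf hg fg gf] := pr; have [_ hf' hg' fg' gf'] := pr'; split.
  by apply: hom_sum => c _; apply: homM (hg c) (hf' c).
rewrite -gf mulmx_suml; apply: eq_bigr => c _.
rewrite mulmx_sumr (bigD1 c) //= mulmxA -(mulmxA (g1 c)) fg' eqxx gh.
by rewrite big1 ?addr0 // => c' ne; rewrite mulmxA -(mulmxA (g1 c)) fg' eq_sym (negPf ne) mulmx0 mul0mx.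
Qed.

Let nG : nualg (hom N N) := nualg_hom N.
Let G1 : (hom N N) 1%:M := @hom1 F A F d N.
Let GM x y : Gk x -> Gk y -> Gk (x *m y).
Proof. by have [_ _ _] := nualg_ext j nG; apply. Qed.

(** [h h' h] is [h] up to a nilpotent, so it has an inverse [t] in the corner of [h]; take
    [b = h h'] and [a = h' h t]. Then [h' - a b] is an idempotent in the radical, hence 0. *)
Lemma idem_conj h h' : Gk h -> Gk h' -> h *m h = h -> h' *m h' = h' -> Jk (h - h') ->
  exists a b, [/\ Gk a, Gk b, a *m b = h' & b *m a = h].
Proof.
move=> Gh Gh' hh hh' J.
have [s nil] := ext_span_rad_nil j nG G1.
have [y Ey] : {y | y = h *m (h - h') *m h} by eexists.
have Jy : Jk y by rewrite Ey; apply: ext_radMr => //; apply: ext_radMl.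
have hy : h *m y = y by rewrite Ey !mulmxA hh.
have yh : y *m h = y by rewrite Ey -!mulmxA hh.
have hy' : h *m h' *m h = h - y by rewrite Ey mulmxBr mulmxBl !hh opprB addrCA subrr addr0.
have [t Et] : {t | t = h *m \sum_(i < s) y ^+ i} by eexists.
have Gt : Gk t.
  rewrite Et; apply: GM => //; apply: ext_span_sum => i _.
  by apply: ext_spanX nG G1 _; apply: ext_radG.
have ht : h *m t = t by rewrite Et mulmxA hh.
have th : t *m h = t.
  rewrite Et -mulmxA mulmx_suml mulmx_sumr [RHS]mulmx_sumr; apply: eq_bigr => i _.
  case: {Et} (val i) => [|m]; first by rewrite expr0 -[1]/(1%:M) mulmx1 mul1mx hh.
  by rewrite exprSr -[_ * y]/(_ *m y) -(mulmxA _ y h) yh.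
have yt : (h - y) *m t = h.
  rewrite Et mulmxA mulmxBl hh yh.
  have := subrX1 y s; rewrite nil // sub0r => /(congr1 (fun z => - (h *m z))).
  rewrite mulmxN opprK -[1]/(1%:M) mulmx1 => e; rewrite [RHS]e.
  rewrite -[_ * _]/(_ *m _) -mulmxN -mulNmx opprB mulmxA; congr (_ *m _).
  by rewrite mulmxBr mulmx1 hy.
have [a Ea] : {a | a = h' *m h *m t} by eexists.
have [b Eb] : {b | b = h *m h'} by eexists.
have ba : b *m a = h.
  by rewrite Eb Ea !mulmxA -(mulmxA h h' h') hh' hy' yt.
have hb : h *m b = b by rewrite Eb mulmxA hh.
have h'a : h' *m a = a by rewrite Ea !mulmxA hh'.
have bh' : b *m h' = b by rewrite Eb -mulmxA hh'.
have [Ga Gb] : Gk a /\ Gk b by rewrite Ea Eb; split; do !apply: GM.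
exists a, b; split=> //.
have [z Ez] : {z | z = a *m b} by eexists.
have zz : z *m z = z by rewrite Ez !mulmxA -(mulmxA a b a) ba -(mulmxA a h b) hb.
have h'z : h' *m z = z by rewrite Ez mulmxA h'a.
have zh' : z *m h' = z by rewrite Ez -mulmxA bh'.
have Gz : Gk z by rewrite Ez; apply: GM.
have Jz : Jk (h' - z).
  have Jt : Jk (h - t).
    have -> : h - t = - (y *m t).
      by rewrite -{1}yt mulmxBl ht addrC addrA addNr add0r.
    by apply: ext_spanN; apply: ext_radMr.
  have -> : h' - z = h' *m (h' - h) *m h' + h' *m h *m (h - t) *m h *m h'.
    rewrite mulmxBr mulmxBl !hh' [h' *m h *m _ in RHS]mulmxBr -[h' *m h *m h in RHS]mulmxA hh.
    by rewrite !mulmxBl -[h' *m h *m h in RHS]mulmxA hh Ez Ea Eb !mulmxA subrKA.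
  apply: ext_spanD.
    by apply: ext_radMr => //; apply: ext_radMl => //; rewrite -opprB; apply: ext_spanN.
  by apply: ext_radMr => //; apply: ext_radMr => //; apply: ext_radMl => //; apply: GM.
have idz : (h' - z) *m (h' - z) = h' - z.
  by rewrite mulmxBr !mulmxBl hh' h'z zh' zz subrr subr0.
have idzX m : (h' - z) ^+ m.+1 = h' - z.
  by elim: m => [|m IH]; rewrite ?expr1 // exprS IH -[_ * _]/(_ *m _) idz.
rewrite -Ez; apply/esym/eqP; rewrite -subr_eq0 -(idzX s) exprS nil // mulr0 //.
Qed.

Lemma presents_congr n (X : A -> 'M[k]_n) (C : finType) (h h' : C -> 'M[k]_d) f g :
  presents N j X h f g -> (forall c, Gk (h' c)) -> (forall c, h' c *m h' c = h' c) ->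
  (forall c, Jk (h c - h' c)) -> exists f' g', presents N j X h' f' g'.
Proof.
move=> pr Gh' hh' J; have [Gh hf hg fg gf] := pr; have hh := presents_idem pr.
have hfE := presents_hf pr.
have /choice[ab abE] c : exists ab : 'M[k]_d * 'M[k]_d,
    [/\ Gk ab.1, Gk ab.2, ab.1 *m ab.2 = h' c & ab.2 *m ab.1 = h c].
  have [a [b ?]] := idem_conj (Gh c) (Gh' c) (hh c) (hh' c) (J c); by exists (a, b).
exists (fun c => (ab c).1 *m f c), (fun c => g c *m (ab c).2); split=> // [c|c|c c'|].
- by have [Ga _ _ _] := abE c; apply: homM (hf c); apply/hom_ext_span.
- by have [_ Gb _ _] := abE c; apply: homM (hg c) _; apply/hom_ext_span.
- rewrite -mulmxA (mulmxA (f c)) fg; case: eqP => [<-|_]; last by rewrite mul0mx mulmx0.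
  have [_ _ e1 e2] := abE c.
  by rewrite -e2 !mulmxA e1 -mulmxA e1 hh'.
- rewrite -gf; apply: eq_bigr => c _; have [_ _ _ e2] := abE c.
  by rewrite -mulmxA (mulmxA (ab c).2) e2 hfE.
Qed.

(** The module is cut out of [C] copies of [N] by the block diagonal idempotent with entries
    [h c]. *)
Lemma presents_exists C (h : 'I_C -> 'M[k]_d) :
  (forall c, Gk (h c)) -> (forall c, h c *m h c = h c) ->
  exists n (X : A -> 'M[k]_n) f g, is_rep j X /\ presents N j X h f g.
Proof.
move=> Gh hh.
have Gh' c : hom Nk Nk (h c) by apply/hom_ext_span.
have [m [D [R [L [D_rep hR hL [RL hRE]]]]]] : exists m (D : A -> 'M[k]_m) (R : 'I_C -> 'M[k]_(d, m))
    (L : 'I_C -> 'M[k]_(m, d)), [/\ is_rep j D, forall c, hom Nk D (R c), forall c, hom D Nk (L c) &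
    (forall c c', R c *m L c' = if c == c' then h c else 0) /\ forall c, h c *m R c = R c].
  pose R c : 'M[k]_(d, \sum_(i < C) d) := \mxrow_(i < C) (if c == i then h c else 0).
  pose L c : 'M[k]_(\sum_(i < C) d, d) := \mxcol_(i < C) (if c == i then h c else 0).
  pose D a : 'M[k]_(\sum_(i < C) d) := \mxblock_(i < C, l < C) (if i == l then Nk a else 0).
  have RL c c' : R c *m L c' = if c == c' then h c else 0.
    rewrite mul_mxrow_mxcol (bigD1 c) //= eqxx big1 ?addr0 => [|i ne].
      by rewrite eq_sym; case: eqP => [->|_]; rewrite ?hh ?mulmx0.
    by rewrite eq_sym (negPf ne) mul0mx.
  have [Nk0 NkZ Nk1 NkM] := rep_bc j N_rep.
  have D_rep : is_rep j D.
    split=> [a b|z a||a b].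
    - rewrite /D -mxblockD; apply: eq_mxblock => i l; case: eqP => _; rewrite ?Nk0 ?addr0 //.
    - by apply/matrixP => u v; rewrite 3!mxE; case: eqP => _; [rewrite NkZ mxE|rewrite !mxE mulr0].
    - rewrite -mxdiagZ; apply: eq_mxblock => i l; case: eqP => // _.
      by rewrite conform_mx_id Nk1.
    - rewrite /D mul_mxblock; apply: eq_mxblock => i l.
      rewrite (bigD1 i) //= eqxx big1 ?addr0 => [|m ne]; last by rewrite eq_sym (negPf ne) mul0mx.
      by case: eqP => _; rewrite ?NkM ?mulmx0.
  have hR c : hom Nk D (R c).
    move=> a; rewrite /R mul_mxrow_mxblock mul_mxrow; apply: eq_mxrow => i.
    rewrite (bigD1 c) //= eqxx big1 ?addr0 => [|m ne]; last by rewrite eq_sym (negPf ne) mul0mx.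
    by case: eqP => _; rewrite ?mulmx0 // Gh'.
  have hL c : hom D Nk (L c).
    move=> a; rewrite /L mul_mxblock_mxrow mxcol_mul; apply: eq_mxcol => i.
    rewrite (bigD1 c) //= eqxx big1 ?addr0 => [|m ne]; last by rewrite [c == m]eq_sym (negPf ne) mulmx0.
    by rewrite [i == c]eq_sym; case: eqP => _; rewrite ?mul0mx // Gh'.
  exists (\sum_(i < C) d)%N, D, R, L; split=> //; split=> // c.
  by rewrite /R mul_mxrow; apply: eq_mxrow => i; case: eqP => _; rewrite ?hh ?mulmx0.
pose e := \sum_c L c *m R c.
have Re c : R c *m e = R c.
  rewrite mulmx_sumr (bigD1 c) //= mulmxA RL eqxx hRE big1 ?addr0 // => i ne.
  by rewrite mulmxA RL eq_sym (negPf ne) mul0mx.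
have ee : e *m e = e.
  by rewrite {1 3}/e mulmx_suml; apply: eq_bigr => c _; rewrite -mulmxA Re.
have he : hom D D e by apply: hom_sum => c _; apply: homM (hL c) (hR c).
have [Cm [B [CB BC eC Be]]] := split_idem ee.
have [|X_rep hC hB] := sub_rep D_rep BC; first by rewrite CB.
exists (\rank e), (fun a => B *m D a *m Cm), (fun c => R c *m Cm), (fun c => B *m L c).
split=> //; split=> // [c|c|c c'|].
- exact: homM (hR c) hC.
- exact: homM hB (hL c).
- by rewrite -mulmxA (mulmxA Cm) CB (mulmxA (R c)) Re RL.
- rewrite (eq_bigr (fun c => B *m (L c *m R c) *m Cm)) => [|c _]; last by rewrite !mulmxA.
  by rewrite -mulmx_suml -mulmx_sumr -/e Be BC.
Qed.

End Fixed.

Section Map.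
Variables (k : fieldType) (j : {rmorphism F -> k}) (L : fieldType) (i : {rmorphism F -> L})
  (l : {rmorphism L -> k}).
Hypothesis li : forall c, l (i c) = j c.

Lemma ext_span_comp m n (Q : 'M[F]_(m, n) -> Prop) x : ext_span i Q x -> ext_span j Q (map_mx l x).
Proof.
elim/ext_span_ind' => [|c y|y z|y Qy].
- by rewrite map_mx0; apply: ext_span0.
- by rewrite map_mxZ; apply: ext_spanZ.
- by rewrite map_mxD; apply: ext_spanD.
suff -> : map_mx l (map_mx i y) = map_mx j y by apply: ext_span_map.
by apply/matrixP => u v; rewrite !mxE li.
Qed.

Lemma presents_map n (X : A -> 'M[L]_n) (C : finType) (h : C -> 'M[L]_d) f g :
  presents N i X h f g ->
  presents N j (fun a => map_mx l (X a)) (fun c => map_mx l (h c))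
    (fun c => map_mx l (f c)) (fun c => map_mx l (g c)).
Proof.
move=> [Gh hf hg fg gf].
have bcE a : map_mx l (bc i N a) = bc j N a by apply/matrixP => u v; rewrite !mxE li.
split=> [c|c a|c a|c c'|].
- exact: ext_span_comp (Gh c).
- by rewrite -bcE -map_mxM hf map_mxM.
- by rewrite -bcE -!map_mxM hg.
- by rewrite -map_mxM fg; case: eqP => _ //; rewrite map_mx0.
- by rewrite -(map_mx1 l) -gf map_mx_sum; apply: eq_bigr => c _; rewrite map_mxM.
Qed.

End Map.
End Iso.

Lemma fitting_idem (k : fieldType) n (S : 'M[k]_n -> Prop) x : nualg S -> S x ->
  exists2 e, S e & e *m e = e /\ exists w s, [/\ S w, e = x *m w & (x - x *m e) ^+ s.+1 = 0].
Proof.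
move=> nS Sx; have [w [Sw xw ee [s hs]]] := fitting nS Sx; have [_ _ _ SM] := nS.
exists (x *m w); first exact: SM.
split=> //; exists w, s; split=> //.
have -> : x - x *m (x *m w) = x *m (1%:M - x *m w) by rewrite mulmxBr mulmx1.
have c : GRing.comm x (1%:M - x *m w).
  rewrite /GRing.comm -![_ * _]/(_ *m _) mulmxBr mulmxBl mulmx1 mul1mx.
  by rewrite -(mulmxA x w x) -xw.
have := exprMn_comm s.+1 c; rewrite -[x * _]/(x *m _) => ->.
rewrite exprS exprSr -[_ * _]/((x *m x ^+ s) *m ((1%:M - x *m w) ^+ s *m (1%:M - x *m w))).
have cX : (1%:M - x *m w) ^+ s *m (1%:M - x *m w) = (1%:M - x *m w) *m (1%:M - x *m w) ^+ s.
  by rewrite -[_ *m _]/(_ * _) -exprSr exprS.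
by rewrite cX -mulmxA (mulmxA (x ^+ s)) hs mul0mx mulmx0.
Qed.

Section Structure.
Variables (F : fieldType) (A : falgType F).
Variables (d : nat) (N : A -> 'M[F]_d).
Hypotheses (N_rep : is_rep idfun N) (N_gen : generator N).
Local Notation G := (hom N N).
Hypothesis Glie : forall x y, G x -> G y -> rad G (lie x y).
Let nG : nualg G := nualg_hom N.
Let G1 : G 1%:M := @hom1 F A F d N.
Variables (q : nat) (gb : 'I_q -> 'M[F]_d) (P : 'M[F]_(d * d, q)).
Hypothesis Gg : forall i, G (gb i).
Hypothesis JP : forall x, rad G x -> mxvec x *m P = 0.
Hypothesis GJ : forall x, G x -> rad G (x - \sum_i (mxvec x *m P) 0 i *: gb i).
Variables (k : fieldType) (j : {rmorphism F -> k}).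
Local Notation Gk := (ext_span j G).
Local Notation Jk := (ext_span j (rad G)).
Local Notation rk := (repJ gb P j).

Theorem structure n (M : A -> 'M[k]_n) : (forall x, Gk x -> Jk (x *m x) -> Jk x) -> is_rep j M ->
  exists C (h : 'I_C -> 'M[k]_d) f g, presents N j M h f g /\ nested N j h.
Proof.
move=> Rk M_rep; have [s [W [W0 Ws Wflag]]] := rad_flag nG G1.
have [J0 JD JZ _] := nualg_rad nG.
have [||l [jb [Pj [Jjb _ _ jdec]]]] := basis_mod J0 JD JZ (J := fun x => x = 0) (erefl 0).
- by move=> x y -> ->; rewrite addr0.
- by move=> c x ->; rewrite scaler0.
have jb_gen z : Jk z -> exists a : 'I_l -> k, z = \sum_t a t *: map_mx j (jb t).
  elim/ext_span_ind' => [|c y [a ->]|y y' [a ->] [a' ->]|x Jx].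
  - by exists (fun=> 0); rewrite big1 // => t _; rewrite scale0r.
  - by exists (fun t => c * a t); rewrite scaler_sumr; apply: eq_bigr => t _; rewrite scalerA.
  - by exists (fun t => a t + a' t); rewrite -big_split; apply: eq_bigr => t _; rewrite scalerDl.
  exists (fun t => j ((mxvec x *m Pj) 0 t)).
  have /eqP := jdec x Jx; rewrite subr_eq0 => /eqP {1}->; rewrite map_mx_sum.
  by apply: eq_bigr => t _; rewrite map_mxZ.
have [C [f [h [fam full]]]] := family_full N_rep Glie Gg JP GJ Rk M Jjb jb_gen.
have := @presentation F A d N N_rep N_gen k j n M M_rep C (fun c => f c) (fun c => h c).
case=> [c|c|c|c|p hp|y Gy sy c|g pr].
- exact: fam_f fam _ (ltn_ord c).
- exact: fam_h fam _ (ltn_ord c).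
- exact: fam_idem fam _ (ltn_ord c).
- exact: fam_hf fam _ (ltn_ord c).
- by have [x Gx e] := family_span Jjb W0 Ws Wflag full hp; exists (fun c => x c).
- have := @family_free F A d N N_gen k j n M M_rep l jb Jjb jb_gen s W W0 Ws Wflag
    C f h fam full (pad y).
  move/(_ _ _ c (ltn_ord c)); rewrite pad_ord; apply.
    by move=> c'; rewrite /pad; case: insub => // ; apply: ext_span0.
  by rewrite -[RHS]sy; apply: eq_bigr => c' _; rewrite pad_ord.
exists C, (fun c : 'I_C => h c), (fun c : 'I_C => f c), g; split=> // c c' lt.
by apply: (fam_nested fam); rewrite lt ltn_ord.
Qed.

(** Let [h] be the Fitting idempotent of a preimage [x] of [e]. The class [e - rk h] of [x - x h] is
    both idempotent and nilpotent, hence 0. *)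
Lemma lift_idem e : (exists2 x, Gk x & rk x = e) -> e *m e = e ->
  exists h, [/\ Gk h, h *m h = h & rk h = e].
Proof.
move=> [x Gx xe] ee; have nGk := nualg_ext j nG; have [_ _ _ GM] := nGk.
have [h Gh [hh [w [s [Gw hE nil]]]]] := fitting_idem nGk Gx.
exists h; split=> //.
have rM u v : Gk u -> Gk v -> rk (u *m v) = rk u *m rk v by apply: repJM.
have eh : e *m rk h = rk h by rewrite hE rM // xe mulmxA ee.
have he : rk h *m e = e *m rk h.
  have J := ext_lie Glie Gx Gh; have [_ /(_ J)] := repJ_eq0 nG G1 Gg JP GJ (ext_radG J).
  by rewrite /lie repJB !rM // xe => /eqP; rewrite subr_eq0 => /eqP.
have [y Ey] : {y | y = x - x *m h} by eexists.
have Gy : Gk y by rewrite Ey; apply: ext_spanB => //; apply: GM.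
have ry : rk y = e - rk h by rewrite Ey repJB rM // xe eh.
have yy : rk y *m rk y = rk y.
  by rewrite ry mulmxBl !mulmxBr ee he eh -rM // hh subrr subr0.
rewrite -Ey in nil; have : rk (y ^+ s.+1) = rk y.
  elim: s {nil} => [|m IH]; first by rewrite expr1.
  rewrite exprS -[_ * _]/(_ *m _) rM ?IH //.
  exact: (ext_spanX _ nG G1 Gy).
rewrite nil -(scale0r (0 : 'M_d)) repJZ scale0r ry => /esym/eqP; rewrite subr_eq0 => /eqP; done.
Qed.

End Structure.

(** * The minimal field of definition of a representation *)

Section Descent.
Variables (F : fieldType) (F_C1 : C1_field F) (A : falgType F).
Variables (d : nat) (N : A -> 'M[F]_d).
Hypotheses (N_rep : is_rep idfun N) (N_gen : generator N).
Hypothesis N_min : forall d' (N' : A -> 'M[F]_d'),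
  is_rep idfun N' -> generator N' -> (d <= d')%N.
Local Notation G := (hom N N).
Variables (K : fieldType) (iota : {rmorphism F -> K}).
Hypothesis pc : perfectly_closed iota.

Definition descends (E : interfield iota) n (M : A -> 'M[K]_n) :=
  exists m (M0 : A -> 'M[if_sort E]_m), is_rep (if_inj E) M0 /\
    rep_iso M (fun a => map_mx (if_val E) (M0 a)).

Theorem rep_minimal_field n (M : A -> 'M[K]_n) : is_rep iota M ->
  exists K0 : interfield iota, [/\ descends K0 M, finite_degree K0 &
    forall L : interfield iota, descends L M -> {subset if_pred K0 <= if_pred L}].
Proof.
move=> M_rep.
have nG : nualg G := nualg_hom N; have G1 : G 1%:M := @hom1 F A F d N.
have Glie := min_lie N_rep N_gen N_min F_C1.
have Gsqr := min_rad_sqr N_rep N_gen N_min.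
have [G0 GD GZ GM] := nG; have [J0 JD JZ _] := nualg_rad nG.
have [q [gb [P [Gg gP JP GJ]]]] := basis_mod G0 GD GZ J0 JD JZ.
pose E := imgJ G gb P.
have nE : nualg E by apply: nualg_imgJ.
have Ec : forall x y, E x -> E y -> x *m y = y *m x by apply: imgJ_comm.
have Er : forall x, E x -> x *m x = 0 -> x = 0 by apply: imgJ_reduced.
pose rK := repJ gb P iota.
have [red alg] : (forall z, ext_span iota E z -> z *m z = 0 -> z = 0) /\
    (forall z u v, ext_span iota E z -> z *m z = z -> algebraicOver iota (z u v)).
  (* The case [q = 0] is set apart, as the results on commutative reduced algebras concern matrices
     of positive size. *)
  move: (E) nE Ec Er; clear -F_C1 pc; case: q => [|r] E' nE Ec Er.
    by split=> [z _ _|z []//]; apply/matrixP => -[].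
  by split=> [z|z u v]; [exact: (reduced_ext nE Ec Er F_C1 pc (z := z))|
    exact: (idem_algebraic nE Ec Er (e := z) u v)].
(* Reducedness over [L] follows from that over [K], since matrices over [L] embed in those over
   [K]. *)
have RL (L : fieldType) (i : {rmorphism F -> L}) (l : {rmorphism L -> K}) x :
    (forall c, l (i c) = iota c) -> ext_span i G x -> ext_span i (rad G) (x *m x) ->
    ext_span i (rad G) x.
  move=> li Gx Jxx; have nGL := nualg_ext i nG.
  apply: (repJ_eq0 nG G1 Gg JP GJ Gx).1; apply: (map_mx_inj (f := l)).
  rewrite map_mx0 -(repJ_map gb P x li); apply: red.
    by apply: ext_imgJ; apply: (ext_span_comp li).
  rewrite (repJ_map gb P x li) -map_mxM -(repJM nG Gg JP GJ Gx Gx).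
  by rewrite (repJ_eq0 nG G1 Gg JP GJ (ext_radG Jxx)).2 ?map_mx0.
have [C [h [f [g [pr nest]]]]] := structure N_rep N_gen Glie Gg JP GJ
  (fun x => RL K iota idfun x (fun=> erefl)) M_rep.
have hh := presents_idem pr; have [Gh _ _ _ _] := pr.
have rh c : rK (h c) *m rK (h c) = rK (h c) by rewrite -(repJM nG Gg JP GJ) ?hh.
pose entries (L : interfield iota) := forall c u v, rK (h c) u v \in if_pred L.
(* The field generated by the entries, as the intersection of all intermediate fields that contain
   them. *)
have dS : GRing.divring_closed (fun x => `[< forall L, entries L -> x \in if_pred L >]).
  split; first by apply/asboolP => L _; apply: rpred1.
    by move=> x y /asboolP hx /asboolP hy; apply/asboolP => L eL; rewrite rpredB ?hx ?hy.
  by move=> x y /asboolP hx /asboolP hy; apply/asboolP => L eL; rewrite rpred_div ?hx ?hy.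
pose D : divringClosed K := HB.pack (fun x => `[< forall L, entries L -> x \in if_pred L >])
  (GRing.isDivringClosed.Build K _ dS).
have D0 c : iota c \in D by apply/asboolP => L _; apply: if_base.
pose K0 := Interfield D0.
have K0E c u v : rK (h c) u v \in if_pred K0 by apply/asboolP => L; apply.
have K0min L : entries L -> {subset if_pred K0 <= if_pred L}.
  by move=> eL x /asboolP; apply.
exists K0; split.
- pose e0 c : 'M[if_sort K0]_q := \matrix_(u, v) Sub (rK (h c) u v) (K0E c u v).
  have e0E c : map_mx (if_val K0) (e0 c) = rK (h c).
    by apply/matrixP => u v; rewrite !mxE.
  have K0K c : if_val K0 (if_inj K0 c) = iota c by apply: if_injK.
  have inj := map_mx_inj (f := if_val K0).
  (* The class of [h c] lifts to an idempotent over [K0]. Over [K] the lift need only be congruent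
     to [h c] modulo the radical, which [presents_congr] allows. *)
  have /choice[h0 h0E] c : exists h0, [/\ ext_span (if_inj K0) G h0, h0 *m h0 = h0 &
      repJ gb P (if_inj K0) h0 = e0 c].
    apply: (lift_idem Glie Gg JP GJ); last first.
      by apply: inj; rewrite map_mxM e0E.
    exists (liftJ gb P (if_inj K0) (e0 c)); first exact: liftJG.
    apply: inj; rewrite -(repJ_map gb P _ K0K) -(liftJ_map gb P _ K0K) !e0E.
    exact: (liftJK nG G1 Gg JP GJ).
  have [m [M0 [f0 [g0 [M0_rep pr0]]]]] := presents_exists N_rep
    (fun c => let: And3 a _ _ := h0E c in a) (fun c => let: And3 _ a _ := h0E c in a).
  exists m, M0; split=> //.
  have prK := presents_map K0K pr0.
  have [|||f1 [g1 pr1]] := presents_congr N_rep pr (h' := fun c => map_mx (if_val K0) (h0 c)).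
  + by move=> c; have [a _ _] := h0E c; apply: (ext_span_comp K0K).
  + by move=> c; have [_ a _] := h0E c; rewrite -map_mxM a.
  + move=> c; have [Gh0 _ e] := h0E c.
    have GhK := ext_span_comp K0K Gh0.
    apply: (repJ_eq0 nG G1 Gg JP GJ (ext_spanB (Gh c) GhK)).1.
    by rewrite repJB (repJ_map gb P _ K0K) e e0E subrr.
  exact: presents_iso pr1 prK.
- pose s := [seq rK (h x.1) x.2.1 x.2.2 | x : 'I_C * ('I_q * 'I_q)].
  have [|L [fL sL]] := @algebraic_interfield F K iota s.
    move=> _ /mapP[x _ ->]; apply: alg => //; exact: ext_imgJ.
  apply: finite_degree_sub fL; apply: K0min => c u v; apply: sL.
  by apply/mapP; exists (c, (u, v)); rewrite ?mem_enum.
- move=> L [m [M0 [M0_rep iso]]]; apply: K0min => c u v.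
  have LK c0 : if_val L (if_inj L c0) = iota c0 by apply: if_injK.
  (* A decomposition over [L] stays nested over [K]; uniqueness identifies its classes, whose
     entries lie in [L], with those of the [h c]. *)
  have [C' [h' [f' [g' [pr' nest']]]]] := structure N_rep N_gen Glie Gg JP GJ
    (fun x => RL _ (if_inj L) (if_val L) x LK) M0_rep.
  have iso' : rep_iso (fun a => map_mx (if_val L) (M0 a)) M.
    by have [a [b [ha hb ab ba]]] := iso; exists b, a.
  have [f1 [g1 pr1]] := presents_iso_transfer iso' (presents_map LK pr').
  have nest1 : nested N iota (fun c => map_mx (if_val L) (h' c)).
    by move=> c1 c2 lt; have := ext_span_comp LK (nest' _ _ lt); rewrite map_mxB map_mxM.
  rewrite /rK (nested_unique N_rep Glie Gg JP GJ pr nest pr1 nest1) /pad.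
  case: insubP => [c' _ _|_]; last by rewrite mxE rpred0.
  by rewrite (repJ_map gb P _ LK) mxE; apply: valP.
Qed.

End Descent.

(** * Modules and representations *)

Lemma row_ext (k : fieldType) m n (X Y : 'M[k]_(m, n)) : (forall v : 'rV_m, v *m X = v *m Y) -> X = Y.
Proof. by move=> h; apply/row_matrixP => i; rewrite !rowE h. Qed.

Section IsoMod.
Variable R : pzRingType.

Lemma linear_fun (M N : lmodType R) (f : M -> N) : (forall r x y, f (r *: x + y) = r *: f x + f y) ->
  exists g : {linear M -> N}, forall x, g x = f x.
Proof.
move=> fl; have fl' : linear f by move=> r x y; apply: fl.
pose g : {linear M -> N} := HB.pack f (GRing.isLinear.Build R M N *:%R f fl').
by exists g.
Qed.

Lemma iso_modI (M N : lmodType R) (f : M -> N) (g : N -> M) :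
  (forall r x y, f (r *: x + y) = r *: f x + f y) -> cancel f g -> cancel g f -> iso_mod M N.
Proof.
by move=> /linear_fun[h hE] fg gf; exists h, g => x; rewrite hE.
Qed.

Lemma iso_mod_sym (M N : lmodType R) : iso_mod M N -> iso_mod N M.
Proof.
move=> [f [g fg gf]]; apply: (@iso_modI _ _ g f) => // r x y.
by apply: (can_inj fg); rewrite linearP !gf.
Qed.

Lemma iso_mod_trans (M N P : lmodType R) : iso_mod M N -> iso_mod N P -> iso_mod M P.
Proof.
move=> [f bf] [g bg]; have [f' ff' f'f] := bf; have [g' gg' g'g] := bg.
apply: (@iso_modI _ _ (g \o f) (f' \o g')) => [r x y|x|x] /=; first by rewrite !linearP.
  by rewrite gg' ff'.
by rewrite f'f g'g.
Qed.

End IsoMod.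

Section Act.
Variables (R : pzRingType) (k : fieldType).

(** Linearity over [k] is expressed separately, through a morphism [sc] from [k] to [R]; the same
    lemmas then serve [A] over [F] and the extended algebra over [k]. *)
Definition is_act n (X : R -> 'M[k]_n) :=
  [/\ forall a b, X (a + b) = X a + X b, X 1 = 1%:M & forall a b, X (a * b) = X b *m X a].

Definition rmod n (X : R -> 'M[k]_n) (hX : is_act X) : Type := 'rV[k]_n.

Section Module.
Variables (n : nat) (X : R -> 'M[k]_n) (hX : is_act X).

HB.instance Definition _ := GRing.Zmodule.on (rmod hX).

Definition rmod_scale (a : R) (u : rmod hX) : rmod hX := (u : 'rV[k]_n) *m X a.

Fact rmod_scaleA a b u : rmod_scale a (rmod_scale b u) = rmod_scale (a * b) u.
Proof. by have [_ _ XM] := hX; rewrite /rmod_scale -mulmxA XM. Qed.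
Fact rmod_scale1 : left_id 1 rmod_scale.
Proof. by have [_ X1 _] := hX; move=> u; rewrite /rmod_scale X1 mulmx1. Qed.
Fact rmod_scaleDr : right_distributive rmod_scale +%R.
Proof. by move=> a u v; apply: mulmxDl. Qed.
Fact rmod_scaleDl u : {morph rmod_scale^~ u : a b / a + b}.
Proof. by have [XD _ _] := hX; move=> a b; rewrite /rmod_scale XD; apply: mulmxDr. Qed.

HB.instance Definition _ := GRing.Zmodule_isLmodule.Build R (rmod hX)
  rmod_scaleA rmod_scale1 rmod_scaleDr rmod_scaleDl.

Lemma rmod_scaleE a (u : rmod hX) : a *: u = ((u : 'rV[k]_n) *m X a : 'rV[k]_n).
Proof. by []. Qed.

End Module.

Variable sc : {rmorphism k -> R}.
Hypothesis scC : forall c r, sc c * r = r * sc c.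

Lemma rmod_fin_gen n (X : R -> 'M[k]_n) (hX : is_act X) : (forall c, X (sc c) = c%:M) ->
  fin_gen (rmod hX).
Proof.
move=> Xsc; exists n, (fun i => row i 1%:M) => u; exists (fun i => sc ((u : 'rV_n) 0 i)).
rewrite -[LHS](mulmx1 (u : 'rV_n)) mulmx_sum_row; apply: eq_bigr => i _.
by rewrite rmod_scaleE Xsc mul_mx_scalar.
Qed.

Lemma rmod_linear n n' (X : R -> 'M[k]_n) (Y : R -> 'M[k]_n') (hX : is_act X) (hY : is_act Y)
    (f : {linear rmod hX -> rmod hY}) :
  (forall c, X (sc c) = c%:M) -> (forall c, Y (sc c) = c%:M) ->
  exists2 T : 'M[k]_(n, n'), forall u, f u = (u : 'rV_n) *m T & forall a, X a *m T = T *m Y a.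
Proof.
move=> Xsc Ysc; pose T : 'M[k]_(n, n') := \matrix_i (f (row i 1%:M) : 'rV[k]_n').
have fT u : f u = (u : 'rV_n) *m T.
  have uE : u = \sum_i sc ((u : 'rV_n) 0 i) *: (row i 1%:M : rmod hX).
    rewrite -[LHS](mulmx1 (u : 'rV_n)) mulmx_sum_row; apply: eq_bigr => i _.
    by rewrite rmod_scaleE Xsc mul_mx_scalar.
  rewrite {1}uE linear_sum mulmx_sum_row; apply: eq_bigr => i _.
  by rewrite linearZ /= rmod_scaleE Ysc mul_mx_scalar rowK.
exists T => // a; apply: row_ext => v; rewrite !mulmxA.
by rewrite -[LHS](fT (v *m X a : 'rV_n)) -[v *m X a]/(a *: (v : rmod hX)) linearZ fT.
Qed.

Lemma rmod_iso n n' (X : R -> 'M[k]_n) (Y : R -> 'M[k]_n') (hX : is_act X) (hY : is_act Y) :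
  (forall c, X (sc c) = c%:M) -> (forall c, Y (sc c) = c%:M) ->
  iso_mod (rmod hX) (rmod hY) <-> exists T T', [/\ forall a, X a *m T = T *m Y a,
    forall a, Y a *m T' = T' *m X a, T *m T' = 1%:M & T' *m T = 1%:M].
Proof.
move=> Xsc Ysc; split=> [[f bf]|[T [T' [hT hT' e e']]]].
  have [g fg gf] := bf.
  have [|h hE] := @linear_fun R (rmod hY) (rmod hX) g.
    by move=> r x y; apply: (can_inj fg); rewrite linearP !gf.
  have [T fT hT] := rmod_linear f Xsc Ysc; have [T' gT' hT'] := rmod_linear h Ysc Xsc.
  exists T, T'; split=> //; apply: row_ext => v; rewrite mulmxA mulmx1.
    by rewrite -[v *m T]fT -[LHS]gT' hE fg.
  by rewrite -[v *m T']gT' hE -[LHS]fT gf.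
apply: (@iso_modI _ (rmod hX) (rmod hY) (fun u : 'rV_n => u *m T) (fun u : 'rV_n' => u *m T')).
- by move=> r x y; rewrite mulmxDl !rmod_scaleE -mulmxA hT mulmxA.
- by move=> u; rewrite -mulmxA e mulmx1.
- by move=> u; rewrite -mulmxA e' mulmx1.
Qed.

(** [w] is the image of a basis of a complement of the space of relations between the [v i]. *)
Lemma frame (M : lmodType R) m (v : 'I_m -> M) :
  (forall x, exists c : 'rV[k]_m, x = \sum_i sc (c 0 i) *: v i) ->
  exists n (w : 'I_n -> M) (psi : M -> 'rV[k]_n),
    cancel psi (fun c => \sum_i sc (c 0 i) *: w i) /\
    injective (fun c : 'rV[k]_n => \sum_i sc (c 0 i) *: w i).
Proof.
move=> span; pose phi (c : 'rV[k]_m) := \sum_i sc (c 0 i) *: v i.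
have phiD c c' : phi (c + c') = phi c + phi c'.
  by rewrite /phi -big_split; apply: eq_bigr => i _; rewrite mxE rmorphD scalerDl.
have phiZ a c : phi (a *: c) = sc a *: phi c.
  by rewrite /phi scaler_sumr; apply: eq_bigr => i _; rewrite mxE rmorphM scalerA.
have phi0 : phi 0 = 0 by rewrite /phi big1 // => i _; rewrite mxE rmorph0 scale0r.
have [|||U HU] := @subspace_mx k m (fun c => phi c = 0) => //.
- by move=> a b ha hb; rewrite phiD ha hb addr0.
- by move=> a b hb; rewrite phiZ hb scaler0.
pose B := row_base (U^C)%MS.
pose w i := phi (row i B).
have wE (c : 'rV_(\rank (U^C)%MS)) : \sum_i sc (c 0 i) *: w i = phi (c *m B).
  rewrite mulmx_sum_row (big_morph phi phiD phi0); apply: eq_bigr => i _.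
  by rewrite phiZ.
have surj x : exists c : 'rV_(\rank (U^C)%MS), x = phi (c *m B).
  have [c ->] := span x; rewrite -/(phi c).
  have /sub_addsmxP[[a b] /= ->] : (c <= U + U^C)%MS.
    by apply: submx_full; apply: addsmx_compl_full.
  have /submxP[c' e] : (b *m U^C <= B)%MS by rewrite eq_row_base submxMl.
  exists c'; rewrite phiD e (HU _).1 ?submxMl // add0r //.
have [psi psiE] := choice surj.
exists (\rank (U^C)%MS), w, psi; split=> [x|c c' /=]; first by rewrite /= wE -psiE.
rewrite !wE => e; apply/eqP; rewrite -subr_eq0; apply/eqP/(row_free_inj (row_base_free (U^C)%MS)).
rewrite mul0mx; apply/eqP; rewrite -submx0 -(capmx_compl U) sub_capmx.
rewrite (HU _).2 /=; first by rewrite -(eq_row_base (U^C)%MS) submxMl.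
by rewrite mulmxBl -scaleN1r phiD phiZ rmorphN1 scaleN1r e subrr.
Qed.

Lemma rmod_exists (M : lmodType R) m (v : 'I_m -> M) :
  (forall x, exists c : 'rV[k]_m, x = \sum_i sc (c 0 i) *: v i) ->
  exists n (X : R -> 'M[k]_n) (hX : is_act X), (forall c, X (sc c) = c%:M) /\ iso_mod M (rmod hX).
Proof.
move=> /frame[n [w [psi [psiK phi_inj]]]].
pose phi (c : 'rV[k]_n) := \sum_i sc (c 0 i) *: w i; rewrite -/phi in psiK phi_inj.
have phiD c c' : phi (c + c') = phi c + phi c'.
  by rewrite /phi -big_split; apply: eq_bigr => i _; rewrite mxE rmorphD scalerDl.
have phiZ a c : phi (a *: c) = sc a *: phi c.
  by rewrite /phi scaler_sumr; apply: eq_bigr => i _; rewrite mxE rmorphM scalerA.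
have phi0 : phi 0 = 0 by rewrite /phi big1 // => i _; rewrite mxE rmorph0 scale0r.
pose X r : 'M[k]_n := \matrix_i psi (r *: w i).
have XE r c : phi (c *m X r) = r *: phi c.
  rewrite mulmx_sum_row (big_morph phi phiD phi0) scaler_sumr; apply: eq_bigr => i _.
  by rewrite phiZ rowK psiK !scalerA scC.
have hX : is_act X.
  split=> [a b||a b]; apply: row_ext => c; apply: phi_inj.
  - by rewrite mulmxDr phiD !XE scalerDl.
  - by rewrite XE scale1r mulmx1.
  - by rewrite mulmxA !XE scalerA.
exists n, X, hX; split=> [c|].
  by apply: row_ext => u; apply: phi_inj; rewrite XE mul_mx_scalar phiZ.
apply: iso_mod_sym; apply: (@iso_modI _ (rmod hX) M phi psi) => [r x y|x|x]; last exact: psiK.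
  by rewrite phiD rmod_scaleE XE.
by apply: phi_inj; rewrite psiK.
Qed.

End Act.

Section ExtRep.
Variables (F : fieldType) (A : falgType F) (k : fieldType) (j : {rmorphism F -> k}).
Local Notation AK := (ext_alg j A).

Section Act.
Variables (n : nat) (X : A -> 'M[k]_n).
Hypothesis hX : is_rep j X.

Definition rep_act (s : AK) : 'M[k]_n := tlift (j := j) (fun a (x : A) => a *: X x) s.

Let bal : balanced j (fun a (x : A) => a *: X x).
Proof.
have [XD XZ _ _] := hX; split=> [v a b|a v w|a c v].
- by rewrite scalerDl.
- by rewrite XD scalerDr.
- by rewrite XZ scalerA.
Qed.

Lemma rep_act_pure a x : rep_act (ext_pure j a x) = a *: X x.
Proof. exact: (tlift_pure bal). Qed.

Lemma rep_actD s t : rep_act (s + t) = rep_act s + rep_act t.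
Proof. exact: (tliftD bal). Qed.

Lemma rep_act0 : rep_act 0 = 0.
Proof. exact: (tlift0 bal). Qed.

Lemma rep_act_is_act : is_act rep_act.
Proof.
have [_ _ X1 XM] := hX; split; first exact: rep_actD.
  by rewrite -[1]/(ext_pure j 1 1) rep_act_pure X1 scale1r.
move=> s t; elim/ext_ind: s => [|a x|s s' IH IH'].
- by rewrite mul0r rep_act0 mulmx0.
- elim/ext_ind: t => [|b y|t t' IH IH'].
  + by rewrite mulr0 rep_act0 mul0mx.
  + by rewrite ext_pureM !rep_act_pure XM -scalemxAl -scalemxAr scalerA mulrC.
  + by rewrite mulrDr !rep_actD IH IH' mulmxDl.
- by rewrite mulrDl !rep_actD IH IH' mulmxDr.
Qed.

Lemma rep_act_sc c : rep_act (in_alg AK c) = c%:M.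
Proof.
have [_ _ X1 _] := hX.
by rewrite /= -[1]/(ext_pure j 1 1) ext_scale_pure mulr1 rep_act_pure X1 scalemx1.
Qed.

End Act.

Notation emod hX := (rmod (rep_act_is_act hX)).

Lemma in_alg_ext_central (c : k) (s : AK) : in_alg AK c * s = s * in_alg AK c.
Proof. by rewrite /= -scalerAl -scalerAr mul1r mulr1. Qed.

Lemma emod_fin_gen n (X : A -> 'M[k]_n) (hX : is_rep j X) : fin_gen (emod hX).
Proof. by apply: (rmod_fin_gen (sc := in_alg AK)) => c; apply: rep_act_sc. Qed.

Lemma emod_iso n n' (X : A -> 'M[k]_n) (Y : A -> 'M[k]_n') (hX : is_rep j X) (hY : is_rep j Y) :
  iso_mod (emod hX) (emod hY) <-> rep_iso X Y.
Proof.
have hE m m' (Z : A -> 'M[k]_m) (Z' : A -> 'M[k]_m') T (hZ : is_rep j Z) (hZ' : is_rep j Z') :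
    (forall s, rep_act Z s *m T = T *m rep_act Z' s) <-> hom Z Z' T.
  split=> h s.
    by have := h (ext_pure j 1 s); rewrite !rep_act_pure // !scale1r.
  elim/ext_ind: s => [|a x|s t IH IH'].
  - by rewrite !rep_act0 // mul0mx mulmx0.
  - by rewrite !rep_act_pure // -scalemxAl -scalemxAr h.
  - by rewrite !rep_actD // mulmxDl mulmxDr IH IH'.
have [||h1 h2] := @rmod_iso AK k (in_alg AK) n n' _ _ (rep_act_is_act hX) (rep_act_is_act hY).
- by move=> c; apply: rep_act_sc.
- by move=> c; apply: rep_act_sc.
split=> [/h1[T [T' [hT hT' e e']]]|[T [T' [hT hT' e e']]]].
  by exists T, T'; split=> //; apply/hE.
by apply: h2; exists T, T'; split=> //; apply/hE.
Qed.

Lemma emod_exists (M : lmodType AK) : fin_gen M ->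
  exists n (X : A -> 'M[k]_n) (hX : is_rep j X), iso_mod M (emod hX).
Proof.
move=> [m [e he]]; pose T := ('I_m * 'I_(\dim {:A}))%type.
pose v (u : 'I_#|{: T}|) := ext_pure j 1 (vbasis {:A})`_(enum_val u).2 *: e (enum_val u).1.
have spanA (s : AK) : exists c : 'I_(\dim {:A}) -> k, s = \sum_l c l *: ext_pure j 1 (vbasis {:A})`_l.
  elim/ext_ind: s => [|a x|s t [c ->] [c' ->]].
  - by exists (fun=> 0); rewrite big1 // => l _; rewrite scale0r.
  - exists (fun l => a * j (coord (vbasis {:A}) l x)).
    have pD : {morph (ext_pure j a : A -> AK) : x y / x + y}.
      by move=> x1 x2; rewrite /ext_pure pureDr.
    have p0 : ext_pure j a 0 = 0 :> AK.
      by apply: (addrI (ext_pure j a 0)); rewrite -pD !addr0.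
    rewrite {1}(coord_vbasis (memvf x)) (big_morph _ pD p0); apply: eq_bigr => l _.
    by rewrite ext_scale_pure mulr1 /ext_pure pure_bal.
  - by exists (fun l => c l + c' l); rewrite -big_split; apply: eq_bigr => l _; rewrite scalerDl.
have spanM x : exists c : 'rV[k]_#|{: T}|, x = \sum_u in_alg AK (c 0 u) *: v u.
  have [r ->] := he x; have [c cE] := choice (fun i => spanA (r i)).
  exists (\row_u c (enum_val u).1 (enum_val u).2).
  pose g (i : 'I_m) (l : 'I_(\dim {:A})) := in_alg AK (c i l) *: (ext_pure j 1 (vbasis {:A})`_l *: e i).
  rewrite (eq_bigr (fun i => \sum_l g i l)) => [|i _]; last first.
    rewrite {1}cE scaler_suml; apply: eq_bigr => l _.
    by rewrite /g scalerA /= -scalerAl mul1r.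
  rewrite (pair_bigA _ g) /= [RHS](reindex _ (onW_bij _ (@enum_rank_bij _))) /=.
  by apply: eq_bigr => -[i l] _; rewrite mxE /v enum_rankK.
have [n [Y [hY [Ysc iM]]]] := rmod_exists in_alg_ext_central spanM.
have [YD Y1 YM] := hY.
have pE a x : ext_pure j a x = in_alg AK a * ext_pure j 1 x :> AK.
  by rewrite /= -scalerAl mul1r ext_scale_pure mulr1.
have hX : is_rep j (fun x => Y (ext_pure j 1 x)).
  split=> [a b|c a||a b].
  - by rewrite -YD /ext_pure pureDr.
  - by rewrite /ext_pure -pure_bal mul1r -[pure _ _ _]/(ext_pure j (j c) a) pE YM Ysc mul_mx_scalar.
  - exact: Y1.
  - by rewrite -YM ext_pureM mulr1.
exists n, (fun x => Y (ext_pure j 1 x)), hX; apply: iso_mod_trans iM _.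
have YE s : Y s = rep_act (fun x => Y (ext_pure j 1 x)) s.
  elim/ext_ind: s => [|a x|s t IH IH'].
  - by rewrite (rep_act0 hX); apply: (addrI (Y 0)); rewrite -YD !addr0.
  - by rewrite (rep_act_pure hX) pE YM Ysc mul_mx_scalar.
  - by rewrite YD (rep_actD hX) IH IH'.
apply/(rmod_iso _ _ Ysc (rep_act_sc hX)).
by exists 1%:M, 1%:M; split=> [s|s||]; rewrite ?mulmx1 ?mul1mx // YE.
Qed.

End ExtRep.
Notation emod hX := (rmod (rep_act_is_act hX)).

Section ExtMod.
Variables (F L K : fieldType) (i : {rmorphism F -> L}).
Variables (l : {rmorphism L -> K}) (iota : {rmorphism F -> K}).
Hypothesis li : forall c, l (i c) = iota c.
Variables (A : falgType F).

Lemma rep_map n (X : A -> 'M[L]_n) : is_rep i X -> is_rep iota (fun a => map_mx l (X a)).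
Proof.
move=> [XD XZ X1 XM]; split=> [a b|c a||a b].
- by rewrite XD map_mxD.
- by rewrite XZ map_mxZ li.
- by rewrite X1 map_mx1.
- by rewrite XM map_mxM.
Qed.

(** This is the identification of the tensor product of [K] and [L^n] with [K^n]; the inverse [g] is
    given on the standard basis. *)
Lemma ext_mod_emod (M0 : lmodType (ext_alg i A)) n (X : A -> 'M[L]_n) (hX : is_rep i X) :
  iso_mod M0 (emod hX) -> iso_mod (ext_mod li M0) (emod (rep_map hX)).
Proof.
move=> [th [th' thK th'K]].
pose th1 (m : M0) : 'rV[L]_n := th m.
have thD m m' : th1 (m + m') = th1 m + th1 m' by rewrite /th1 linearD.
have thZ s m : th1 (s *: m) = th1 m *m rep_act X s by rewrite /th1 linearZ.
pose f0 (b : K) (m : restr (in_alg (ext_alg i A)) M0) : 'rV[K]_n := b *: map_mx l (th1 m).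
have bal : balanced l f0.
  split=> [m a b|a m m'|a c m]; rewrite /f0.
  - by rewrite scalerDl.
  - by rewrite thD map_mxD scalerDr.
  - by rewrite restr_scaleE thZ rep_act_sc // mul_mx_scalar map_mxZ scalerA.
pose f (t : ext_mod li M0) : 'rV[K]_n := tlift (j := l) f0 t.
have fP b m : f (mod_pure li b m) = b *: map_mx l (th1 m) by apply: (tlift_pure bal).
have fD t t' : f (t + t') = f t + f t' by apply: (tliftD bal).
have f00 : f 0 = 0 by apply: (tlift0 bal).
have fZ s t : f (s *: t) = f t *m rep_act (fun a => map_mx l (X a)) s.
  have rX := rep_map hX; elim/ext_ind: s => [|a x|s s' IH IH'].
  - by rewrite scale0r f00 rep_act0 // mulmx0.
  - elim/mod_ind: t => [|b m|t t' IH IH'].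
    + by rewrite scaler0 f00 mul0mx.
    + rewrite scale_mod_pure !fP thZ !rep_act_pure // scale1r map_mxM.
      by rewrite -scalemxAl -scalemxAr scalerA mulrC.
    + by rewrite scalerDr !fD IH IH' mulmxDl.
  - by rewrite scalerDl fD rep_actD // mulmxDr IH IH'.
pose g (u : 'rV[K]_n) : ext_mod li M0 := \sum_r mod_pure li (u 0 r) (th' (row r 1%:M : 'rV[L]_n)).
have gD u u' : g (u + u') = g u + g u'.
  rewrite /g -big_split; apply: eq_bigr => r _.
  by rewrite mxE /mod_pure pureDl.
apply: (@iso_modI _ _ (emod (rep_map hX)) f g) => [s x y|t|u].
- by rewrite fD fZ rmod_scaleE.
- elim/mod_ind: t => [|b m|t t' IH IH'].
  + by rewrite f00; apply: (addrI (g 0)); rewrite -gD !addr0.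
  + rewrite fP /g.
    have pD (m1 m2 : M0) : mod_pure li b (m1 + m2) = mod_pure li b m1 + mod_pure li b m2.
      exact: pureDr.
    have p0 : mod_pure li b (0 : M0) = 0.
      by apply: (addrI (mod_pure li b (0 : M0))); rewrite -pD !addr0.
    have mE : m = \sum_r in_alg (ext_alg i A) (th1 m 0 r) *: th' (row r 1%:M : 'rV[L]_n).
      apply: (can_inj thK); rewrite linear_sum; rewrite -[LHS](mulmx1 (th1 m)).
      rewrite mulmx_sum_row; apply: eq_bigr => r _.
      by rewrite linearZ /= th'K rmod_scaleE rep_act_sc // mul_mx_scalar.
    rewrite {2}mE (big_morph _ pD p0); apply: eq_bigr => r _.
    rewrite !mxE /mod_pure pure_bal; congr (pure _ _ _).
  + by rewrite fD gD IH IH'.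
- rewrite /g (big_morph f fD f00) -[RHS]mulmx1 mulmx_sum_row; apply: eq_bigr => r _.
  by rewrite fP /th1 th'K map_row map_mx1.
Qed.

End ExtMod.

(** * Additive generators from finite representation type *)

Section Generator.
Variables (F : fieldType) (A : falgType F).
Local Notation is_repF := (is_rep (idfun : {rmorphism F -> F})).

Lemma rep_is_act n (X : A -> 'M[F]_n) : is_repF X -> is_act X.
Proof. by case. Qed.

Lemma rep_sc n (X : A -> 'M[F]_n) : is_repF X -> forall c, X (in_alg A c) = c%:M.
Proof. by move=> [_ XZ X1 _] c; rewrite /= XZ X1 scalemx1. Qed.

Lemma rep_indecomposable n (X : A -> 'M[F]_n) (hX : is_act X) : is_repF X -> (0 < n)%N ->
  (forall e, hom X X e -> e *m e = e -> e = 0 \/ e = 1%:M) -> indecomposable (rmod hX).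
Proof.
move=> rX n0 idem; split.
  move=> z; have := z (const_mx 1 : 'rV_n) => /rowP/(_ (Ordinal n0)); rewrite !mxE => /eqP.
  by rewrite oner_eq0.
move=> P Q [f [g fg gf]].
have fl (a : A) x y : f (a *: x + y) = a *: f x + f y by rewrite linearP.
have gl (a : A) x y : g (a *: x + y) = a *: g x + g y.
  by apply: (can_inj fg); rewrite linearP !gf.
pose e0 (u : rmod hX) : rmod hX := g ((f u).1, 0).
have e0l (a : A) u v : e0 (a *: u + v) = a *: e0 u + e0 v.
  rewrite /e0 -gl fl; congr (g _); rewrite -[RHS]/(_, _) /=; congr (_, _).
  by rewrite scaler0 addr0.
have [e eE] := linear_fun e0l.
have [T eT hT] := rmod_linear e (rep_sc rX) (rep_sc rX).
have e0T (u : 'rV_n) : u *m T = e0 u by rewrite -eE eT.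
have TT : T *m T = T.
  by apply: row_ext => v; rewrite mulmxA !e0T /e0 gf.
have g0 : g 0 = 0 by apply: (addrI (g 0)); have := gl 1 0 0; rewrite !scale1r !addr0 => <-.
have zeroP : T = 0 -> zero_mod P.
  move=> T0 p; have := e0T (g (p, 0)); rewrite T0 mulmx0 /e0 gf /= => /(congr1 f).
  by rewrite gf -[f _]/(f (0 : rmod hX)) linear0 => -[].
have zeroQ : T = 1%:M -> zero_mod Q.
  move=> T1 p; have := e0T (g (0, p)); rewrite T1 mulmx1 /e0 gf /= => /(congr1 f).
  by rewrite !gf => -[].
by case: (idem T hT TT) => h; [left; apply: zeroP|right; apply: zeroQ].
Qed.

Lemma in_add_iso m n p (N : A -> 'M[F]_n) (X : A -> 'M[F]_m) (Y : A -> 'M[F]_p) :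
  rep_iso X Y -> in_add N Y -> in_add N X.
Proof.
move=> [f [g [hf hg fg _]]] hN; apply: in_add_trans hN _.
exists unit, (fun=> f), (fun=> g); split=> //.
by rewrite big_const cardT enumT unlock /= addr0.
Qed.

Lemma in_add_split n p1 p2 d (N : A -> 'M[F]_d) (X : A -> 'M[F]_n) (Y1 : A -> 'M[F]_p1)
    (Y2 : A -> 'M[F]_p2) al1 be1 al2 be2 :
  hom X Y1 al1 -> hom Y1 X be1 -> hom X Y2 al2 -> hom Y2 X be2 ->
  al1 *m be1 + al2 *m be2 = 1%:M -> in_add N Y1 -> in_add N Y2 -> in_add N X.
Proof.
move=> ha1 hb1 ha2 hb2 e [I1 [a1 [b1 [h1 h1' e1]]]] [I2 [a2 [b2 [h2 h2' e2]]]].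
exists (I1 + I2)%type, (fun c => match c with inl c => al1 *m a1 c | inr c => al2 *m a2 c end),
  (fun c => match c with inl c => b1 c *m be1 | inr c => b2 c *m be2 end); split.
- by case=> c; [apply: homM ha1 (h1 c)|apply: homM ha2 (h2 c)].
- by case=> c; [apply: homM (h1' c) hb1|apply: homM (h2' c) hb2].
rewrite big_sumType /= -e; congr (_ + _).
  rewrite (eq_bigr (fun c => al1 *m (a1 c *m b1 c) *m be1)) => [|c _]; last by rewrite !mulmxA.
  by rewrite -mulmx_suml -mulmx_sumr e1 mulmx1.
rewrite (eq_bigr (fun c => al2 *m (a2 c *m b2 c) *m be2)) => [|c _]; last by rewrite !mulmxA.
by rewrite -mulmx_suml -mulmx_sumr e2 mulmx1.
Qed.

Lemma rep_dsum n (T : 'I_n -> {m : nat & A -> 'M[F]_m}) : (forall i, is_repF (projT2 (T i))) ->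
  exists d (N : A -> 'M[F]_d), is_repF N /\ forall i, in_add N (projT2 (T i)).
Proof.
elim: n T => [|n IH] T rT.
  exists 0%N, (fun=> 0); split=> [|[]//].
  by split=> *; apply/matrixP => -[].
have [|d [N' [rN' aN']]] := IH (fun i => T (lift ord0 i)); first by move=> i; apply: rT.
case E: (T ord0) (rT ord0) => [m X] /= rX.
pose N a : 'M[F]_(m + d) := block_mx (X a) 0 0 (N' a).
have rN : is_repF N.
  have [XD XZ X1 XM] := rX; have [YD YZ Y1 YM] := rN'; split=> [a b|c a||a b]; rewrite /N.
  - by rewrite add_block_mx XD YD !addr0.
  - by rewrite scale_block_mx XZ YZ !scaler0.
  - by rewrite X1 Y1 -scalar_mx_block.
  - by rewrite mulmx_block XM YM !mulmx0 !mul0mx !addr0 add0r.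
have aX : in_add N X.
  exists unit, (fun=> row_mx 1%:M 0), (fun=> col_mx 1%:M 0); split=> [_ a|_ a|].
  - by rewrite mul_row_block mul_mx_row !mulmx1 !mul1mx !mulmx0 !mul0mx !addr0.
  - by rewrite mul_block_col mul_col_mx !mulmx1 !mul1mx !mulmx0 !mul0mx !addr0.
  - by rewrite big_const cardT enumT unlock /= addr0 mul_row_col mulmx1 mulmx0 addr0.
have aN : in_add N N'.
  exists unit, (fun=> row_mx 0 1%:M), (fun=> col_mx 0 1%:M); split=> [_ a|_ a|].
  - by rewrite mul_row_block mul_mx_row !mulmx1 !mul1mx !mulmx0 !mul0mx !add0r.
  - by rewrite mul_block_col mul_col_mx !mulmx1 !mul1mx !mulmx0 !mul0mx !add0r.
  - by rewrite big_const cardT enumT unlock /= addr0 mul_row_col mulmx1 mulmx0 add0r.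
exists (m + d)%N, N; split=> // i; case: (unliftP ord0 i) => [i' ->|->].
  exact: in_add_trans aN (aN' i').
by rewrite E.
Qed.

(** The generator is the direct sum of the listed indecomposables; a representation that is not
    indecomposable is split by an idempotent into smaller ones. *)
Theorem generator_exists : finite_rep_type A ->
  exists d (N : A -> 'M[F]_d), is_repF N /\ generator N.
Proof.
move=> [n [S hS]].
pose good i m (X : A -> 'M[F]_m) := exists hX : is_act X, iso_mod (rmod hX) (S i).
(* The list may contain modules that are not finite-dimensional; an index to which no representation
   corresponds receives the zero one. *)
have ex i : exists T : {m : nat & A -> 'M[F]_m}, is_repF (projT2 T) /\
    forall m (X : A -> 'M[F]_m), is_repF X -> good i m X -> good i _ (projT2 T).
  have [[m [X [rX gX]]]|no] := pselect (exists m (X : A -> 'M[F]_m), is_repF X /\ good i m X).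
    by exists (existT _ m X).
  exists (existT _ 0%N (fun=> 0)); split=> [|m X rX gX]; last by case: no; exists m, X.
  by split=> *; apply/matrixP => -[].
have [T hT] := choice ex.
have [d [N [rN aN]]] := rep_dsum (fun i => (hT i).1).
exists d, N; split=> // m X rX.
have [r le] := ubnP m; elim: r m le X rX => // r IH m le X rX.
have [m0|m0] := posnP m.
  exists void, (fun=> 0), (fun=> 0); split=> //.
  by rewrite big1 //; move: m m0 {le X rX} => _ ->; apply/matrixP => -[].
have [[e [he ee e0 e1]]|indec] := pselect (exists e, [/\ hom X X e, e *m e = e, e <> 0 & e <> 1%:M]).
  have ee' : (1%:M - e) *m (1%:M - e) = 1%:M - e.
    by rewrite mulmxBr mulmx1 mulmxBl mul1mx ee subrr subr0.
  have he' : hom X X (1%:M - e) by apply: homB => //; apply: hom1.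
  have small (f : 'M[F]_m) : f *m f = f -> f <> 1%:M -> (\rank f < m)%N.
    move=> ff f1; rewrite ltn_neqAle rank_leq_row andbT; apply/negP => /eqP rf; apply: f1.
    have fu : row_free f by apply/eqP.
    by apply: (row_free_inj fu); rewrite ff mul1mx.
  have [C1 [B1 [CB1 BC1 _ _]]] := split_idem ee.
  have [C2 [B2 [CB2 BC2 _ _]]] := split_idem ee'.
  have [|Y1 hC1 hB1] := sub_rep rX BC1; first by rewrite CB1.
  have [|Y2 hC2 hB2] := sub_rep rX BC2; first by rewrite CB2.
  apply: (in_add_split hC1 hB1 hC2 hB2); first by rewrite CB1 CB2 addrC subrK.
    by apply: IH => //; rewrite -ltnS in le; apply: leq_trans (small _ ee e1) _.
  apply: IH => //; apply: leq_trans (small _ ee' _) _ => // h; apply: e0.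
  by rewrite -[e]opprK -[- e](addKr 1%:M) h addNr oppr0.
have hX := rep_is_act rX.
have [i iX] : exists i, iso_mod (rmod hX) (S i).
  apply: hS; first exact: rmod_fin_gen (rep_sc rX).
  apply: (rep_indecomposable hX rX m0) => e he ee.
  have [->|e0] := pselect (e = 0); first by left.
  by right; apply: contrapT => e1; apply: indec; exists e.
have [hY iY] : good i _ (projT2 (T i)) by apply: (hT i).2 rX _; exists hX.
have := iso_mod_trans iX (iso_mod_sym iY).
move/(rmod_iso hX hY (rep_sc rX) (rep_sc (hT i).1)) => iso.
exact: in_add_iso iso (aN i).
Qed.

End Generator.

Lemma minimal_generator (F : fieldType) (A : falgType F) : finite_rep_type A ->
  exists d (N : A -> 'M[F]_d), [/\ is_rep idfun N, generator N &
    forall d' (N' : A -> 'M[F]_d'), is_rep idfun N' -> generator N' -> (d <= d')%N].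
Proof.
move=> A_frt; pose Q d := `[< exists N : A -> 'M[F]_d, is_rep idfun N /\ generator N >].
have exQ : exists d, Q d.
  by have [d [N rN]] := generator_exists A_frt; exists d; apply/asboolP; exists N.
case: (ex_minnP exQ) => d /asboolP[N [rN gN]] min; exists d, N; split=> // d' N' rN' gN'.
by apply: min; apply/asboolP; exists N'.
Qed.

Lemma field_of_definition_descends (F K : fieldType) (iota : {rmorphism F -> K}) (A : falgType F)
    (M : lmodType (ext_alg iota A)) n (X : A -> 'M[K]_n) (hX : is_rep iota X) (E : interfield iota) :
  iso_mod M (emod hX) -> field_of_definition M E <-> descends E X.
Proof.
move=> iM; split=> [[M0 [fg iM0]]|[m [X0 [hX0 iso]]]].
  have [m [X0 [hX0 i0]]] := emod_exists fg.
  exists m, X0; split=> //.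
  apply/(emod_iso hX (rep_map (if_injK E) hX0)).
  apply: iso_mod_trans (iso_mod_sym iM) _; apply: iso_mod_trans iM0 _.
  exact: ext_mod_emod.
exists (emod hX0); split; first exact: emod_fin_gen.
apply: iso_mod_trans iM _; apply: (@iso_mod_trans _ _ (emod (rep_map (if_injK E) hX0))).
  exact/emod_iso.
apply: iso_mod_sym; apply: ext_mod_emod; apply: (@iso_modI _ _ _ id id) => //.
Qed.

Theorem theorem1p2 (F : fieldType) (F_C1 : C1_field F)
    (A : falgType F) (A_frt : finite_rep_type A)
    (K : fieldType) (iota : {rmorphism F -> K})
    (M : lmodType (ext_alg iota A)) (M_fg : fin_gen M)
    (F_pc : perfectly_closed iota) :
  exists K0 : interfield iota,
    minimal_field_of_definition M K0 /\ finite_degree K0.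
Proof.
have [d [N [N_rep N_gen N_min]]] := minimal_generator A_frt.
have [n [X [hX iM]]] := emod_exists M_fg.
have [K0 [K0X fin min]] := rep_minimal_field F_C1 N_rep N_gen N_min F_pc hX.
exists K0; split=> //; split=> [|L defL].
  by apply/(field_of_definition_descends _ iM).
by apply: min; apply/(field_of_definition_descends _ iM).
Qed.
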